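(* For every finite-dimensional real Hilbert space $E$, every skew-adjoint operator $K$ on $E$ and every symmetric operator $S$ on $E$, $$\mathfrak c_A^E(K)=\|K\|_{\mathcal S_2},\qquad\mathfrak c_Q^E(S)=\|S\|_{\rm op}.$$ Thus the dual state gauges are exactly the Hilbert--Schmidt and trace norms: for a separable real Hilbert space $H$, finite-rank skew-adjoint $a$ and finite-rank self-adjoint $q$ on $H$ supported on a finite-dimensional $E\subset H$, $\sup\{|\operatorname{Tr}(K^*a)|:\mathfrak c_A^E(K)\le1\}=\|a\|_{\mathcal S_2}$ and $\sup\{|\operatorname{Tr}(Sq)|:\mathfrak c_Q^E(S)\le1\}=\|q\|_{\mathcal S_1}$; and the compatible infinite-dimensional response completion is $H\times\mathcal S_2(H)_{\rm sk}\times\mathcal S_1(H)_{\rm sa}$ (the completion of $H\times\{\text{finite-rank skew-adjoint}\}\times\{\text{finite-rank self-adjoint}\}$ in these gauges). The calibration is orthogonally natural (invariant under conjugation by orthogonal isomorphisms $E\to F$). For increasing finite-rank orthogonal projections $P_n\uparrow I$ on $H$, every $K\in\mathcal S_2(H)_{\rm sk}$ and every $S\in\mathcal L(H)_{\rm sa}$, $$\sup_n\mathfrak c_A^{P_nH}(P_nKP_n)=\|K\|_{\mathcal S_2},\qquad\sup_n\mathfrak c_Q^{P_nH}(P_nSP_n)=\|S\|_{\rm op}.$$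
   Context: For $E=\{0\}$ set $\mathfrak c_A^E(0)=\mathfrak c_Q^E(0)=0$. For $E\neq\{0\}$ finite dimensional, let $B^E$ be standard $E$-valued Brownian motion on $[0,1]$, $\beta$ a standard real Brownian motion, and for a unit vector $e\in E$ put $B^e_t=\beta_te$. For skew-adjoint $K$ and symmetric $S$ on $E$ define (It\^o integrals) $$\mathfrak c_A^E(K)=\Bigl(2\,\mathbb E\Bigl|\tfrac12\int_0^1\operatorname{Tr}[K^*(B^E_t\otimes dB^E_t-dB^E_t\otimes B^E_t)]\Bigr|^2\Bigr)^{1/2},$$ $$\mathfrak c_Q^E(S)=\sup_{\|e\|=1}\Bigl\|\operatorname{Tr}[S(B^e_1\otimes B^e_1)]-\int_0^1\operatorname{Tr}[S(B^e_t\otimes dB^e_t+dB^e_t\otimes B^e_t)]\Bigr\|_{L^2}.$$ Here $x\otimes y$ is $h\mapsto\langle y,h\rangle x$; $\mathcal S_1,\mathcal S_2$ are trace-class and Hilbert--Schmidt operators; sk, sa denote skew-adjoint and self-adjoint. *)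

(* Defs.v *)
From HB Require Import structures.
From mathcomp Require Import all_boot all_order all_algebra.
From mathcomp Require Import all_classical all_reals all_analysis.

Set Implicit Arguments.
Unset Strict Implicit.
Unset Printing Implicit Defensive.

Import Order.TTheory GRing.Theory Num.Theory.
Import numFieldNormedType.Exports.

Local Open Scope classical_set_scope.
Local Open Scope ring_scope.

HB.mixin Record NormedModule_hasInner (R : realType) E & NormedModule R E := {
  inner : E -> E -> R ;
  innerC : forall x y, inner x y = inner y x ;
  innerDl : forall x y z, inner (x + y) z = inner x z + inner y z ;
  innerZl : forall (a : R) x y, inner (a *: x) y = a * inner x y ;
  inner_normE : forall x, inner x x = `|x| ^+ 2
}.

#[short(type="innerProductType")]
HB.structure Definition InnerProduct (R : realType) :=
  {E of NormedModule R E & NormedModule_hasInner R E}.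

#[short(type="hilbertType")]
HB.structure Definition Hilbert (R : realType) :=
  {E of InnerProduct R E & CompleteNormedModule R E}.

Section RealLine.
Variable R : realType.
Implicit Types x y z : R^o.
Let mul_inner x y : R := (x : R) * (y : R).
Let mul_innerC x y : mul_inner x y = mul_inner y x.
Proof. exact: mulrC. Qed.
Let mul_innerDl x y z : mul_inner (x + y) z = mul_inner x z + mul_inner y z.
Proof. exact: mulrDl. Qed.
Let mul_innerZl (a : R) x y : mul_inner (a *: x) y = a * mul_inner x y.
Proof. by rewrite /mul_inner /GRing.scale /= mulrA. Qed.
Let mul_inner_normE x : mul_inner x x = `|x| ^+ 2.
Proof. by rewrite /mul_inner real_normK ?num_real// expr2. Qed.
HB.instance Definition _ := NormedModule_hasInner.Build R R^o
  mul_innerC mul_innerDl mul_innerZl mul_inner_normE.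
End RealLine.

(* A finite-dimensional inner product space is complete, so an
   [innerProductType] satisfying [findim] is a finite-dimensional Hilbert space. *)
Definition findim (R : realType) (E : lmodType R) : Prop :=
  exists (n : nat) (e : 'I_n -> E),
    forall x, exists c : 'I_n -> R, x = \sum_(i < n) c i *: e i.

Definition separable_space (T : topologicalType) : Prop :=
  exists2 A : set T, countable A & dense A.

Record lsubspace (R : realType) (H : innerProductType R) := LSubspace {
  subspace_pred : {pred H} ;
  subspace_closed : submod_closed subspace_pred
}.

Record subspace_type (R : realType) (H : innerProductType R)
    (E : lsubspace H) := SubspaceElt {
  subspace_val : H ;
  subspace_valP : subspace_val \in subspace_pred E
}.
Coercion subspace_type : lsubspace >-> Sortclass.

Section SubspaceInstances.
Variables (R : realType) (H : innerProductType R) (E : lsubspace H).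

HB.instance Definition _ :=
  GRing.isSubmodClosed.Build R H (subspace_pred E) (subspace_closed E).
HB.instance Definition _ := [isSub for @subspace_val R H E].
HB.instance Definition _ := [Choice of subspace_type E by <:].
HB.instance Definition _ :=
  [SubChoice_isSubLmodule of subspace_type E by <:].

Implicit Types x y z : E.

Let sub_norm x : R := `|val x|.
Let sub_normD x y : sub_norm (x + y) <= sub_norm x + sub_norm y.
Proof. exact: ler_normD. Qed.
Let sub_normZ (a : R) x : sub_norm (a *: x) = `|a| * sub_norm x.
Proof. exact: normrZ. Qed.
Let sub_norm0 x : sub_norm x = 0 -> x = 0.
Proof. by move=> /normr0_eq0 x0; apply/val_inj. Qed.
HB.instance Definition _ := Lmodule_isNormed.Build R (subspace_type E)
  sub_normD sub_normZ sub_norm0.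

Let sub_inner x y : R := inner (val x) (val y).
Let sub_innerC x y : sub_inner x y = sub_inner y x.
Proof. exact: innerC. Qed.
Let sub_innerDl x y z : sub_inner (x + y) z = sub_inner x z + sub_inner y z.
Proof. exact: innerDl. Qed.
Let sub_innerZl (a : R) x y : sub_inner (a *: x) y = a * sub_inner x y.
Proof. exact: innerZl. Qed.
Let sub_inner_normE x : sub_inner x x = `|x| ^+ 2.
Proof. exact: inner_normE. Qed.
HB.instance Definition _ := NormedModule_hasInner.Build R (subspace_type E)
  sub_innerC sub_innerDl sub_innerZl sub_inner_normE.

(* The operator on [E] obtained by restricting [T] ([0] is a dummy value, never
   used when the range of [T] lies in [E]). *)
Definition restr (T : H -> H) : subspace_type E -> subspace_type E :=
  fun x => insubd (0 : subspace_type E) (T (subspace_val x)).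

Definition supported_on (T : H -> H) : Prop :=
  (forall x : H, T x \in subspace_pred E) /\
  (forall x : H, (forall y : E, inner (subspace_val y) x = 0) -> T x = 0).

End SubspaceInstances.

Section RangeSubspace.
Variables (R : realType) (H : innerProductType R) (P : {linear H -> H}).

Definition range_pred : {pred H} := [pred x | `[< exists y, x = P y >]].

Lemma range_pred_closed : submod_closed range_pred.
Proof.
split; first by apply/asboolP; exists 0; rewrite linear0.
move=> a _ _ /asboolP[x ->] /asboolP[y ->].
by apply/asboolP; exists (a *: x + y); rewrite linearP.
Qed.

Definition rangesp : lsubspace H := LSubspace range_pred_closed.

End RangeSubspace.

Section Operators.
Variables (R : realType) (H : innerProductType R).
Implicit Types (T K S A : H -> H) (B : set H).

Definition tens (x y : H) : H -> H := fun h => inner y h *: x.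

Definition bounded_op T : Prop := linear T /\ continuous T.

Definition adj T : H -> H :=
  fun y => xget 0 [set z | forall x, inner (T x) y = inner x z].

Definition skew_adjoint K : Prop :=
  bounded_op K /\ forall x y, inner (K x) y = - inner x (K y).

Definition self_adjoint S : Prop :=
  bounded_op S /\ forall x y, inner (S x) y = inner x (S y).

Definition positive_op A : Prop :=
  self_adjoint A /\ forall x, 0 <= inner (A x) x.

Definition finite_rank T : Prop :=
  exists (n : nat) (e : 'I_n -> H),
    forall x, exists c : 'I_n -> R, T x = \sum_(i < n) c i *: e i.

Definition orthogonal_projection T : Prop :=
  self_adjoint T /\ forall x, T (T x) = T x.

(* A maximal orthonormal set. *)
Definition is_onb B : Prop :=
  [/\ forall e, B e -> `|e| = 1,
      forall e f, B e -> B f -> e <> f -> inner e f = 0 &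
      forall x, (forall e, B e -> inner e x = 0) -> x = 0].

Definition onb : set H := xget set0 is_onb.

(* Only meaningful on a finite-dimensional space, where [onb] is finite. *)
Definition tr T : R := \sum_(e \in onb) inner e (T e).

Definition op_norm T : \bar R := ereal_sup [set `|T x|%:E | x in [set x | `|x| <= 1]].

Definition hs_norm T : \bar R :=
  ((\esum_(e in onb) (`|T e| ^+ 2)%:E) `^ 2^-1)%E.

Definition hilbert_schmidt T : Prop := bounded_op T /\ (hs_norm T < +oo)%E.

Definition is_abs_op T A : Prop :=
  positive_op A /\ (forall x, A (A x) = adj T (T x)).

(* [|T|]: the positive square root of [T^* T], which is unique. *)
Definition abs_op T : H -> H := xget (fun=> 0) (is_abs_op T).

Definition trace_norm T : \bar R := \esum_(e in onb) (inner e (abs_op T e))%:E.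

Definition trace_class T : Prop :=
  [/\ bounded_op T, exists A, is_abs_op T A & (trace_norm T < +oo)%E].

End Operators.

Section Brownian.
Variables (R : realType) (E : innerProductType R).

Definition borel : set (set E) := <<s @open E >>.

Section Process.
Context d (Omega : measurableType d) (P : probability Omega R).
Implicit Type W : R -> Omega -> E.

(* The natural filtration of [W]. *)
Definition past W (t : R) : set (set Omega) :=
  <<s [set A | exists s U, [/\ 0 <= s <= t, borel U & A = W s @^-1` U]] >>.

Definition is_brownian W : Prop :=
  [/\ forall t, 0 <= t <= 1 -> forall U, borel U -> measurable (W t @^-1` U),
      {ae P, forall w, W 0 w = 0 /\ {within `[0, 1], continuous (W ^~ w)}},
      forall s t, 0 <= s < t -> t <= 1 ->
        forall A U, past W s A -> borel U ->
        P (A `&` [set w | U (W t w - W s w)]) =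
          (P A * P [set w | U (W t w - W s w)%R])%E &
      forall s t, 0 <= s < t -> t <= 1 ->
        forall e : E, `|e| = 1 -> forall U : set R, measurable U ->
        P [set w | U (inner e (W t w - W s w))] =
          normal_prob 0 (Num.sqrt (t - s)) U].

End Process.

Record brownian := Brownian {
  bm_disp : measure_display ;
  bm_space : measurableType bm_disp ;
  bm_prob : probability bm_space R ;
  bm :> R -> bm_space -> E ;
  bmP : is_brownian bm_prob bm
}.

End Brownian.

Section Ito.
Variables (R : realType) (E : innerProductType R).
Context d (Omega : measurableType d) (P : probability Omega R).
Variable X : R -> Omega -> E.

(* Integrands take values in the linear functionals on [E], so that
   [\int_0^1 Tr [K^* (B_t (x) dB_t - dB_t (x) B_t)]] is the integral against [B]
   of the functional [y |-> Tr [K^* (B_t (x) y - y (x) B_t)]].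
   A simple process equals [sp_xi i] on [`]sp_t i, sp_t i.+1]], [i < sp_n]. *)
Record simple_process := SimpleProcess {
  sp_n : nat ;
  sp_t : nat -> R ;
  sp_xi : nat -> Omega -> E -> R
}.
Implicit Type s : simple_process.

Definition simple_adapted s : Prop :=
  [/\ sp_t s 0%N = 0, sp_t s (sp_n s) = 1,
      forall i, (i < sp_n s)%N -> sp_t s i < sp_t s i.+1,
      forall i w, (i < sp_n s)%N -> scalar (sp_xi s i w) &
      forall i y, (i < sp_n s)%N ->
        (forall U : set R, measurable U ->
           past X (sp_t s i) [set w | U (sp_xi s i w y)]) /\
        ('E_P[fun w => (sp_xi s i w y ^+ 2)%R] < +oo)%E].

Definition simple_val s (t : R) (w : Omega) (y : E) : R :=
  \sum_(i < sp_n s) \1_(`]sp_t s i, sp_t s i.+1]) t * sp_xi s i w y.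

Definition simple_integral s (w : Omega) : R :=
  \sum_(i < sp_n s) sp_xi s i w (X (sp_t s i.+1) w - X (sp_t s i) w).

(* The [L^2] extension of [simple_integral].  Since [E] is finite-dimensional,
   convergence in [L^2([0,1] x Omega; E^* )] is convergence for each [y]. *)
Definition is_ito (Phi : R -> Omega -> E -> R) (I : Omega -> R) : Prop :=
  [/\ measurable_fun setT I, ('E_P[fun w => (I w ^+ 2)%R] < +oo)%E &
      exists s : nat -> simple_process,
        [/\ forall k, simple_adapted (s k),
            forall y, (fun k =>
              \int[lebesgue_measure]_(t in `[0%R, 1%R])
                'E_P[fun w => ((simple_val (s k) t w y - Phi t w y) ^+ 2)%R])%E
              @ \oo --> 0%E &
            (fun k => 'E_P[fun w => ((simple_integral (s k) w - I w) ^+ 2)%R])%E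
              @ \oo --> 0%E]].

(* Determined up to almost sure equality. *)
Definition ito (Phi : R -> Omega -> E -> R) : Omega -> R :=
  xget (fun=> 0) (is_ito Phi).

End Ito.

Section Calibration.
Variable R : realType.

Definition cA (E : innerProductType R) (B : brownian E) (K : E -> E) : \bar R :=
  if `[< forall x : E, x = 0 >] then 0%E else
  ((2%:E * 'E_(bm_prob B)[fun w => (`|2^-1 *
     ito (bm_prob B) B
       (fun t w y => tr (adj K \o (tens (B t w) y - tens y (B t w)))) w| ^+ 2)%R])
   `^ 2^-1)%E.

(* [B^e_t = beta_t e] *)
Definition line_process (E : innerProductType R) (b : brownian R^o) (e : E) :
  R -> bm_space b -> E := fun t w => (b t w : R) *: e.
Arguments line_process {E} b e.

Definition quadratic_defect (b : brownian R^o) (E : innerProductType R)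
    (S : E -> E) (e : E) (w : bm_space b) : R :=
  let Be := line_process b e in
  tr (S \o tens (Be 1 w) (Be 1 w)) -
  ito (bm_prob b) Be
    (fun t w' y => tr (S \o (tens (Be t w') y + tens y (Be t w')))) w.
Arguments quadratic_defect b {E} S e w.

Definition cQ (b : brownian R^o) (E : innerProductType R) (S : E -> E) : \bar R :=
  if `[< forall x : E, x = 0 >] then 0%E else
  ereal_sup [set ('N[bm_prob b]_(2%:E)[EFin \o quadratic_defect b S e])%E
    | e in [set e : E | `|e| = 1]].

Definition dualA (E : innerProductType R) (B : brownian E) (a : E -> E) : \bar R :=
  ereal_sup [set `|tr (adj K \o a)|%:E
    | K in [set K | skew_adjoint K /\ (cA B K <= 1)%E]].

Definition dualQ (b : brownian R^o) (E : innerProductType R) (q : E -> E) : \bar R :=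
  ereal_sup [set `|tr (S \o q)|%:E
    | S in [set S : E -> E | self_adjoint S /\ (cQ b S <= 1)%E]].

End Calibration.

(* [X], with norm [N], is a completion of the subspace [D] with gauge [g]. *)
Definition is_completion (R : realType) (V : lmodType R)
    (D : set V) (g : V -> \bar R) (X : set V) (N : V -> \bar R) : Prop :=
  [/\ [/\ D 0, forall (a : R) x y, D x -> D y -> D (a *: x + y),
          X 0 & forall (a : R) x y, X x -> X y -> X (a *: x + y)],
      [/\ forall x, X x -> N x \is a fin_num,
          forall x y, X x -> X y -> (N (x + y)%R <= N x + N y)%E,
          forall (a : R) x, X x -> N (a *: x) = (`|a|%:E * N x)%E &
          forall x, X x -> N x = 0%E -> x = 0],
      D `<=` X /\ forall x, D x -> N x = g x,
      forall x (eps : R), X x -> 0 < eps ->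
        exists2 y, D y & (N (x - y)%R < eps%:E)%E &
      forall u : nat -> V, (forall n, X (u n)) ->
        (forall eps : R, 0 < eps -> exists n0, forall m n,
           (n0 <= m)%N -> (n0 <= n)%N -> (N (u m - u n)%R < eps%:E)%E) ->
        exists2 x, X x & (fun n => N (u n - x)%R) @ \oo --> 0%E].

Section Response.
Variables (R : realType) (H : innerProductType R).

Definition response : lmodType R := (H * (H -> H) * (H -> H))%type.

Implicit Type x : response.

Definition response_fin : set response :=
  [set x | [/\ skew_adjoint x.1.2, finite_rank x.1.2,
               self_adjoint x.2 & finite_rank x.2]].

Definition response_full : set response :=
  [set x | [/\ skew_adjoint x.1.2, hilbert_schmidt x.1.2,
               self_adjoint x.2 & trace_class x.2]].

Definition response_norm x : \bar R :=
  maxe `|x.1.1|%:E (maxe (hs_norm x.1.2) (trace_norm x.2)).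

(* [E] is a finite-dimensional subspace supporting both operators of [x]. *)
Definition response_gauge (b : brownian R^o) (E : lsubspace H) (B : brownian E)
    x : \bar R :=
  maxe `|x.1.1|%:E (maxe (dualA B (restr x.1.2)) (dualQ b (restr (E := E) x.2))).

End Response.

(* Main.v *)
Require Import Defs.
From HB Require Import structures.
From mathcomp Require Import all_boot all_order all_algebra.
From mathcomp Require Import all_classical all_reals all_analysis.
From mathcomp Require Import measurable_realfun.
From mathcomp Require Import ring lra.
Set Implicit Arguments.
Unset Strict Implicit.
Unset Printing Implicit Defensive.
Import Order.TTheory GRing.Theory Num.Theory.
Import numFieldNormedType.Exports.
Local Open Scope classical_set_scope.
Local Open Scope ring_scope.
Import HBNNSimple.

(** The Brownian gauges are computed on a finite-dimensional space; the rest is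
    duality and approximation in Hilbert space.

    For skew [K] the integrand [Tr (adj K (B_t (x) y - y (x) B_t))] is the
    functional [y |-> -2 <K B_t, y>], linear in the coordinates of [B].  The
    coordinates of an increment of [B] are centred, uncorrelated, of variance
    [dt] and independent of the past, so discrete stochastic integrals are
    isometric ([transform_isometry]).  Hence the left-point sums of a linear
    integrand along a partition have second moment [C / 2] up to the sum of
    the squared mesh sizes, where [C] is the sum of the squares of the
    coefficients ([left_transform]).  Any simple processes approximating the
    integrand may be replaced by the left-point processes on their own
    partitions, and the approximation forces the mesh term to vanish
    ([ito_left_limit]); so the integral has second moment [C / 2]
    ([ito_second_moment]), and it exists because left-point sums on refined
    grids form a Cauchy sequence ([ito_exists]).  Here [C = 4 |K|^2] for the
    Hilbert-Schmidt norm, whence [cA_hs_norm].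

    For symmetric [S] and a unit vector [e], the left-point sums telescope to [<S
    e, e>] times the difference of [b_1^2] and the sum of the squared
    increments of [b]; that sum tends to [1] by the bound on Gaussian fourth
    moments.  Thus the integral is [<S e, e> (b_1^2 - 1)] ([ito_square]), the
    defect is the constant [<S e, e>], and the supremum over unit vectors is
    the operator norm, by polarization ([cQ_op_norm]).

    The dual of the Hilbert-Schmidt norm is given by Cauchy-Schwarz
    ([dualA_hs_norm]), that of the operator norm by an operator with the signs
    of the eigenvalues ([dualQ_trace_norm]).  The trace norm is handled
    through the spectral theorem for self-adjoint Hilbert-Schmidt operators
    ([spectral_hs]), which is proved by power iteration: it identifies the
    trace norm with the sum of the moduli of the eigenvalues
    ([trace_norm_eig]) and with the supremum of [\sum |<f, T f>|] over finite
    orthonormal families ([trace_norm_nuc]).  The latter form is subadditive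
    and lower semicontinuous, which gives completeness; truncated expansions
    give density ([hs_completion], [trace_completion]).  Passing between a
    space and a finite-dimensional subspace supporting the operators, or
    between isometric spaces, amounts to a choice of orthonormal bases, on
    which neither norm depends; and compressions by projections increasing to
    the identity recover both norms by lower semicontinuity. *)

(** * Inner products and orthonormal families *)

(** The common core of the Cauchy-Schwarz inequalities below, for forms that are
    only semidefinite. *)
Lemma discriminant_le (R : realType) (p q r : R) : 0 <= p -> 0 <= r ->
  (forall t, 0 <= p + 2 * t * q + t ^+ 2 * r) -> q ^+ 2 <= p * r.
Proof.
move=> p0 r00 key; have [r0|r0] := eqVneq r 0.
  have [q0|q0] := eqVneq q 0; first by rewrite q0 expr0n mulr_ge0.
  have := key (- (p + 1) / (2 * q)); rewrite r0 mulr0 addr0.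
  have -> : p + 2 * (- (p + 1) / (2 * q)) * q = -1 by field.
  by rewrite oppr_ge0 ler10.
have rp : 0 < r by rewrite lt_neqAle eq_sym r0.
have := key (- q / r); rewrite -(ler_pM2l rp) mulr0.
have -> : r * (p + 2 * (- q / r) * q + (- q / r) ^+ 2 * r) = p * r - q ^+ 2 by field.
by rewrite subr_ge0.
Qed.

Section InnerProduct.
Variables (R : realType) (E : innerProductType R).
Implicit Types (x y z : E) (a b : R) (s : seq E).

Lemma innerDr x y z : inner x (y + z) = inner x y + inner x z.
Proof. by rewrite innerC innerDl !(innerC _ x). Qed.
Lemma innerZr a x y : inner x (a *: y) = a * inner x y.
Proof. by rewrite innerC innerZl innerC. Qed.
Lemma inner0l x : inner 0 x = 0.
Proof. by rewrite -(scale0r x) innerZl mul0r. Qed.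
Lemma inner0r x : inner x 0 = 0.
Proof. by rewrite innerC inner0l. Qed.
Lemma innerNl x y : inner (- x) y = - inner x y.
Proof. by rewrite -scaleN1r innerZl mulN1r. Qed.
Lemma innerNr x y : inner x (- y) = - inner x y.
Proof. by rewrite innerC innerNl innerC. Qed.
Lemma innerBl x y z : inner (x - y) z = inner x z - inner y z.
Proof. by rewrite innerDl innerNl. Qed.
Lemma innerBr x y z : inner x (y - z) = inner x y - inner x z.
Proof. by rewrite innerDr innerNr. Qed.

Lemma inner_suml (I : Type) (r : seq I) (P : pred I) (F : I -> E) y :
  inner (\sum_(i <- r | P i) F i) y = \sum_(i <- r | P i) inner (F i) y.
Proof.
elim/big_rec2: _ => [|i u v _ <-]; first exact: inner0l.
by rewrite innerDl.
Qed.
Lemma inner_sumr (I : Type) (r : seq I) (P : pred I) (F : I -> E) y :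
  inner y (\sum_(i <- r | P i) F i) = \sum_(i <- r | P i) inner y (F i).
Proof. by rewrite innerC inner_suml; under eq_bigr do rewrite innerC. Qed.

Lemma norm_sq0 x : (`|x| ^+ 2 == 0) = (x == 0).
Proof. by rewrite sqrf_eq0 normr_eq0. Qed.

Lemma normD_sq x y : `|x + y| ^+ 2 = `|x| ^+ 2 + 2 * inner x y + `|y| ^+ 2.
Proof.
rewrite -!inner_normE innerDl !innerDr (innerC y x); ring.
Qed.
Lemma normB_sq x y : `|x - y| ^+ 2 = `|x| ^+ 2 - 2 * inner x y + `|y| ^+ 2.
Proof. by rewrite normD_sq normrN innerNr mulrN. Qed.

Lemma cauchy_schwarz x y : `|inner x y| <= `|x| * `|y|.
Proof.
have [->|y0] := eqVneq y 0; first by rewrite inner0r !normr0 mulr0.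
have ny : 0 < `|y| ^+ 2 by rewrite exprn_gt0// normr_gt0.
rewrite -(@ler_pXn2r _ 2%N) ?nnegrE ?mulr_ge0//.
have := sqr_ge0 (`|x - (inner x y / `|y| ^+ 2) *: y|).
rewrite normB_sq innerZr normrZ exprMn !real_normK ?num_real// exprMn => h.
rewrite -subr_ge0; move: (mulr_ge0 (ltW ny) h); congr (0 <= _).
by field; rewrite normr_eq0.
Qed.

Lemma inner_le x y : inner x y <= `|x| * `|y|.
Proof. exact: le_trans (ler_norm _) (cauchy_schwarz _ _). Qed.

Lemma inner_eq0P x : (forall y, inner y x = 0) -> x = 0.
Proof.
by move=> /(_ x); rewrite inner_normE => /eqP; rewrite norm_sq0 => /eqP.
Qed.

Lemma inner_inj x y : (forall z, inner z x = inner z y) -> x = y.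
Proof.
move=> h; apply/eqP; rewrite -subr_eq0; apply/eqP; apply: inner_eq0P => z.
by rewrite innerBr h subrr.
Qed.

Definition orthonormal (B : set E) : Prop :=
  (forall e, B e -> `|e| = 1) /\
  (forall e f, B e -> B f -> e <> f -> inner e f = 0).

Lemma on_norm (B : set E) e : orthonormal B -> B e -> `|e| = 1.
Proof. by move=> [h _]; exact: h. Qed.
Lemma on_ortho (B : set E) e f : orthonormal B -> B e -> B f -> e <> f -> inner e f = 0.
Proof. by move=> [_ h]; exact: h. Qed.

(** Finite orthonormal families are lists, so that sums over them are ordinary
    iterated sums. *)
Definition ortho_seq s := uniq s /\ orthonormal [set` s].

Lemma orthonormal_inner (B : set E) e f : orthonormal B -> B e -> B f ->
  inner e f = (e == f)%:R.
Proof.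
move=> [nB oB] Be Bf; case: eqVneq => [<-|/eqP]; last exact: oB.
by rewrite inner_normE nB// expr1n.
Qed.

Lemma orthonormalS (B C : set E) : B `<=` C -> orthonormal C -> orthonormal B.
Proof. by move=> BC [nC oC]; split=> [e /BC/nC//|e f /BC Ce /BC/(oC _ _ Ce)]. Qed.

Lemma ortho_seqS (B : set E) s : orthonormal B -> uniq s ->
  [set` s] `<=` B -> ortho_seq s.
Proof. by move=> oB us sB; split => //; exact: orthonormalS oB. Qed.

Lemma sum_pick s (c : E -> R) f : uniq s -> f \in s ->
  \sum_(e <- s) c e * (e == f)%:R = c f.
Proof.
move=> us fs; rewrite (bigD1_seq f)//= eqxx mulr1 big1 ?addr0// => e /negPf ->.
by rewrite mulr0.
Qed.

Lemma inner_ortho_sum_in s (c : E -> R) f : ortho_seq s -> f \in s ->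
  inner f (\sum_(e <- s) c e *: e) = c f.
Proof.
move=> [us os] fs; rewrite inner_sumr -[RHS](sum_pick c us fs).
rewrite big_seq [RHS]big_seq; apply: eq_bigr => e es.
by rewrite innerZr (orthonormal_inner os)// eq_sym.
Qed.

Lemma inner_ortho_sum_out s (c : E -> R) f :
  (forall e, e \in s -> inner e f = 0) ->
  inner f (\sum_(e <- s) c e *: e) = 0.
Proof.
move=> h; rewrite inner_sumr big_seq big1// => e es.
by rewrite innerZr innerC h// mulr0.
Qed.

Lemma norm_ortho_sum s (c : E -> R) : ortho_seq s ->
  `|\sum_(e <- s) c e *: e| ^+ 2 = \sum_(e <- s) c e ^+ 2.
Proof.
move=> os; rewrite -inner_normE inner_suml big_seq [RHS]big_seq.
apply: eq_bigr => e es; rewrite innerZl inner_ortho_sum_in//.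
Qed.

(** The orthogonal projection on the span of [s], when [s] is orthonormal. *)
Definition proj_seq s x := \sum_(e <- s) inner e x *: e.

Lemma inner_proj_seq s x y :
  inner (proj_seq s x) y = \sum_(e <- s) inner e x * inner e y.
Proof. by rewrite inner_suml; under eq_bigr do rewrite innerZl. Qed.

Lemma proj_seq_ortho s x f : ortho_seq s -> f \in s ->
  inner f (x - proj_seq s x) = 0.
Proof. by move=> os fs; rewrite innerBr inner_ortho_sum_in// subrr. Qed.

Lemma normB_proj_seq s x : ortho_seq s ->
  `|x - proj_seq s x| ^+ 2 = `|x| ^+ 2 - \sum_(e <- s) inner e x ^+ 2.
Proof.
move=> os; rewrite normB_sq norm_ortho_sum// innerC inner_proj_seq.
under [X in 2 * X]eq_bigr do rewrite -expr2.
ring.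
Qed.

Lemma bessel s x : ortho_seq s -> \sum_(e <- s) inner e x ^+ 2 <= `|x| ^+ 2.
Proof. by move=> os; rewrite -subr_ge0 -normB_proj_seq// sqr_ge0. Qed.

End InnerProduct.

(** * Linear maps *)

Section LinearProp.
Variables (R : realType) (E F : innerProductType R) (T : E -> F).
Hypothesis lT : linear T.
Lemma linpD x y : T (x + y) = T x + T y.
Proof. by have := lT 1 x y; rewrite !scale1r. Qed.
Lemma linp0 : T 0 = 0.
Proof. by have := linpD 0 0; rewrite addr0 => /esym/eqP; rewrite -subr_eq0 addrK => /eqP. Qed.
Lemma linpZ a x : T (a *: x) = a *: T x.
Proof. by have := lT a x 0; rewrite !addr0 linp0 addr0. Qed.
Lemma linpN x : T (- x) = - T x.
Proof. by rewrite -scaleN1r linpZ scaleN1r. Qed.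
Lemma linpB x y : T (x - y) = T x - T y.
Proof. by rewrite linpD linpN. Qed.
Lemma linp_sum I (r : seq I) (P : pred I) (f : I -> E) :
  T (\sum_(i <- r | P i) f i) = \sum_(i <- r | P i) T (f i).
Proof.
by elim/big_rec2: _ => [|i u v _ <-]; [exact: linp0|rewrite linpD].
Qed.

Lemma linp_continuous_bound : continuous T ->
  exists2 M, 0 < M & forall x, `|T x| <= M * `|x|.
Proof.
pose f : {linear E -> F} := HB.pack T (GRing.isLinear.Build _ _ _ _ T lT).
move=> cT; have : bounded_near f (nbhs (0 : E)).
  by apply: continuous_linear_bounded; exact: cT.
move/linear_boundedP => [r [_ fr]].
exists (Num.max (r + 1) 1); first by rewrite lt_max ltr01 orbT.
move=> x; apply: fr; rewrite lt_max; apply/orP; left; by rewrite ltrDl.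
Qed.

Lemma linp_bound_continuous M : (forall x, `|T x| <= M * `|x|) -> continuous T.
Proof.
pose f : {linear E -> F} := HB.pack T (GRing.isLinear.Build _ _ _ _ T lT).
move=> hM; have : bounded_near f (nbhs (0 : E)).
  apply/linear_boundedP; exists (Num.max M 0); split; first exact: num_real.
  move=> r /ltW Mr x; apply: le_trans (hM x) _.
  by rewrite ler_wpM2r// (le_trans _ Mr)// le_max lexx.
by move/bounded_linear_continuous.
Qed.
End LinearProp.

(** * Sums over arbitrary index sets *)

Section EsumSeq.
Variables (R : realType) (T : choiceType).
Implicit Types (C : set T) (a : T -> R) (s : seq T).

Lemma seq_le_esum C a s : uniq s -> [set` s] `<=` C ->
  ((\sum_(e <- s) a e)%:E <= \esum_(e in C) (a e)%:E)%E.
Proof.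
move=> us sC; apply: esum_ge; exists [set` s]; first by split => //; exact: finite_seq.
by rewrite -fsbig_seq//= sumEFin.
Qed.

Lemma esum_le_seq C a (M : \bar R) :
  (forall s, uniq s -> [set` s] `<=` C -> (((\sum_(e <- s) a e)%:E <= M)%E)) ->
  (\esum_(e in C) (a e)%:E <= M)%E.
Proof.
move=> h; apply: ge_ereal_sup => _ [X [fX XC] <-].
rewrite fsbig_finite//= sumEFin; apply: h => //.
by move=> x /=; rewrite in_fset_set// inE; exact: XC.
Qed.

Lemma esum_seq s a : uniq s -> (forall e, e \in s -> 0 <= a e) ->
  (\esum_(e in [set` s]) (a e)%:E = (\sum_(e <- s) a e)%:E)%E.
Proof.
move=> us a0; rewrite esum_fset; first by rewrite -fsbig_seq//= sumEFin.
  exact: finite_seq.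
by move=> i /set_mem /= /a0; rewrite lee_fin.
Qed.

Lemma esum_approx C a (S eps : R) : (\esum_(e in C) (a e)%:E = S%:E)%E ->
  0 < eps -> exists s, [/\ uniq s, [set` s] `<=` C & S - eps < \sum_(e <- s) a e].
Proof.
move=> hS e0.
have : ((S - eps)%:E < \esum_(e in C) (a e)%:E)%E by rewrite hS lte_fin ltrBlDr ltrDl.
move/ereal_sup_gt => [_ [X [fX XC] <-]].
rewrite fsbig_finite//= sumEFin lte_fin => h.
exists (finmap.enum_fset (fset_set X)); split => //.
by move=> x /=; rewrite in_fset_set// inE; exact: XC.
Qed.

Lemma esum_sub_le C D (a : T -> \bar R) : C `<=` D ->
  (\esum_(e in C) a e <= \esum_(e in D) a e)%E.
Proof.
move=> CD; apply: ge_ereal_sup => _ [X [fX XC] <-]; apply: ereal_sup_ubound.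
by exists X => //; split => //; exact: subset_trans CD.
Qed.

Lemma esum_supp_eq C D (a : T -> \bar R) : C `<=` D -> (forall e, D e -> 0 <= a e)%E ->
  (forall e, D e -> ~ C e -> a e = 0%E) ->
  (\esum_(e in C) a e = \esum_(e in D) a e)%E.
Proof.
move=> CD a0 h; rewrite [RHS](esumID C)// [X in (_ + X)%E]esum1 ?adde0.
  by rewrite setIidr.
by move=> i [Di nCi]; exact: h.
Qed.

Lemma esumZl C (a : T -> R) (k : R) : 0 <= k -> (forall e, C e -> 0 <= a e) ->
  (\esum_(e in C) (k * a e)%:E = k%:E * \esum_(e in C) (a e)%:E)%E.
Proof.
move=> k0 a0; have [->|kn0] := eqVneq k 0.
  by rewrite mul0e esum1// => e _; rewrite mul0r.
have kp : 0 < k by rewrite lt_neqAle eq_sym kn0.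
apply/eqP; rewrite eq_le; apply/andP; split.
  apply: esum_le_seq => s us sC; rewrite -mulr_sumr EFinM.
  by rewrite lee_wpmul2l ?lee_fin// seq_le_esum.
rewrite -lee_pdivlMl//; apply: esum_le_seq => s us sC.
by rewrite lee_pdivlMl// -EFinM mulr_sumr; apply: seq_le_esum.
Qed.

Lemma esum_gt0_real C a (M : R) : (forall e, C e -> 0 <= a e) ->
  (\esum_(e in C) (a e)%:E <= M%:E)%E ->
  exists2 S, 0 <= S <= M & (\esum_(e in C) (a e)%:E = S%:E)%E.
Proof.
move=> a0 hM.
have h0 : (0 <= \esum_(e in C) (a e)%:E)%E by apply: esum_ge0 => e Ce; rewrite lee_fin a0.
have hf : (\esum_(e in C) (a e)%:E)%E \is a fin_num.
  by rewrite ge0_fin_numE// (le_lt_trans hM)// ltry.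
exists (fine (\esum_(e in C) (a e)%:E)%E); last by rewrite fineK.
by rewrite -!lee_fin fineK// h0 hM.
Qed.
End EsumSeq.

Lemma esum_exchange (R : realType) (T1 T2 : choiceType) (C : set T1) (D : set T2)
    (a : T1 -> T2 -> \bar R) : (forall i j, C i -> D j -> (0 <= a i j)%E) ->
  (\esum_(i in C) \esum_(j in D) a i j = \esum_(j in D) \esum_(i in C) a i j)%E.
Proof.
move=> a0; rewrite !esum_esum//; last by move=> *; exact: a0.
rewrite (reindex_esum (D `*` C) _ (fun x => (x.2, x.1)))//; split => //=.
- by move=> [i j] [/=].
- by move=> [i1 i2] [j1 j2] /= _ _ [] -> ->.
- by move=> [i j] [/= Ci Dj]; exists (j, i).
Qed.

(** * Orthonormal bases *)

Section Bases.
Variables (R : realType) (E : innerProductType R).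
Implicit Types (x y z : E) (s : seq E) (B C : set E).

(** Zorn's lemma on orthonormal sets.  The predicate [p] lets it serve twice: when
    [p] is trivial it extends an orthonormal set to a basis, and when [p]
    selects eigenvectors it yields a maximal orthonormal family of
    eigenvectors. *)
Lemma orthonormal_extend (p : E -> Prop) B : orthonormal B -> B `<=` p ->
  exists C, [/\ B `<=` C, orthonormal C, C `<=` p &
    forall x, `|x| = 1 -> p x -> (forall e, C e -> inner e x = 0) -> False].
Proof.
move=> oB Bp.
pose P := [set X : set E | orthonormal (B `|` X) /\ X `<=` p].
have [|A [[oA Ap] mA]] := @Zorn_bigcup E P.
  move=> F FP tF; split; last by move=> x [X FX Xx]; apply: (FP _ FX).2.
  split=> [e [Be|[X FX Xe]]|e f].
  - exact: (on_norm oB).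
  - by apply: (on_norm (FP _ FX).1); right.
  - move=> [Be|[X FX Xe]] [Bf|[Y FY Yf]] ef.
    + exact: (on_ortho oB).
    + by apply: (on_ortho (FP _ FY).1) => //; [left|right].
    + by apply: (on_ortho (FP _ FX).1) => //; [right|left].
    + have [XY|YX] := tF _ _ FX FY.
        by apply: (on_ortho (FP _ FY).1) => //; right; [exact: XY|].
      by apply: (on_ortho (FP _ FX).1) => //; right; [|exact: YX].
exists (B `|` A); split => //.
- by move=> x [/Bp|/Ap].
move=> x nx px ox.
have xA : ~ A x.
  move=> Ax; have := ox x (or_intror Ax); rewrite inner_normE nx expr1n => /eqP.
  by rewrite oner_eq0.
apply: (mA (x |` A)); first by split => [y Ay|/(_ x)]; [right|move=> /(_ (or_introl erefl))].
split; last by move=> y [->|/Ap].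
split=> [e [Be|[->//|Ae]]|e f].
- exact: (on_norm oB).
- by apply: (on_norm oA); right.
- move=> [Be|[->|Ae]] [Bf|[->|Af]] ef //.
  + exact: (on_ortho oB).
  + by apply: ox; left.
  + by apply: (on_ortho oA) => //; [left|right].
  + by rewrite innerC; apply: ox; left.
  + by rewrite innerC; apply: ox; right.
  + by apply: (on_ortho oA) => //; [right|left].
  + by apply: ox; right.
  + by apply: (on_ortho oA) => //; right.
Qed.

Lemma onb_orthonormal C : is_onb C -> orthonormal C.
Proof. by case. Qed.

Lemma onb_extend B : orthonormal B -> exists2 C, B `<=` C & is_onb C.
Proof.
move=> oB; have [C [BC oC _ mC]] := @orthonormal_extend (fun=> True) B oB (fun _ _ => I).
exists C => //; case: oC => nC oC; split => // x ox.
apply: contrapT => /eqP x0; apply: (mC (`|x|^-1 *: x)) => //.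
  by rewrite normrZ normfV normr_id mulVf// normr_eq0.
by move=> e Ce; rewrite innerZr ox// mulr0.
Qed.

Lemma orthonormal0 : orthonormal (set0 : set E).
Proof. by split. Qed.

Lemma onbP : is_onb (@onb R E).
Proof. by have [C _ oC] := onb_extend orthonormal0; apply: xgetPex; exists C. Qed.

Lemma onb_seq C s : is_onb C -> uniq s -> [set` s] `<=` C -> ortho_seq s.
Proof. by move=> /onb_orthonormal oC us sC; exact: ortho_seqS oC us sC. Qed.

(** Sequential completeness as a property: it is shared by Hilbert spaces and by
    finite-dimensional inner product spaces, whose types carry no completeness
    structure. *)
Definition cauchy_complete : Prop := forall u : nat -> E,
  (forall eps : R, 0 < eps -> exists N, forall m n, (N <= m)%N -> (N <= n)%N ->
     `|u m - u n| < eps) -> exists l : E, u @ \oo --> l.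

Lemma cvg_innerl (u : nat -> E) l y : u @ \oo --> l ->
  (fun n => inner y (u n)) @ \oo --> inner y l.
Proof.
move=> ul; apply/cvgrPdist_le => /= eps e0.
have e1 : 0 < eps / (`|y| + 1) by rewrite divr_gt0// ltr_wpDl.
have /cvgrPdist_le /(_ _ e1) [N _ hN] := ul; exists N => // n /hN /= h.
rewrite -innerBr; apply: le_trans (cauchy_schwarz _ _) _.
apply: le_trans (ler_wpM2l (normr_ge0 _) h) _.
rewrite mulrCA ger_pMr// ler_pdivrMr ?ltr_wpDl// mul1r lerDl ler01//.
Qed.

Lemma cvg_norm_sq (u : nat -> E) l : u @ \oo --> l ->
  (fun n => `|u n| ^+ 2) @ \oo --> `|l| ^+ 2.
Proof.
move=> ul; have nl := cvg_norm ul.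
exact: (cvg_comp _ _ (nl _) (@exprn_continuous R 2%N `|l|)).
Qed.
End Bases.

Lemma hilbert_complete (R : realType) (H : hilbertType R) : @cauchy_complete R H.
Proof.
move=> u cu; apply/cvg_ex; apply: cauchy_cvg; apply: cauchy_exP => eps e0.
have [N hN] := cu _ e0; exists (u N); exists N => //= n /= Nn.
by rewrite -ball_normE /=; exact: hN.
Qed.

Lemma cvg_of_le_inv (R : realType) (V : normedModType R) (u : nat -> V) l :
  (forall n, `|u n - l| <= n.+1%:R^-1) -> u @ \oo --> l.
Proof.
move=> h; apply/cvgrPdist_lt => /= eps e0.
have [N hN] : exists N, N.+1%:R^-1 < eps.
  exists (Num.truncn eps^-1).
  by rewrite invf_plt ?posrE// truncnS_gt.
exists N => //= n /= Nn; rewrite distrC (le_lt_trans (h n))// (le_lt_trans _ hN)//.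
by rewrite lef_pV2 ?posrE// ler_nat.
Qed.

Lemma sum_sub_seq (T : eqType) (V : nmodType) (s u : seq T) (F : T -> V) :
  uniq s -> uniq u -> {subset s <= u} ->
  \sum_(e <- u) F e = \sum_(e <- s) F e + \sum_(e <- u | e \notin s) F e.
Proof.
move=> us uu su; rewrite (bigID (mem s))/=; congr (_ + _).
rewrite -big_filter; apply: perm_big; apply: uniq_perm => //.
  exact: filter_uniq.
by move=> x; rewrite mem_filter; case xs : (x \in s) => //=; rewrite su.
Qed.

Lemma cvg_real_unique (R : realType) (u : nat -> R) (a b : R) :
  u @ \oo --> a -> u @ \oo --> b -> a = b.
Proof.
by move=> ua ub; rewrite -(cvg_lim (@Rhausdorff R) ua) (cvg_lim (@Rhausdorff R) ub).
Qed.

(** * Riesz-Fischer and Parseval *)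

Section RieszFischer.
Variables (R : realType) (E : innerProductType R).
Implicit Types (x y z : E) (s : seq E) (B C : set E).

Lemma norm_sub_ortho_sum C (c : E -> R) s u : orthonormal C ->
  uniq s -> uniq u -> {subset s <= u} -> [set` u] `<=` C ->
  `|\sum_(e <- u) c e *: e - \sum_(e <- s) c e *: e| ^+ 2 =
  \sum_(e <- u) c e ^+ 2 - \sum_(e <- s) c e ^+ 2.
Proof.
move=> oC us uu su uC.
rewrite !(sum_sub_seq _ us uu su) (addrC (\sum_(e <- s) _ *: _)) addrK.
rewrite (addrC (\sum_(e <- s) _ ^+ 2)) addrK -big_filter norm_ortho_sum ?big_filter//.
apply: ortho_seqS oC _ _; first exact: filter_uniq.
by move=> e /=; rewrite mem_filter => /andP[_ ?]; exact: uC.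
Qed.

(** Finite sums that nearly exhaust [\sum c_e^2] form a Cauchy sequence, since any
    two of them differ from a common refinement by small tails. *)
Lemma riesz_fischer C (c : E -> R) (S : R) : @cauchy_complete R E -> orthonormal C ->
  (\esum_(e in C) (c e ^+ 2)%:E = S%:E)%E ->
  exists y, [/\ forall e, C e -> inner e y = c e,
   forall z, (forall e, C e -> inner e z = 0) -> inner z y = 0,
   `|y| ^+ 2 = S & forall eps, 0 < eps -> exists s, [/\ uniq s, [set` s] `<=` C &
     `|y - \sum_(e <- s) c e *: e| < eps]].
Proof.
move=> cE oC hS.
have ltS s : uniq s -> [set` s] `<=` C -> \sum_(e <- s) c e ^+ 2 <= S.
  by move=> us sC; rewrite -lee_fin -hS; exact: (@seq_le_esum _ _ C (fun e => c e ^+ 2)).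
have /choice[s hs] : forall n : nat, exists s, [/\ uniq s, [set` s] `<=` C &
    S - (n.+1%:R^-1) ^+ 2 < \sum_(e <- s) c e ^+ 2].
  by move=> n; apply: (esum_approx hS); rewrite exprn_gt0// invr_gt0.
pose y n := \sum_(e <- s n) c e *: e.
have dist n u : uniq u -> {subset s n <= u} -> [set` u] `<=` C ->
    `|\sum_(e <- u) c e *: e - y n| <= n.+1%:R^-1.
  move=> uu su uC; have [us sC hn] := hs n.
  rewrite -(@ler_pXn2r _ 2%N) ?nnegrE//.
  rewrite (norm_sub_ortho_sum _ oC)// lerBlDr.
  by apply: le_trans (ltS _ uu uC) _; rewrite -lerBlDl; exact: ltW.
have dist2 m n : `|y m - y n| <= m.+1%:R^-1 + n.+1%:R^-1.
  pose u := undup (s m ++ s n).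
  have [_ sCm _] := hs m; have [_ sCn _] := hs n.
  have uC : [set` u] `<=` C.
    by move=> e /=; rewrite mem_undup mem_cat => /orP[/sCm|/sCn].
  rewrite -(subrK (\sum_(e <- u) c e *: e) (y m)) -addrA.
  apply: le_trans (ler_normD _ _) _; apply: lerD.
    rewrite distrC; apply: dist => //; first exact: undup_uniq.
    by move=> e es; rewrite mem_undup mem_cat es.
  apply: dist => //; first exact: undup_uniq.
  by move=> e es; rewrite mem_undup mem_cat es orbT.
have [l yl] : exists l : E, y @ \oo --> l.
  apply: cE => eps e0; exists (Num.truncn (eps / 2)^-1) => m n Nm Nn.
  have hN : (Num.truncn (eps / 2)^-1).+1%:R^-1 < eps / 2.
    by rewrite invf_plt ?posrE ?divr_gt0// truncnS_gt.
  apply: le_lt_trans (dist2 _ _) _; rewrite [ltRHS]splitr; apply: ltrD.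
    by apply: le_lt_trans hN; rewrite lef_pV2 ?posrE// ler_nat.
  by apply: le_lt_trans hN; rewrite lef_pV2 ?posrE// ler_nat.
exists l; split.
- move=> e Ce; apply: (cvg_real_unique (cvg_innerl (y := e) yl)).
  apply: cvg_of_le_inv => n; have [us sC hn] := hs n.
  have oS : ortho_seq (s n) by exact: ortho_seqS oC us sC.
  have [es|es] := boolP (e \in s n).
    by rewrite inner_ortho_sum_in// subrr normr0.
  rewrite inner_ortho_sum_out; last first.
    move=> f fs; apply: (on_ortho oC) => //; first exact: sC.
    by move=> fe; move: es; rewrite -fe fs.
  rewrite sub0r normrN -(@ler_pXn2r _ 2%N) ?nnegrE// real_normK ?num_real//.
  have : \sum_(e <- e :: s n) c e ^+ 2 <= S.
    apply: ltS; first by rewrite /= es us.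
    by move=> f; rewrite /= inE => /predU1P[->|/sC].
  rewrite big_cons => h; rewrite -(lerD2r (\sum_(f <- s n) c f ^+ 2)).
  by apply: le_trans h _; rewrite -lerBlDl; exact: ltW.
- move=> z oz; apply: (cvg_real_unique (cvg_innerl (y := z) yl)).
  have -> : (fun n => inner z (y n)) = fun=> 0.
    apply/funext => n; rewrite inner_ortho_sum_out// => e es; apply: oz.
    by have [_ sC _] := hs n; exact: sC.
  exact: cvg_cst.
- apply: (cvg_real_unique (cvg_norm_sq yl)).
  have h n : S - n.+1%:R^-1 <= `|y n| ^+ 2 <= S.
    have [us sC hn] := hs n; rewrite norm_ortho_sum; last exact: ortho_seqS oC us sC.
    rewrite ltS// andbT; apply: le_trans (ltW hn); rewrite lerB// expr2.
    by rewrite ler_piMl// invf_le1// ler1n.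
  apply: cvg_of_le_inv => n; rewrite ler_norml; have /andP[h1 h2] := h n.
  have d0 : 0 <= n.+1%:R^-1 :> R by rewrite invr_ge0 ler0n.
  by move: h1 h2 d0; move: (`|y n| ^+ 2) (n.+1%:R^-1) => p q h1 h2 d0; apply/andP; split; lra.
- move=> eps e0.
  have /cvgrPdist_lt /(_ _ e0) [N _ /(_ N (leqnn N)) /= h] := yl.
  by exists (s N); have [us sC _] := hs N; split.
Qed.

Lemma bessel_esum C x : orthonormal C ->
  (\esum_(e in C) (inner e x ^+ 2)%:E <= (`|x| ^+ 2)%:E)%E.
Proof.
move=> oC; apply: esum_le_seq => s us sC; rewrite lee_fin bessel//.
exact: ortho_seqS oC us sC.
Qed.

Section Onb.
Variables (C : set E) (cE : @cauchy_complete R E) (oC : is_onb C).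

Lemma onb_inj x y : (forall e, C e -> inner e x = inner e y) -> x = y.
Proof.
move=> h; apply/eqP; rewrite -subr_eq0; apply/eqP.
by case: oC => _ _; apply=> e Ce; rewrite innerBr h// subrr.
Qed.

Lemma onb_approx x eps : 0 < eps ->
  exists s, [/\ uniq s, [set` s] `<=` C & `|x - proj_seq s x| < eps].
Proof.
move=> e0; have [S _ hS] := esum_gt0_real (fun e _ => sqr_ge0 (inner e x))
  (bessel_esum x (onb_orthonormal oC)).
have [y [hy _ _ hs]] := riesz_fischer cE (onb_orthonormal oC) hS.
suff -> : x = y by have [s [us sC h]] := hs _ e0; exists s; split=> //; rewrite /proj_seq;
  move: h; congr (`|y - _| < _); rewrite big_seq [RHS]big_seq; apply: eq_bigr => e es;
  rewrite hy//; exact: sC.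
by apply: onb_inj => e Ce; rewrite hy.
Qed.

(** The vector that Riesz-Fischer builds from the coefficients of [x] is [x],
    because [C] is total. *)
Lemma parseval x : (\esum_(e in C) (inner e x ^+ 2)%:E = (`|x| ^+ 2)%:E)%E.
Proof.
have [S _ hS] := esum_gt0_real (fun e _ => sqr_ge0 (inner e x))
  (bessel_esum x (onb_orthonormal oC)).
have [y [hy _ Sy _]] := riesz_fischer cE (onb_orthonormal oC) hS.
rewrite hS -Sy; congr ((`|_| ^+ 2)%:E); apply: onb_inj => e Ce; rewrite hy//.
Qed.

(** A bounded functional is determined by its values on the dense span of a basis. *)
Lemma onb_ext (g : E -> R) M : (forall x y, g (x + y) = g x + g y) ->
  (forall a x, g (a *: x) = a * g x) -> (forall x, `|g x| <= M * `|x|) ->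
  (forall e, C e -> g e = 0) -> forall x, g x = 0.
Proof.
move=> gD gZ gM g0 x; apply/eqP; rewrite -normr_le0.
apply/ler_addgt0Pl => eps e0; rewrite addr0.
have M1 : 0 < `|M| + 1 by rewrite ltr_wpDl.
have [s [us sC h]] := onb_approx x (divr_gt0 e0 M1).
have gs : g (proj_seq s x) = 0.
  rewrite /proj_seq; elim: s us sC {h} => [|e s IH] /= => [_ _|/andP[_ us] sC].
    by rewrite big_nil -(scale0r 0) gZ mul0r.
  rewrite big_cons gD gZ g0 ?mulr0 ?add0r ?IH//; last by apply: sC => /=; rewrite inE eqxx.
  by move=> f fs; apply: sC; rewrite /= inE; apply/orP; right.
rewrite -(subrK (proj_seq s x) x) gD gs addr0; apply: le_trans (gM _) _.
apply: le_trans (ler_wpM2r (normr_ge0 _) (ler_norm M)) _.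
apply: le_trans (ler_wpM2l (normr_ge0 _) (ltW h)) _.
by rewrite mulrCA ger_pMr// ler_pdivrMr// mul1r lerDl.
Qed.
End Onb.
End RieszFischer.

(** * Finite dimension *)

Section Findim.
Variables (R : realType) (E : innerProductType R).
Implicit Types (x y z : E) (s : seq E) (B C : set E).

Lemma gram_schmidt (n : nat) (v : 'I_n -> E) :
  exists s, ortho_seq s /\ (size s <= n)%N /\ forall i, proj_seq s (v i) = v i.
Proof.
elim: n v => [|n IH] v.
  by exists [::]; split; [split => //; split|split => // -[]].
have [s [os [ss hs]]] := IH (fun i => v (lift ord_max i)).
have [us oss] := os.
pose w := v ord_max - proj_seq s (v ord_max).
have key t : proj_seq t (v ord_max) = v ord_max -> (forall i : 'I_n,
    proj_seq t (v (lift ord_max i)) = v (lift ord_max i)) ->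
    forall i, proj_seq t (v i) = v i.
  by move=> h1 h2 i; case: (unliftP ord_max i) => [j ->|->].
have [w0|w0] := eqVneq w 0.
  exists s; split => //; split; first exact: leqW.
  by apply: key => //; apply/esym/eqP; rewrite -subr_eq0 -/w w0.
pose e := `|w|^-1 *: w.
have ne : `|e| = 1 by rewrite normrZ normfV normr_id mulVf// normr_eq0.
have ow f : f \in s -> inner f w = 0 by move=> fs; exact: proj_seq_ortho.
have oe f : f \in s -> inner f e = 0 by move=> fs; rewrite innerZr ow// mulr0.
have es : e \notin s.
  apply/negP => /oe; rewrite inner_normE ne expr1n => /eqP; by rewrite oner_eq0.
exists (e :: s); split; last split => //; last apply: key.
- split; first by rewrite /= es us.
  split => [f|f g] /=; rewrite !inE.
    by move=> /predU1P[->//|fs]; exact: (on_norm oss).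
  move=> /predU1P[->|fs] /predU1P[->|gs] fg //.
  + by rewrite innerC oe.
  + by rewrite oe.
  + exact: (on_ortho oss).
- rewrite /proj_seq big_cons -/(proj_seq _ _).
  have -> : inner e (v ord_max) = `|w|.
    rewrite -(subrK (proj_seq s (v ord_max)) (v ord_max)) -/w innerDr.
    rewrite [X in _ + X]innerC inner_proj_seq [X in _ + X]big_seq big1 ?addr0; last first.
      by move=> f fs; rewrite oe// mulr0.
    by rewrite innerZl inner_normE expr2 mulrA mulVf ?normr_eq0// mul1r.
  by rewrite /e scalerA divff ?normr_eq0// scale1r subrK.
- move=> i; rewrite /proj_seq big_cons -/(proj_seq _ _) hs.
  rewrite -hs innerC inner_proj_seq big_seq big1 ?scale0r ?add0r// => f fs.
  by rewrite oe// mulr0.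
Qed.

Lemma proj_seqD s x y : proj_seq s (x + y) = proj_seq s x + proj_seq s y.
Proof. by rewrite /proj_seq -big_split; apply: eq_bigr => e _; rewrite /= innerDr scalerDl. Qed.
Lemma proj_seqZ s a x : proj_seq s (a *: x) = a *: proj_seq s x.
Proof. by rewrite /proj_seq scaler_sumr; apply: eq_bigr => e _; rewrite innerZr scalerA. Qed.

Lemma findim_basis : @findim R E -> exists s, ortho_seq s /\ forall x, proj_seq s x = x.
Proof.
move=> [n [v hv]]; have [s [os [_ hs]]] := gram_schmidt v; exists s; split => // x.
have [c ->] := hv x; elim/big_ind: _ => [|y z hy hz|i _].
- by rewrite -(scale0r 0) proj_seqZ !scale0r.
- by rewrite proj_seqD hy hz.
- by rewrite proj_seqZ hs.
Qed.
End Findim.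

Section FindimFacts.
Variables (R : realType) (E : innerProductType R) (fE : @findim R E).
Implicit Types (x y z : E) (s : seq E) (B C : set E).

Lemma real_complete (v : nat -> R) :
  (forall eps : R, 0 < eps -> exists N, forall m n, (N <= m)%N -> (N <= n)%N ->
     `|v m - v n| < eps) -> exists l : R, v @ \oo --> l.
Proof.
move=> cu; apply/cvg_ex; apply: cauchy_cvg; apply: cauchy_exP => eps e0.
have [N hN] := cu _ e0; exists (v N); exists N => //= n /= Nn.
by rewrite -ball_normE /=; exact: hN.
Qed.

Lemma findim_complete : @cauchy_complete R E.
Proof.
have [s [os hs]] := findim_basis fE.
move=> u cu.
have /choice[l hl] : forall e : E, exists l : R, `|e| = 1 -> (fun n => inner e (u n)) @ \oo --> l.
  move=> e; have [ne|ne] := pselect (`|e| = 1); last by exists 0.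
  have [|l hl] := @real_complete (fun n => inner e (u n)).
    move=> eps e0; have [N hN] := cu _ e0; exists N => m n Nm Nn.
    rewrite -innerBr; apply: le_lt_trans (cauchy_schwarz _ _) _.
    by rewrite ne mul1r; exact: hN.
  by exists l.
exists (\sum_(e <- s) l e *: e).
rewrite (_ : u = (fun n => \sum_(e <- s) inner e (u n) *: e)); last first.
  by apply/funext => n; rewrite -[LHS]hs.
have : forall e, e \in s -> (fun n => inner e (u n)) @ \oo --> l e.
  by move=> e es; apply: hl; apply: (on_norm os.2).
elim: s {os hs} => [|e s IH] h.
  rewrite big_nil; under eq_fun do rewrite big_nil; exact: cvg_cst.
rewrite big_cons; under eq_fun do rewrite big_cons.
apply: cvgD; first by apply: cvgZr_tmp; apply: h; rewrite inE eqxx.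
by apply: IH => f fs; apply: h; rewrite inE fs orbT.
Qed.

(** Summing [|e|^2] over an orthonormal list and comparing with a finite basis
    through Bessel's inequality bounds the length of the list; so a maximal
    orthonormal set is finite. *)
Lemma onb_findim C : is_onb C ->
  exists s, [/\ uniq s, C = [set` s] & forall x, proj_seq s x = x].
Proof.
move=> oC; have [b [ob hb]] := findim_basis fE.
have size_le (t : seq E) : ortho_seq t -> (size t <= size b)%N.
  move=> ot; have : \sum_(e <- t) `|e| ^+ 2 <= \sum_(f <- b) `|f| ^+ 2.
    have -> : \sum_(e <- t) `|e| ^+ 2 = \sum_(e <- t) \sum_(f <- b) inner f e ^+ 2.
      by apply: eq_bigr => e _; rewrite -norm_ortho_sum// -/(proj_seq b e) hb.
    rewrite exchange_big /= ler_sum// => f _.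
    under eq_bigr do rewrite innerC.
    exact: bessel.
  rewrite !big_seq (eq_bigr (fun=> 1)); last first.
    by move=> e es; rewrite (on_norm ot.2 es) expr1n.
  rewrite [leRHS](eq_bigr (fun=> 1)); last first.
    by move=> e es; rewrite (on_norm ob.2 es) expr1n.
  by rewrite -!big_seq !big_const_seq !count_predT !iter_addr !addr0 ler_nat.
have fC : finite_set C.
  apply: contrapT => /(@infinite_set_fset _ _ (size b).+1)[F FC hF].
  have := size_le (finmap.enum_fset F); rewrite leqNgt hF => /(_ _)/negP; apply => //.
  by apply: (onb_seq oC); [exact: finmap.fset_uniq|exact: FC].
pose s := finmap.enum_fset (fset_set C).
have Cs : C = [set` s] by rewrite fset_setK.
have us : uniq s by exact: finmap.fset_uniq.
exists s; split => // x.
have os : ortho_seq s by apply: (onb_seq oC) => //; rewrite -Cs.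
apply/esym/eqP; rewrite -subr_eq0; apply/eqP; case: oC => _ _; apply.
by move=> e; rewrite Cs => es; exact: proj_seq_ortho.
Qed.

(** The trace may be computed in any basis; [tr] uses [onb], of which only
    maximality is known. *)
Lemma tr_seq (T : E -> E) (t : seq E) : linear T -> ortho_seq t ->
  (forall x, proj_seq t x = x) -> tr T = \sum_(e <- t) inner e (T e).
Proof.
move=> lT ot ht; have [s [us Cs hs]] := onb_findim (onbP E).
rewrite /tr Cs -fsbig_seq//=.
have -> : \sum_(e <- s) inner e (T e) =
    \sum_(e <- s) \sum_(f <- t) inner f e * inner f (T e).
  by apply: eq_bigr => e _; rewrite -inner_proj_seq ht.
rewrite exchange_big /=; apply: eq_bigr => f _.
rewrite -[in RHS](hs f) {2}/proj_seq (linp_sum lT) inner_sumr.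
by apply: eq_bigr => e _; rewrite (linpZ lT) innerZr innerC hs.
Qed.

Lemma onb_ortho_seq : exists s, [/\ uniq s, @onb R E = [set` s], ortho_seq s &
  forall x, proj_seq s x = x].
Proof.
have [s [us Cs hs]] := onb_findim (onbP E); exists s; split => //.
by apply: (onb_seq (onbP E)) => //; rewrite Cs.
Qed.

Lemma findim_linear_continuous (T : E -> E) : linear T -> continuous T.
Proof.
move=> lT; have [s [us Cs os hs]] := onb_ortho_seq.
apply: (@linp_bound_continuous _ _ _ T lT (\sum_(e <- s) `|T e|)) => x.
rewrite -[in leLHS](hs x) /proj_seq (linp_sum lT) mulr_suml.
apply: le_trans (ler_norm_sum _ _ _) _; rewrite !big_seq; apply: ler_sum => e es.
rewrite (linpZ lT) normrZ mulrC ler_wpM2l//; apply: le_trans (cauchy_schwarz _ _) _.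
by rewrite (on_norm os.2 es) mul1r.
Qed.
End FindimFacts.

(** * Hilbert-Schmidt sums *)

Section HilbertSchmidt.
Variables (R : realType) (E : innerProductType R).
Implicit Types (x y z : E) (s : seq E) (B C D : set E) (T K S : E -> E).

(** Squared Hilbert-Schmidt norm, computed on the family [C]. *)
Definition hs2 C T : \bar R := \esum_(e in C) (`|T e| ^+ 2)%:E.

Lemma hs2_ge0 C T : (0 <= hs2 C T)%E.
Proof. by apply: esum_ge0 => e _; rewrite lee_fin sqr_ge0. Qed.

Lemma adjE T T' : (forall x y, inner (T x) y = inner x (T' y)) -> adj T = T'.
Proof.
move=> h; apply/funext => y; rewrite /adj; apply: xget_unique => [x|z hz]; first exact: h.
by apply: inner_inj => x; rewrite -hz h.
Qed.

Lemma adj_sa S : self_adjoint S -> adj S = S.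
Proof. by move=> [_ h]; exact: adjE. Qed.
Lemma adj_skew K : skew_adjoint K -> adj K = (fun x => - K x).
Proof. by move=> [_ h]; apply: adjE => x y; rewrite h innerNr. Qed.

Lemma sa_linear S : self_adjoint S -> linear S. Proof. by case=> -[]. Qed.
Lemma skew_linear S : skew_adjoint S -> linear S. Proof. by case=> -[]. Qed.
Lemma sa_bound S : self_adjoint S -> exists2 M, 0 < M & forall x, `|S x| <= M * `|x|.
Proof. by move=> [[lS cS] _]; exact: linp_continuous_bound. Qed.

(** The Hilbert-Schmidt norm sees self-adjoint and skew-adjoint operators alike:
    all that matters is that <Tx, y> and <x, Ty> have equal squares. *)
Definition sym_or_skew T := exists sg : R, `|sg| = 1 /\
  forall x y, inner (T x) y = sg * inner x (T y).
Lemma sa_sos S : self_adjoint S -> sym_or_skew S.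
Proof. by move=> [_ h]; exists 1; rewrite normr1; split => // x y; rewrite mul1r. Qed.
Lemma skew_sos S : skew_adjoint S -> sym_or_skew S.
Proof. by move=> [_ h]; exists (-1); rewrite normrN1; split => // x y; rewrite mulN1r. Qed.

Lemma sos_sq T x y : sym_or_skew T -> inner (T x) y ^+ 2 = inner x (T y) ^+ 2.
Proof.
move=> [sg [n1 h]]; rewrite h exprMn -(real_normK (num_real sg)) n1 expr1n mul1r//.
Qed.

Section Complete.
Hypothesis cE : @cauchy_complete R E.

(** Parseval in [D], an exchange of sums, and Parseval in [C].  With a single
    operator it gives independence of the basis; with two, it moves a
    projection from one side of an operator to the other. *)
Lemma hs2_adjoint C D T T' : (forall x y, inner (T x) y ^+ 2 = inner x (T' y) ^+ 2) ->
  is_onb C -> is_onb D -> hs2 C T = hs2 D T'.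
Proof.
move=> hT oC oD; rewrite /hs2.
transitivity (\esum_(e in C) \esum_(f in D) (inner f (T e) ^+ 2)%:E)%E.
  by apply: eq_esum => e _; rewrite parseval.
rewrite esum_exchange; last by move=> *; rewrite lee_fin sqr_ge0.
apply: eq_esum => f _; under eq_esum do rewrite innerC hT.
by rewrite parseval.
Qed.

Lemma hs2_onb C D T : sym_or_skew T -> is_onb C -> is_onb D -> hs2 C T = hs2 D T.
Proof. by move=> hT; apply: hs2_adjoint => x y; exact: sos_sq. Qed.

Lemma hs2_le_ortho B C T : sym_or_skew T -> is_onb C -> orthonormal B ->
  (hs2 B T <= hs2 C T)%E.
Proof.
move=> hT oC oB; have [D BD oD] := onb_extend oB.
by rewrite (hs2_onb hT oC oD); exact: esum_sub_le.
Qed.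

Lemma hs2_seq_le C T s : sym_or_skew T -> is_onb C -> ortho_seq s ->
  ((\sum_(e <- s) `|T e| ^+ 2)%:E <= hs2 C T)%E.
Proof.
move=> hT oC [us os]; apply: le_trans (hs2_le_ortho hT oC os).
by apply: seq_le_esum.
Qed.

(** The unit vector along [x] is an orthonormal family by itself. *)
Lemma hs2_norm_le C T x : linear T -> sym_or_skew T -> is_onb C ->
  ((`|T x| ^+ 2)%:E <= (`|x| ^+ 2)%:E * hs2 C T)%E.
Proof.
move=> lT hT oC; have [->|x0] := eqVneq x 0.
  by rewrite (linp0 lT) !normr0 expr0n mul0e.
have nx : 0 < `|x| ^+ 2 by rewrite exprn_gt0// normr_gt0.
have : ortho_seq [:: `|x|^-1 *: x].
  split => //; split => [e|e f] /=; rewrite !inE => /eqP ->.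
    by rewrite normrZ normfV normr_id mulVf// normr_eq0.
  by move=> /eqP -> .
move/(hs2_seq_le hT oC); rewrite big_seq1 (linpZ lT) normrZ normfV normr_id exprMn exprVn.
by rewrite EFinM lee_pdivrMl.
Qed.
End Complete.
End HilbertSchmidt.

(** * The spectral theorem for self-adjoint Hilbert-Schmidt operators *)

Section Spectral.
Variables (R : realType) (E : innerProductType R) (cE : @cauchy_complete R E).
Implicit Types (x y z : E) (s : seq E) (B C D : set E).
Variable T : E -> E.
Hypothesis saT : self_adjoint T.
Hypothesis hsT : (hs2 (@onb R E) T < +oo)%E.
Let lT := sa_linear saT.

Lemma iter_sa n x y : inner (iter n T x) y = inner x (iter n T y).
Proof.
elim: n x y => [//|n IH] x y; rewrite iterS (proj2 saT) IH -iterSr//.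
Qed.

(** Cauchy-Schwarz for <T^n x, T^(n+2) x>, which is the square of |T^(n+1) x|. *)
Lemma norm_iter_logconvex n x :
  (`|iter n.+1 T x| ^+ 2) ^+ 2 <= `|iter n T x| ^+ 2 * `|iter n.+2 T x| ^+ 2.
Proof.
rewrite -exprMn -[X in X ^+ 2 <= _]inner_normE [X in inner _ X]iterS.
rewrite -(proj2 saT) -iterS innerC.
rewrite -(real_normK (num_real (inner _ _))) ler_pXn2r ?nnegrE ?mulr_ge0//.
exact: cauchy_schwarz.
Qed.

(** By log-convexity the ratios of consecutive norms increase, so each is at least
    the first. *)
Lemma norm_iter_pow n x : `|x| = 1 -> (`|T x| ^+ 2) ^+ n <= `|iter n T x| ^+ 2.
Proof.
move=> x1; have [->|t0] := eqVneq (`|T x| ^+ 2) 0.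
  by case: n => [|n]; [rewrite expr0 /= x1 expr1n|rewrite expr0n /= sqr_ge0].
have tp : 0 < `|T x| ^+ 2 by rewrite lt_neqAle eq_sym t0 sqr_ge0.
suff h k : 0 < `|iter k T x| ^+ 2 /\
    `|T x| ^+ 2 * `|iter k T x| ^+ 2 <= `|iter k.+1 T x| ^+ 2.
  elim: n => [|n IH]; first by rewrite expr0 /= x1 expr1n.
  rewrite exprS; apply: le_trans (h n).2; exact: ler_wpM2l (sqr_ge0 _) _ _ IH.
elim: k => [|k [p1 IH]]; first by rewrite /= x1 expr1n mulr1 lexx.
have p2 : 0 < `|iter k.+1 T x| ^+ 2 by apply: lt_le_trans IH; exact: mulr_gt0.
split => //; rewrite -(ler_pM2l p1); apply: le_trans (norm_iter_logconvex k x).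
rewrite mulrA (mulrC (`|iter k T x| ^+ 2)) expr2.
exact: ler_wpM2r (sqr_ge0 _) _ _ IH.
Qed.

Let bernoulli (d : R) n : 0 <= d <= 1 -> 1 - n%:R * d <= (1 - d) ^+ n.
Proof.
move=> /andP[d0 d1]; elim: n => [|n IH]; first by rewrite mul0r subr0 expr0.
rewrite exprS; apply: le_trans (ler_wpM2l _ IH); last by rewrite subr_ge0.
rewrite mulrS mulrDl mul1r -subr_ge0.
have -> : (1 - d) * (1 - n%:R * d) - (1 - (d + n%:R * d)) = n%:R * (d * d) by ring.
by rewrite !mulr_ge0.
Qed.

Section Invariant.
(* [B] consists of eigenvectors inside the basis [C]; [T] leaves their orthogonal
   complement [M] invariant, and [D] is a basis of it. *)
Variables (B C : set E) (lam : E -> R).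
Hypothesis oC : is_onb C.
Hypothesis BC : B `<=` C.
Hypothesis eigB : forall e, B e -> T e = lam e *: e.
Let M : set E := [set x | forall e, B e -> inner e x = 0].
Let D := C `\` B.

Lemma eig_compl_stable x : M x -> M (T x).
Proof.
by move=> Mx e Be; rewrite -(proj2 saT) eigB// innerZl Mx// mulr0.
Qed.
Lemma eig_compl_iter n x : M x -> M (iter n T x).
Proof. by move=> Mx; elim: n => //= n; exact: eig_compl_stable. Qed.
Lemma eig_compl_basis e : D e -> M e.
Proof.
move=> [Ce nBe] f Bf; apply: (on_ortho (onb_orthonormal oC)) => //; first exact: BC.
by move=> fe; apply: nBe; rewrite -fe.
Qed.

Lemma eig_compl_Z a x : M x -> M (a *: x).
Proof. by move=> Mx e Be; rewrite innerZr Mx// mulr0. Qed.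
Lemma eig_compl_D x y : M x -> M y -> M (x + y).
Proof. by move=> Mx My e Be; rewrite innerDr Mx// My// addr0. Qed.

(** Each coordinate <f, T^n x> = <T^n f, x> is at most |T^n f|. *)
Lemma iter_le_trace n x : M x -> `|x| = 1 ->
  ((`|iter n T x| ^+ 2)%:E <= \esum_(f in D) (`|iter n T f| ^+ 2)%:E)%E.
Proof.
move=> Mx x1; rewrite -(parseval cE oC (iter n T x)).
rewrite -(@esum_supp_eq _ _ D C); first last.
- move=> e Ce nDe; have Be : B e by apply: contrapT => nBe; apply: nDe.
  by rewrite eig_compl_iter// expr0n.
- by move=> e _; rewrite lee_fin sqr_ge0.
- by move=> e [].
apply: le_esum => f _; rewrite lee_fin -iter_sa.
rewrite -(real_normK (num_real (inner _ _))) ler_pXn2r ?nnegrE//.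
by apply: le_trans (cauchy_schwarz _ _) _; rewrite x1 mulr1.
Qed.

(** Power iteration.  Let [mu] be the supremum of |T x|^2 on the unit sphere of
    [M].  For each [f] the numbers [b f n = |T^n f|^2 / mu^n] decrease.  As
    [T] is Hilbert-Schmidt, all but finitely many basis vectors contribute
    little to [\sum |T^n f|^2], while near-maximizers of |T x| keep that sum
    above a fixed multiple of [mu^n]; so [b f] stays away from 0 for some [f].
    The vectors [y n = T^(2n) f / mu^n] have inner products [b f (n + m)],
    hence they converge, to a nonzero eigenvector of [T^2]. *)
Lemma power_eigvec : (exists x, M x /\ T x != 0) ->
  exists y mu, [/\ M y, y != 0, 0 < mu & T (T y) = mu *: y].
Proof.
move=> [x0 [Mx0 Tx0]].
have x00 : x0 != 0 by apply: contraNneq Tx0 => ->; rewrite (linp0 lT).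
pose Q := [set r | exists x, [/\ M x, `|x| = 1 & r = `|T x| ^+ 2]].
have [Mb Mb0 hMb] := sa_bound saT.
have bQ : has_ubound Q.
  exists (Mb ^+ 2) => _ [x [_ x1 ->]]; rewrite ler_pXn2r ?nnegrE//; last exact: ltW.
  by apply: le_trans (hMb _) _; rewrite x1 mulr1.
have Q0 : Q (`|T (`|x0|^-1 *: x0)| ^+ 2).
  exists (`|x0|^-1 *: x0); split => //; first exact: eig_compl_Z.
  by rewrite normrZ normfV normr_id mulVf// normr_eq0.
have sQ : has_sup Q by split => //; exists (`|T (`|x0|^-1 *: x0)| ^+ 2).
pose mu := sup Q.
have mu0 : 0 < mu.
  apply: lt_le_trans (ub_le_sup bQ Q0); rewrite exprn_gt0// normr_gt0.
  by rewrite (linpZ lT) scaler_eq0 negb_or invr_eq0 normr_eq0 x00.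
have le_mu x : M x -> `|T x| ^+ 2 <= mu * `|x| ^+ 2.
  move=> Mx; have [->|xn0] := eqVneq x 0.
    by rewrite (linp0 lT) normr0 expr0n mulr0.
  have px : 0 < `|x| ^+ 2 by rewrite exprn_gt0// normr_gt0.
  have /(ub_le_sup bQ) : Q (`|T (`|x|^-1 *: x)| ^+ 2).
    exists (`|x|^-1 *: x); split => //; first exact: eig_compl_Z.
    by rewrite normrZ normfV normr_id mulVf// normr_eq0.
  by rewrite (linpZ lT) normrZ normfV normr_id exprMn exprVn mulrC ler_pdivrMr.
have iter_mu n x : M x -> `|iter n.+1 T x| ^+ 2 <= mu * `|iter n T x| ^+ 2.
  by move=> Mx; apply: le_mu; exact: eig_compl_iter.
have iter_mu1 n x : M x -> `|iter n.+1 T x| ^+ 2 <= mu ^+ n * `|T x| ^+ 2.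
  move=> Mx; elim: n => [|n IH]; first by rewrite mul1r.
  apply: le_trans (iter_mu _ _ Mx) _; rewrite [mu ^+ _]exprS -mulrA.
  by rewrite ler_wpM2l// ltW.
(* Outside a finite [s] the vectors of [D] contribute at most [mu / 4] to the
   Hilbert-Schmidt sum, hence at most a quarter of [mu^n] to that of [T^n]. *)
have hD : (\esum_(f in D) (`|T f| ^+ 2)%:E <= hs2 (@onb R E) T)%E.
  rewrite (hs2_onb cE (sa_sos saT) (onbP E) oC); apply: esum_sub_le; by move=> e [].
have [S [S0 hS]] : exists S, 0 <= S /\ (\esum_(f in D) (`|T f| ^+ 2)%:E = S%:E)%E.
  have h0 : (0 <= \esum_(f in D) (`|T f| ^+ 2)%:E)%E.
    by apply: esum_ge0 => e _; rewrite lee_fin sqr_ge0.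
  have hf : (\esum_(f in D) (`|T f| ^+ 2)%:E \is a fin_num)%E.
    by rewrite ge0_fin_numE// (le_lt_trans hD).
  exists (fine (\esum_(f in D) (`|T f| ^+ 2)%:E)%E); rewrite fineK//; split => //.
  by rewrite -lee_fin fineK.
have [s [us sD hs]] := esum_approx hS (divr_gt0 mu0 (ltr0n R 4)).
have tail n : (\esum_(f in D) (`|iter n.+1 T f| ^+ 2)%:E <=
    (\sum_(f <- s) `|iter n.+1 T f| ^+ 2 + mu ^+ n.+1 / 4)%:E)%E.
  apply: esum_le_seq => t ut tD; rewrite lee_fin.
  pose u := undup (s ++ t).
  have uu : uniq u by exact: undup_uniq.
  have uD : [set` u] `<=` D.
    by move=> e /=; rewrite mem_undup mem_cat => /orP[/sD|/tD].
  apply: (@le_trans _ _ (\sum_(f <- u) `|iter n.+1 T f| ^+ 2)).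
    rewrite (@sum_sub_seq _ _ t u)//; last first.
      by move=> e es; rewrite mem_undup mem_cat es orbT.
    by rewrite lerDl sumr_ge0// => *; exact: sqr_ge0.
  have su : {subset s <= u} by move=> e es; rewrite mem_undup mem_cat es.
  rewrite (@sum_sub_seq _ _ s u)// lerD2l.
  apply: (@le_trans _ _ (\sum_(f <- u | f \notin s) mu ^+ n * `|T f| ^+ 2)).
    rewrite big_seq_cond [leRHS]big_seq_cond; apply: ler_sum => f /andP[fu _].
    by apply: iter_mu1; apply: eig_compl_basis; exact: uD.
  rewrite -mulr_sumr exprSr -mulrA ler_wpM2l ?exprn_ge0 ?(ltW mu0)//.
  have : \sum_(f <- u) `|T f| ^+ 2 <= S.
    by rewrite -lee_fin -hS; apply: (@seq_le_esum _ _ D (fun f => `|T f| ^+ 2)).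
  rewrite (@sum_sub_seq _ _ s u)// => h2.
  rewrite -(lerD2l (\sum_(f <- s) `|T f| ^+ 2)); apply: le_trans h2 _.
  by rewrite -lerBlDr ltW.
(* For [d] of order [1 / n], a unit vector with |T x|^2 above [mu (1 - d)] keeps
   3/4 of [mu^n], by Bernoulli's inequality; the tail accounts for 1/4. *)
have low n : mu ^+ n.+1 / 2 <= \sum_(f <- s) `|iter n.+1 T f| ^+ 2.
  pose d : R := (4 * n.+1%:R)^-1.
  have d01 : 0 <= d <= 1.
    by rewrite invr_ge0 mulr_ge0//= invf_le1 ?mulr_gt0// -natrM ler1n muln_gt0.
  have dp : 0 < d by rewrite invr_gt0 mulr_gt0.
  have [_ [x [Mx x1 ->]] hx] := sup_adherent (mulr_gt0 mu0 dp) sQ.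
  have h1 : (mu * (1 - d)) ^+ n.+1 <= `|iter n.+1 T x| ^+ 2.
    have /andP[_ d1] := d01; apply: le_trans (norm_iter_pow n.+1 x1).
    have q0 : 0 <= mu * (1 - d) by rewrite mulr_ge0 ?(ltW mu0)// subr_ge0.
    by rewrite ler_pXn2r ?nnegrE ?sqr_ge0// mulrBr mulr1 ltW.
  have h2 := le_trans (iter_le_trace n.+1 Mx x1) (tail n).
  move: h2; rewrite lee_fin => h2.
  have h3 : mu ^+ n.+1 * (3 / 4) <= (mu * (1 - d)) ^+ n.+1.
    rewrite exprMn ler_wpM2l ?exprn_ge0 ?(ltW mu0)//.
    apply: le_trans (bernoulli n.+1 d01).
    rewrite /d invfM mulrCA divff ?pnatr_eq0// mulr1; lra.
  move: h1 h2 h3; move: (mu ^+ n.+1) (`|iter n.+1 T x| ^+ 2) ((mu * (1 - d)) ^+ n.+1).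
  by move=> p q r; move: (\sum_(f <- s) _) => w h1 h2 h3; lra.
pose b f n : R := `|iter n T f| ^+ 2 / mu ^+ n.
have b0 f n : 0 <= b f n by rewrite divr_ge0 ?sqr_ge0// exprn_ge0// ltW.
have bdec f n : M f -> b f n.+1 <= b f n.
  move=> Mf; rewrite /b ler_pdivrMr ?exprn_gt0// [mu ^+ n.+1]exprSr mulrA divfK ?lt0r_neq0 ?exprn_gt0//.
  by rewrite mulrC; exact: iter_mu.
have bdec' f m n : M f -> (m <= n)%N -> b f n <= b f m.
  move=> Mf; elim: n => [|n IH]; first by rewrite leqn0 => /eqP ->.
  by rewrite leq_eqVlt => /predU1P[->//|/IH]; apply: le_trans; exact: bdec.
(* If every [b f] with [f] in [s] came close to 0, so would their sum, against
   [low]. *)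
have [f [fs [dl [dl0 hdl]]]] : exists f, f \in s /\ exists d, 0 < d /\ forall n, d <= b f n.
  apply: contrapT => hno.
  have all_small (t : seq E) : {subset t <= s} -> forall d, 0 < d ->
      exists N, forall n, (N <= n)%N -> \sum_(f <- t) b f n < d.
    elim: t => [|f t IH] ts d d0; first by exists 0%N => n _; rewrite big_nil.
    have [|N1 h1] := IH _ (d / 2) (divr_gt0 d0 (ltr0n R 2)).
      by move=> g gt; apply: ts; rewrite inE gt orbT.
    have fs : f \in s by apply: ts; rewrite inE eqxx.
    have [N2 h2] : exists N, b f N < d / 2.
      apply: contrapT => h; apply: hno; exists f; split => //.
      exists (d / 2); split; first by rewrite divr_gt0.
      by move=> n; rewrite leNgt; apply/negP => hb; apply: h; exists n.
    exists (maxn N1 N2) => n; rewrite geq_max => /andP[n1 n2].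
    rewrite big_cons [ltRHS]splitr; apply: ltrD; last exact: h1.
    by apply: le_lt_trans h2; apply: bdec' => //; apply: eig_compl_basis; exact: sD.
  have [N hN] := all_small s (fun _ => id) (1 / 2) (divr_gt0 ltr01 (ltr0n R 2)).
  have := hN N.+1 (leqnSn N); rewrite ltNge => /negP; apply.
  by rewrite -mulr_suml ler_pdivlMr ?exprn_gt0// mulrC mulrA mulr1; exact: low.
have Mf : M f by apply: eig_compl_basis; exact: sD.
pose y n := (mu ^+ n)^-1 *: iter (n + n) T f.
have yin n m : inner (y n) (y m) = b f (n + m).
  rewrite innerZl innerZr /b.
  have -> : inner (iter (n + n) T f) (iter (m + m) T f) = `|iter (n + m)%N T f| ^+ 2.
    rewrite iterD iter_sa -iterD addnCA iterD -iter_sa -(iterD m n) (addnC m n).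
    by rewrite inner_normE.
  by rewrite exprD invfM mulrA mulrC.
have ydist n m : `|y n - y m| ^+ 2 = b f (n + n) - 2 * b f (n + m) + b f (m + m).
  by rewrite normB_sq -!inner_normE !yin.
pose Bs := [set b f n | n in [set: nat]].
have iB : has_inf Bs.
  by split; [exists (b f 0%N); exists 0%N|exists 0 => _ [n _ <-]].
pose c := inf Bs.
have hc n : c <= b f n by apply: ge_inf; [exact: iB.2|exists n].
have [l yl] : exists l : E, y @ \oo --> l.
  apply: cE => eps e0.
  have [_ [N _ <-] hN] := inf_adherent (exprn_gt0 2 (divr_gt0 e0 (ltr0n R 2)) : 0 < (eps / 2) ^+ 2) iB.
  exists N => m n Nm Nn; rewrite -(@ltr_pXn2r _ 2%N) ?nnegrE ?(ltW e0)//.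
  rewrite ydist.
  have k1 : b f (m + m) <= b f N by apply: bdec' => //; exact: leq_trans (leq_addr _ _).
  have k2 : b f (n + n) <= b f N by apply: bdec' => //; exact: leq_trans (leq_addr _ _).
  have k3 := hc (m + n)%N; move: hN; rewrite -/c expr_div_n => hN.
  have e2 : 0 < eps ^+ 2 by rewrite exprn_gt0.
  move: k1 k2 k3 hN e2; move: (b f (m + m)) (b f (n + n)) (b f N) (b f (m + n)) (eps ^+ 2).
  by move=> p q r w v k1 k2 k3 hN e2; lra.
exists l, mu; split => //.
- move=> e Be; apply: (cvg_real_unique (cvg_innerl (y := e) yl)).
  rewrite (_ : (fun n => _) = fun=> 0); first exact: cvg_cst.
  by apply/funext => n; rewrite innerZr eig_compl_iter// mulr0.
- have : dl <= `|l| ^+ 2.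
    have := cvg_norm_sq yl => h; rewrite -(cvg_lim (@Rhausdorff R) h).
    apply: limr_ge; first by apply/cvg_ex; eexists; exact: h.
    by apply: nearW => n; rewrite -inner_normE yin.
  by move=> h; rewrite -norm_sq0 gt_eqF// (lt_le_trans dl0).
- apply: inner_inj => z; rewrite innerZr -2!(proj2 saT).
  apply: (cvg_real_unique (cvg_innerl (y := T (T z)) yl)).
  rewrite (_ : (fun n => _) = (fun n => mu * inner z (y n.+1))).
    have := cvg_innerl (y := z) yl; rewrite -(cvg_shiftS (fun n => inner z (y n))).
    exact: cvgMl_tmp.
  apply/funext => n; rewrite 2!(proj2 saT) /y !(linpZ lT) !innerZr addSn addnS !iterS.
  by rewrite [mu ^+ n.+1]exprS invfM !mulrA divff ?mul1r// lt0r_neq0.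
Qed.
End Invariant.

(** Take a maximal orthonormal family of eigenvectors.  If it were not a basis,
    either [T] would vanish somewhere on its complement, or power iteration
    would give there an eigenvector [y] of [T^2] for some [mu = sg^2 > 0];
    then [T y + sg y] is an eigenvector of [T], unless it is 0 and [y] itself
    is one. *)
Theorem spectral_hs : exists B (lam : E -> R),
  is_onb B /\ forall e, B e -> T e = lam e *: e.
Proof.
pose p x := exists a : R, T x = a *: x.
have [B [_ oB Bp mB]] := @orthonormal_extend R E p set0 (orthonormal0 E) (fun _ => False_ind _).
have /choice[lam hlam] : forall e : E, exists a : R, B e -> T e = a *: e.
  by move=> e; have [/Bp[a ha]|nB] := pselect (B e); [exists a|exists 0].
exists B, lam; split => //.
have nomore x a : x != 0 -> (forall e, B e -> inner e x = 0) -> T x = a *: x -> False.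
  move=> x0 ox Tx; apply: (mB (`|x|^-1 *: x)).
  - by rewrite normrZ normfV normr_id mulVf// normr_eq0.
  - by exists a; rewrite (linpZ lT) Tx !scalerA mulrC.
  - by move=> e Be; rewrite innerZr ox// mulr0.
case: (oB) => nB oB'; split => // x ox; apply: contrapT => /eqP x0.
have [C BC oC] := onb_extend oB.
have [|y [mu [My y0 mu0 hy]]] := power_eigvec oC BC hlam.
  exists x; split => //; apply/eqP => Tx; apply: (nomore x 0) => //.
  by rewrite Tx scale0r.
pose sg := Num.sqrt mu.
have sg2 : sg * sg = mu by rewrite -expr2 sqr_sqrtr// ltW.
have [w0|w0] := eqVneq (T y + sg *: y) 0.
  apply: (nomore y (- sg)) => //; apply/eqP; rewrite scaleNr -subr_eq0 opprK.
  exact/eqP.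
apply: (nomore _ sg w0).
  apply: eig_compl_D => //; last exact: eig_compl_Z.
  exact: (eig_compl_stable hlam).
by rewrite (linpD lT) (linpZ lT) hy scalerDr scalerA sg2 addrC.
Qed.
End Spectral.

(** * Self-adjoint and skew-adjoint operators *)

Section SignedAdjoint.
Variables (R : realType) (H : innerProductType R).
Implicit Types (T K S : H -> H) (s : seq H).

Definition signed_adjoint (sg : R) T :=
  bounded_op T /\ forall x y, inner (T x) y = sg * inner x (T y).

Lemma skewE T : skew_adjoint T <-> signed_adjoint (-1) T.
Proof. by split => -[h1 h2]; split => // x y; rewrite h2 mulN1r. Qed.
Lemma saE T : self_adjoint T <-> signed_adjoint 1 T.
Proof. by split => -[h1 h2]; split => // x y; rewrite h2 mul1r. Qed.

Lemma signed_bound sg T : signed_adjoint sg T -> exists2 M, 0 < M & forall x, `|T x| <= M * `|x|.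
Proof. by move=> [[lT cT] _]; exact: linp_continuous_bound. Qed.

Lemma signed_sos sg T : `|sg| = 1 -> signed_adjoint sg T -> sym_or_skew T.
Proof. by move=> s1 [_ h]; exists sg. Qed.

Lemma signed_lincomb sg a T S : signed_adjoint sg T -> signed_adjoint sg S ->
  signed_adjoint sg (fun x => a *: T x + S x).
Proof.
move=> hT hS; have [M M0 hM] := signed_bound hT; have [N N0 hN] := signed_bound hS.
have [[lT cT] aT] := hT; have [[lS cS] aS] := hS.
have l : linear (fun x => a *: T x + S x).
  by move=> c x y; rewrite lT lS !scalerDr !scalerA [a * c]mulrC addrACA.
split; last by move=> x y; rewrite innerDl innerDr innerZl innerZr aT aS; ring.
split => //; apply: (@linp_bound_continuous _ _ _ _ l (`|a| * M + N)) => x.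
rewrite mulrDl; apply: le_trans (ler_normD _ _) _; apply: lerD => //.
by rewrite normrZ -mulrA ler_wpM2l.
Qed.

Lemma signed_0 sg : signed_adjoint sg (fun=> 0).
Proof.
have l : linear (fun=> 0 : H) by move=> a x y; rewrite scaler0 addr0.
split; last by move=> x y; rewrite inner0l inner0r mulr0.
by split => // x; exact: cvg_cst.
Qed.

End SignedAdjoint.

(** * Diagonal operators and the trace norm *)

Section Diagonal.
Variables (R : realType) (E : innerProductType R) (cE : @cauchy_complete R E).
Implicit Types (x y z : E) (s : seq E) (B C D : set E) (T S A : E -> E).

Lemma onb_dense_eq C (T S : E -> E) : is_onb C -> self_adjoint T -> self_adjoint S ->
  (forall e, C e -> T e = S e) -> T = S.
Proof.
move=> oC sT sS h; apply/funext => x; apply: inner_inj => z.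
have [M M0 hM] := sa_bound sT; have [N N0 hN] := sa_bound sS.
apply/eqP; rewrite -subr_eq0; apply/eqP.
apply: (@onb_ext _ _ C cE oC (fun x => inner z (T x) - inner z (S x)) (`|z| * (M + N))).
- by move=> u v; rewrite (linpD (sa_linear sT)) (linpD (sa_linear sS)) !innerDr; ring.
- by move=> a u; rewrite (linpZ (sa_linear sT)) (linpZ (sa_linear sS)) !innerZr mulrBr.
- move=> u; rewrite -innerBr; apply: le_trans (cauchy_schwarz _ _) _.
  rewrite -mulrA ler_wpM2l// mulrDl; apply: le_trans (ler_normB _ _) _.
  exact: lerD.
- by move=> e Ce; rewrite h// subrr.
Qed.

(** Riesz-Fischer applied to the coefficients [d e * <e, x>], square-summable
    because [d] is bounded. *)
Lemma diagonal_exists C (d : E -> R) Md : is_onb C -> (forall e, C e -> `|d e| <= Md) ->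
  exists D : E -> E, [/\ self_adjoint D, forall e, C e -> D e = d e *: e &
    forall e x, C e -> inner e (D x) = d e * inner e x].
Proof.
move=> oC hd; have oC' := onb_orthonormal oC.
have ex x : exists y, (forall e, C e -> inner e y = d e * inner e x) /\
    `|y| ^+ 2 <= Md ^+ 2 * `|x| ^+ 2.
  have bd : (\esum_(e in C) ((d e * inner e x) ^+ 2)%:E <= (Md ^+ 2 * `|x| ^+ 2)%:E)%E.
    rewrite EFinM -(parseval cE oC x) -esumZl ?sqr_ge0//; last by move=> *; exact: sqr_ge0.
    apply: le_esum => e Ce; rewrite lee_fin exprMn ler_wpM2r ?sqr_ge0//.
    rewrite -(real_normK (num_real (d e))) ler_pXn2r ?nnegrE ?hd//.
    exact: le_trans (normr_ge0 _) (hd _ Ce).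
  have [S /andP[_ hS1] hS] := esum_gt0_real (fun e _ => sqr_ge0 (d e * inner e x)) bd.
  by have [y [hy _ ny _]] := riesz_fischer cE oC' hS; exists y; split => //; rewrite ny.
have /choice[D hD] := ex.
have hDe e x : C e -> inner e (D x) = d e * inner e x by move=> Ce; exact: (hD x).1.
have DE e : C e -> D e = d e *: e.
  move=> Ce; apply: (onb_inj oC) => f Cf; rewrite hDe// innerZr.
  rewrite !(orthonormal_inner oC')//; case: eqVneq => [->//|_]; by rewrite !mulr0.
have lD : linear D.
  move=> a x y; apply: (onb_inj oC) => e Ce.
  by rewrite innerDr innerZr !hDe// innerDr innerZr; ring.
have bD x : `|D x| <= `|Md| * `|x|.
  rewrite -(@ler_pXn2r _ 2%N) ?nnegrE ?mulr_ge0// exprMn real_normK ?num_real//.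
  exact: (hD x).2.
exists D; split => //; split; first by split => //; exact: linp_bound_continuous bD.
move=> x y; apply/eqP; rewrite -subr_eq0; apply/eqP.
apply: (@onb_ext _ _ C cE oC (fun x => inner (D x) y - inner x (D y)) ((`|Md| * `|y| + `|D y|))).
- by move=> u v; rewrite (linpD lD) !innerDl; ring.
- by move=> a u; rewrite (linpZ lD) !innerZl mulrBr.
- move=> u; rewrite mulrDl; apply: le_trans (ler_normB _ _) _; apply: lerD.
    apply: le_trans (cauchy_schwarz _ _) _.
    by rewrite mulrAC; apply: ler_wpM2r.
  by apply: le_trans (cauchy_schwarz _ _) _; rewrite mulrC.
- by move=> e Ce; rewrite DE// innerZl hDe// subrr.
Qed.

(** The diagonal operator of the square roots is a square root of [T], which turns
    the form of [T] into a squared norm. *)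
Lemma diagonal_ge0 C (d : E -> R) T : is_onb C -> self_adjoint T ->
  (forall e, C e -> T e = d e *: e) -> (forall e, C e -> 0 <= d e) ->
  exists D : E -> E, [/\ self_adjoint D, forall e, C e -> D e = Num.sqrt (d e) *: e,
    (forall y, D (D y) = T y) & forall y, inner y (T y) = `|D y| ^+ 2].
Proof.
move=> oC sT hT d0; have [M M0 hM] := sa_bound sT.
have [|D [sD DE _]] := @diagonal_exists C (fun e => Num.sqrt (d e)) (Num.sqrt M) oC.
  move=> e Ce; rewrite ger0_norm ?sqrtr_ge0// ler_wsqrtr//.
  have := hM e; rewrite hT// normrZ (on_norm (onb_orthonormal oC) Ce) !mulr1.
  by rewrite ger0_norm ?d0.
have DD : D \o D = T.
  have lD := sa_linear sD.
  apply: (onb_dense_eq oC) => //.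
    split; last by move=> u v /=; rewrite 2!(proj2 sD).
    split; first by move=> a u v /=; rewrite lD lD.
    by move=> u; apply: continuous_comp; apply: (proj2 (proj1 sD)).
  by move=> e Ce /=; rewrite (DE e Ce) (linpZ lD) (DE e Ce) scalerA -expr2 sqr_sqrtr ?d0// hT.
exists D; split => // y; first by rewrite -DD.
by rewrite -DD /= -(proj2 sD) inner_normE.
Qed.

Lemma sa_lincomb a T S : self_adjoint T -> self_adjoint S ->
  self_adjoint (fun x => a *: T x + S x).
Proof. by move=> /saE sT /saE sS; apply/saE; exact: signed_lincomb. Qed.

Lemma positive_cs A x y : positive_op A ->
  inner (A x) y ^+ 2 <= inner (A x) x * inner (A y) y.
Proof.
move=> [sA A0]; have lA := sa_linear sA.
set p := inner (A x) x; set q := inner (A x) y; set r := inner (A y) y.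
apply: discriminant_le => [||t]; rewrite ?A0//.
have := A0 (x + t *: y); rewrite (linpD lA) (linpZ lA) !innerDl !innerDr !innerZl !innerZr.
by rewrite -/p -/q -/r (proj2 sA y x) (innerC y) -/q; congr (0 <= _); ring.
Qed.

(** Cauchy-Schwarz for the form of [A], at [x] and [A x]. *)
Lemma positive_norm_le A M x : positive_op A -> (forall x, `|A x| <= M * `|x|) ->
  `|A x| ^+ 2 <= M * inner (A x) x.
Proof.
move=> pA hM; have [->|Ax0] := eqVneq (A x) 0.
  by rewrite normr0 inner0l expr0n mulr0.
have p2 : 0 < `|A x| ^+ 2 by rewrite exprn_gt0// normr_gt0.
have := positive_cs x (A x) pA; rewrite inner_normE expr2 => h.
rewrite -(ler_pM2r p2); apply: le_trans h _; rewrite -mulrA mulrCA ler_wpM2l ?pA.2//.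
apply: le_trans (inner_le _ _) _; rewrite expr2 mulrA ler_wpM2r//.
Qed.

Section EigenData.
Variables (T : E -> E) (B : set E) (lam : E -> R).
Hypothesis sT : self_adjoint T.
Hypothesis hsT : (hs2 (@onb R E) T < +oo)%E.
Hypothesis oB : is_onb B.
Hypothesis eigB : forall e, B e -> T e = lam e *: e.

Lemma eig_bound : exists2 M, 0 < M & forall e, B e -> `|lam e| <= M.
Proof.
have [M M0 hM] := sa_bound sT; exists M => // e Be.
by have := hM e; rewrite eigB// normrZ (on_norm (onb_orthonormal oB) Be) !mulr1.
Qed.

(** |T| is diagonal in the eigenbasis; its square root [D] turns diagonal sums of
    |T| into Hilbert-Schmidt sums, which do not depend on the basis. *)
Lemma abs_diag_exists : exists A D : E -> E, [/\ is_abs_op T A, self_adjoint D,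
  (forall e, B e -> A e = `|lam e| *: e),
  (forall e, B e -> D e = Num.sqrt `|lam e| *: e) & forall y, inner y (A y) = `|D y| ^+ 2].
Proof.
have [M M0 hM] := eig_bound.
have [|A [sA AE _]] := @diagonal_exists B (fun e => `|lam e|) M oB.
  by move=> e Be; rewrite normr_id hM.
have [D [sD DE DD hD]] := diagonal_ge0 oB sA AE (fun e _ => normr_ge0 (lam e)).
exists A, D; split => //; split.
  by split => // x; rewrite innerC hD sqr_ge0.
have lA := sa_linear sA; have lT := sa_linear sT.
have : A \o A = T \o T.
  apply: (onb_dense_eq oB).
  - split; last by move=> u v /=; rewrite 2!(proj2 sA).
    split; first by move=> a u v /=; rewrite lA lA.
    by move=> u; apply: continuous_comp; apply: (proj2 (proj1 sA)).
  - split; last by move=> u v /=; rewrite 2!(proj2 sT).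
    split; first by move=> a u v /=; rewrite lT lT.
    by move=> u; apply: continuous_comp; apply: (proj2 (proj1 sT)).
  - move=> e Be /=; rewrite (AE e Be) (eigB Be) (linpZ lA) (linpZ lT) (AE e Be) (eigB Be) !scalerA.
    by rewrite -!expr2 real_normK ?num_real.
by rewrite adj_sa// => AT x; have := congr1 (fun f => f x) AT.
Qed.

(** Another positive root [A'] of [T^2] is again Hilbert-Schmidt, so it has an
    eigenbasis.  On an eigenvector [u] of [A'], comparing the components of
    [A' A' u] and [T T u] along [e] matches the squares of the eigenvalues
    whenever <e, u> is not 0. *)
Lemma abs_op_unique A A' : is_abs_op T A -> is_abs_op T A' ->
  (forall e, B e -> A e = `|lam e| *: e) -> A' = A.
Proof.
move=> [pA AA] [pA' AA'] AE; have sA' := pA'.1; have sA := pA.1.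
rewrite adj_sa// in AA AA'.
have lA' := sa_linear sA'; have lT := sa_linear sT.
have hsA : hs2 (@onb R E) A' = hs2 (@onb R E) T.
  apply: eq_esum => e _; rewrite -!inner_normE (proj2 sA') AA' (proj2 sT)//.
have [|B' [mu [oB' eB']]] := spectral_hs cE sA'; first by rewrite hsA.
have mu0 u : B' u -> 0 <= mu u.
  move=> Bu; have := pA'.2 u; rewrite eB'// innerZl inner_normE.
  by rewrite (on_norm (onb_orthonormal oB') Bu) expr1n mulr1.
apply: (onb_dense_eq oB') => // u Bu.
apply: (onb_inj oB) => e Be; rewrite eB'// innerZr -(proj2 sA) AE// innerZl.
have [->|eu] := eqVneq (inner e u) 0; first by rewrite !mulr0.
congr (_ * _).
have h1 : inner e (A' (A' u)) = mu u ^+ 2 * inner e u.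
  by rewrite (eB' u Bu) (linpZ lA') (eB' u Bu) scalerA innerZr expr2.
have h2 : inner e (T (T u)) = lam e ^+ 2 * inner e u.
  by rewrite -2!(proj2 sT) (eigB Be) (linpZ lT) (eigB Be) scalerA innerZl expr2.
have : mu u ^+ 2 = lam e ^+ 2 by apply: (mulIf eu); rewrite -h1 -h2 AA'.
move/eqP; rewrite -(real_normK (num_real (lam e))) eqrXn2 ?mu0// => /eqP //.
Qed.

Lemma is_abs_op_abs_op : is_abs_op T (abs_op T).
Proof.
have [A [D [hA _ _ _ _]]] := abs_diag_exists.
by rewrite /abs_op; apply: xgetPex; exists A.
Qed.

Lemma trace_norm_eig : trace_norm T = (\esum_(e in B) `|lam e|%:E)%E.
Proof.
have [A [D [hA sD AE DE AD]]] := abs_diag_exists.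
rewrite /trace_norm (abs_op_unique hA is_abs_op_abs_op AE).
under eq_esum do rewrite AD.
rewrite -/(hs2 _ _) (hs2_onb cE (sa_sos sD) (onbP E) oB); apply: eq_esum => e Be.
rewrite DE// normrZ (on_norm (onb_orthonormal oB) Be) mulr1 real_normK ?num_real//.
by rewrite sqr_sqrtr.
Qed.

Lemma hs2_eig : hs2 (@onb R E) T = (\esum_(e in B) (lam e ^+ 2)%:E)%E.
Proof.
rewrite (hs2_onb cE (sa_sos sT) (onbP E) oB); apply: eq_esum => e Be.
rewrite eigB// normrZ (on_norm (onb_orthonormal oB) Be) mulr1 real_normK ?num_real//.
Qed.

(** Both |T| + T and |T| - T are positive, so |<f, T f>| is at most <f, |T| f>. *)
Lemma abs_inner_sum_le s : ortho_seq s ->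
  ((\sum_(f <- s) `|inner f (T f)|)%:E <= trace_norm T)%E.
Proof.
move=> os; have [A [D [hA sD AE DE AD]]] := abs_diag_exists.
have sA := hA.1.1.
have -> : trace_norm T = hs2 (@onb R E) D.
  rewrite trace_norm_eig (hs2_onb cE (sa_sos sD) (onbP E) oB); apply: eq_esum => e Be.
  rewrite DE// normrZ (on_norm (onb_orthonormal oB) Be) mulr1 real_normK ?num_real//.
  by rewrite sqr_sqrtr.
apply: le_trans (hs2_seq_le cE (sa_sos sD) (onbP E) os).
rewrite lee_fin; apply: ler_sum => f _; rewrite -AD.
have sgn (sg : R) : `|sg| = 1 -> 0 <= inner f (A f) + sg * inner f (T f).
  move=> n1; have sAT := sa_lincomb sg sT sA.
  have [|e Be|D' [_ _ _ h]] := @diagonal_ge0 B (fun e => sg * lam e + `|lam e|) _ oB sAT.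
  - by move=> e Be /=; rewrite eigB// AE// scalerA scalerDl.
  - have := ler_norm (- (sg * lam e)); rewrite normrN normrM n1 mul1r; lra.
  - by have := sqr_ge0 (`|D' f|); rewrite -h innerDr innerZr addrC.
have := sgn 1 (normr1 _); have := sgn (-1) (normrN1 _).
by rewrite ler_norml => h1 h2; apply/andP; split; lra.
Qed.
End EigenData.

(** Variational form of the trace norm of self-adjoint operators.  As a supremum
    of finite sums of |<f, T f>| it is visibly subadditive and lower
    semicontinuous. *)
Definition nuc (T : E -> E) : \bar R :=
  ereal_sup [set (\sum_(f <- s) `|inner f (T f)|)%:E | s in [set s | ortho_seq s]].

Lemma nuc_ge T s : ortho_seq s -> ((\sum_(f <- s) `|inner f (T f)|)%:E <= nuc T)%E.
Proof. by move=> os; apply: ereal_sup_ubound; exists s. Qed.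

Lemma nuc_le T (M : \bar R) :
  (forall s, ortho_seq s -> ((\sum_(f <- s) `|inner f (T f)|)%:E <= M)%E) -> (nuc T <= M)%E.
Proof. by move=> h; apply: ge_ereal_sup => _ [s os <-]; exact: h. Qed.

Lemma trace_norm_nuc T : self_adjoint T -> (hs2 (@onb R E) T < +oo)%E ->
  trace_norm T = nuc T.
Proof.
move=> sT hT; have [B [lam [oB eB]]] := spectral_hs cE sT hT.
apply/eqP; rewrite eq_le; apply/andP; split; last first.
  by apply: nuc_le => s os; exact: (abs_inner_sum_le sT hT oB eB).
rewrite (trace_norm_eig sT hT oB eB); apply: esum_le_seq => s us sB.
have -> : \sum_(e <- s) `|lam e| = \sum_(e <- s) `|inner e (T e)|.
  rewrite big_seq [RHS]big_seq; apply: eq_bigr => e es; have Be := sB _ es.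
  by rewrite eB// innerZr inner_normE (on_norm (onb_orthonormal oB) Be) expr1n mulr1.
exact/nuc_ge/(onb_seq oB).
Qed.

(** The sum of the squares of the eigenvalues is at most the square of the sum of
    their moduli. *)
Lemma hs2_le_nuc T : self_adjoint T -> (hs2 (@onb R E) T < +oo)%E ->
  (hs2 (@onb R E) T <= nuc T * nuc T)%E.
Proof.
move=> sT hT; rewrite -trace_norm_nuc//; have [B [lam [oB eB]]] := spectral_hs cE sT hT.
rewrite (trace_norm_eig sT hT oB eB) (hs2_eig sT oB eB); apply: esum_le_seq => s us sB.
apply: (@le_trans _ _ ((\sum_(e <- s) `|lam e|) ^+ 2)%:E).
  rewrite lee_fin; elim: s {us sB} => [|e s IH]; first by rewrite !big_nil expr0n.
  rewrite !big_cons sqrrD real_normK ?num_real// -addrA lerD2l.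
  apply: le_trans IH _; rewrite lerDr mulrn_wge0// mulr_ge0// sumr_ge0//.
have h := @seq_le_esum _ _ B (fun e => `|lam e|) s us sB.
rewrite expr2 EFinM; apply: lee_pmul => //; rewrite lee_fin sumr_ge0//.
Qed.

(** With [A = |T|], |T e|^2 = |A e|^2 is at most a multiple of <A e, e>.  This
    makes the spectral theorem available for trace-class operators. *)
Lemma trace_class_hs T : self_adjoint T -> trace_class T -> (hs2 (@onb R E) T < +oo)%E.
Proof.
move=> sT [_ exA tT]; have hA : is_abs_op T (abs_op T) by rewrite /abs_op; exact: xgetPex.
have [pA AA] := hA; have [M M0 hM] := sa_bound pA.1.
rewrite adj_sa// in AA.
suff h : (hs2 (@onb R E) T <= M%:E * trace_norm T)%E.
  by apply: le_lt_trans h _; rewrite lte_mul_pinfty// lee_fin ltW.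
rewrite /trace_norm -esumZl ?(ltW M0)//; last by move=> e _; rewrite innerC pA.2.
apply: le_esum => e _; rewrite lee_fin.
rewrite -inner_normE (proj2 sT) -AA -(proj2 pA.1) inner_normE (innerC e).
exact: positive_norm_le.
Qed.

Lemma hs_trace_class T : self_adjoint T -> (hs2 (@onb R E) T < +oo)%E ->
  (nuc T < +oo)%E -> trace_class T.
Proof.
move=> sT hT nT; have [B [lam [oB eB]]] := spectral_hs cE sT hT.
split; first exact: sT.1; last by rewrite trace_norm_nuc.
by exists (abs_op T); exact: (is_abs_op_abs_op sT oB eB).
Qed.

Lemma nuc_ge0 T : (0 <= nuc T)%E.
Proof.
apply: le_trans (nuc_ge T (_ : ortho_seq [::])); first by rewrite big_nil.
by split => //; split.
Qed.

Lemma nucD T S : (nuc (fun x => (T x + S x)%R) <= nuc T + nuc S)%E.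
Proof.
apply: nuc_le => s os; apply: le_trans (leeD (nuc_ge T os) (nuc_ge S os)).
rewrite -EFinD lee_fin -big_split; apply: ler_sum => f _; rewrite innerDr.
exact: ler_normD.
Qed.

Lemma nucZ a T : nuc (fun x => (a *: T x)%R) = (`|a|%:E * nuc T)%E.
Proof.
have le b S : (nuc (fun x => (b *: S x)%R) <= `|b|%:E * nuc S)%E.
  apply: nuc_le => s os; apply: le_trans (lee_wpmul2l _ (nuc_ge S os)); last by rewrite lee_fin.
  rewrite -EFinM lee_fin mulr_sumr; apply: ler_sum => f _.
  by rewrite innerZr normrM.
apply/eqP; rewrite eq_le le/=.
have [->|a0] := eqVneq a 0; first by rewrite normr0 mul0e nuc_ge0.
have na : 0 < `|a| by rewrite normr_gt0.
rewrite -lee_pdivlMl// -normfV; apply: le_trans (le _ _).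
by apply: nuc_le => s os; apply: le_trans (nuc_ge _ os); rewrite lee_fin; apply: ler_sum => f _; rewrite scalerA mulVf ?scale1r.
Qed.

(** The quadratic form of [T] vanishes, hence so does its polarization. *)
Lemma nuc_eq0 T : self_adjoint T -> nuc T = 0%E -> forall x, T x = 0.
Proof.
move=> sT n0; have lT := sa_linear sT.
have q x : inner x (T x) = 0.
  have [->|x0] := eqVneq x 0; first by rewrite inner0l.
  have nx : `|x| != 0 by rewrite normr_eq0.
  have : ortho_seq [:: `|x|^-1 *: x].
    split => //; split => [e|e f] /=; rewrite !inE => /eqP ->.
      by rewrite normrZ normfV normr_id mulVf.
    by move=> /eqP ->.
  move/(nuc_ge T); rewrite n0 big_seq1 lee_fin normr_le0 (linpZ lT) innerZl innerZr.
  by rewrite !mulf_eq0 invr_eq0 (negPf nx) /= => /eqP.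
move=> x; apply: inner_eq0P => y.
have := q (x + y); rewrite (linpD lT) !innerDl !innerDr !q add0r addr0.
rewrite -(proj2 sT x y) (innerC (T x)) => h; have : 2 * inner y (T x) = 0.
  by rewrite -[RHS]h; ring.
by move/eqP; rewrite mulf_eq0 pnatr_eq0 => /eqP.
Qed.
End Diagonal.

(** * Gaussian moments *)

Section Density.
Context d (T : measurableType d) (R : realType).
Variables (mu nu : {measure set T -> \bar R}) (p : T -> R).
Hypothesis mp : measurable_fun setT p.
Hypothesis p0 : forall x, 0 <= p x.
Hypothesis nuE : forall U, measurable U -> nu U = (\int[mu]_(x in U) (p x)%:E)%E.

Lemma nnsfun_density (h : {nnsfun T >-> R}) :
  (\int[nu]_x (h x)%:E = \int[mu]_x ((h x)%:E * (p x)%:E))%E.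
Proof.
rewrite integralT_nnsfun sintegralE.
transitivity (\int[mu]_x (\sum_(k \in range h)
    (k%:E * (\1_(h @^-1` [set k]) x)%:E * (p x)%:E)))%E; last first.
  apply: eq_integral => x _; rewrite [in RHS](fimfunE h x) -fsumEFin//.
  rewrite ge0_mule_fsuml// => k; rewrite EFinM; exact: nnfun_muleindic_ge0.
have mI k : measurable_fun setT (fun x : T => (k%:E * (\1_(h @^-1` [set k]) x)%:E * (p x)%:E)%E).
  apply: emeasurable_funM; last exact/measurable_EFinP.
  apply/measurable_EFinP; apply: measurable_funM => //.
rewrite ge0_integral_fsum//; last first.
  move=> k x _; apply: mule_ge0; last by rewrite lee_fin.
  exact: nnfun_muleindic_ge0.
apply: eq_fsbigr => k /set_mem [x0 _ hk].
have k0 : 0 <= k by rewrite -hk.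
under [RHS]eq_integral do rewrite -muleA.
rewrite ge0_integralZl_EFin//; last 2 first.
  - by move=> x _; apply: mule_ge0; rewrite lee_fin.
  - apply: emeasurable_funM; apply/measurable_EFinP => //.
congr (_ * _)%E; rewrite nuE// integral_mkcond; apply: eq_integral => x _.
rewrite patchE indicE; case: ifPn => _; first by rewrite mul1e.
by rewrite mul0e.
Qed.

(** Monotone convergence from simple functions. *)
Lemma integral_density (f : T -> R) : measurable_fun setT f -> (forall x, 0 <= f x) ->
  (\int[nu]_x (f x)%:E = \int[mu]_x ((f x)%:E * (p x)%:E))%E.
Proof.
move=> mf f0; have mEf : measurable_fun setT (EFin \o f) by exact/measurable_EFinP.
pose g := nnsfun_approx measurableT mEf.
have gf x : (g n x)%:E @[n --> \oo] --> (f x)%:E.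
  by apply: (cvg_nnsfun_approx measurableT mEf) => // y _; rewrite lee_fin.
have g_nd x : {homo (fun n => (g n x)%:E) : m n / (m <= n)%N >-> (m <= n)%E}.
  by move=> m n mn; rewrite lee_fin; exact/lefP/nd_nnsfun_approx.
have m1 n : measurable_fun setT (fun x => (g n x)%:E) by exact/measurable_EFinP.
have g0 n x : setT x -> (0 <= (g n x)%:E)%E by move=> _; rewrite lee_fin.
have E1 := @monotone_convergence _ _ _ nu setT measurableT (fun n x => (g n x)%:E)
  m1 g0 (fun x _ => g_nd x).
transitivity (limn (fun n => \int[nu]_x (g n x)%:E))%E.
  rewrite -E1; apply: eq_integral => x _; apply/esym/cvg_lim => //; exact: gf.
under eq_fun do rewrite nnsfun_density.
have m2 n : measurable_fun setT (fun x => (g n x)%:E * (p x)%:E)%E.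
  by apply: emeasurable_funM => //; exact/measurable_EFinP.
have g20 n x : setT x -> (0 <= (g n x)%:E * (p x)%:E)%E by move=> _; apply: mule_ge0; rewrite lee_fin.
have E2 := @monotone_convergence _ _ _ mu setT measurableT (fun n x => (g n x)%:E * (p x)%:E)%E
  m2 g20.
rewrite -E2; last by move=> x _ m n mn; apply: lee_wpmul2r; rewrite ?lee_fin//; exact: g_nd.
by apply: eq_integral => x _; apply/cvg_lim => //; apply: cvgeZr => //; exact: gf.
Qed.
End Density.

Section Gauss.
Variable R : realType.
Notation mu := (@lebesgue_measure R).
Let G (a x : R) : R := expR (- (a * x) ^+ 2 / 2).
Let c0 : R := Num.sqrt (pi *+ 2).

Let c0_gt0 : 0 < c0. Proof. by rewrite sqrtr_gt0 pmulrn_lgt0// pi_gt0. Qed.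

Let mG a : measurable_fun setT (G a).
Proof.
apply: measurableT_comp => //; apply: measurable_funM => //.
apply: measurableT_comp => //; apply: measurable_funX; exact: measurable_funM.
Qed.
Let mXG a n : measurable_fun setT (fun x : R => x ^+ n * G a x).
Proof. by apply: measurable_funM => //; exact: measurable_funX. Qed.

Let mGE a : measurable_fun [set: measurableTypeR R] (fun x => (G a x)%:E).
Proof. by apply/measurable_EFinP; exact: mG. Qed.
Let mXGE a n : measurable_fun [set: measurableTypeR R] (fun x => (x ^+ n * G a x)%:E).
Proof. by apply/measurable_EFinP; exact: mXG. Qed.

Let G_ge0 a x : 0 <= G a x. Proof. exact: expR_ge0. Qed.

Let normal_pdf_G s x : 0 < s -> normal_pdf 0 s x = (s * c0)^-1 * G s^-1 x.
Proof.
move=> s0; rewrite normal_pdfE ?gt_eqF// /normal_peak /normal_fun /G /c0 subr0.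
rewrite -mulrnAr sqrtrM ?sqr_ge0// sqrtr_sqr gtr0_norm//; congr (_ * expR _).
rewrite exprMn exprVn -mulr_natr; field; by rewrite gt_eqF.
Qed.

Let Gge0 a (x : R) : [set: measurableTypeR R] x -> (0 <= (G a x)%:E)%E.
Proof. by move=> _; rewrite lee_fin. Qed.
Let XGge0 a (x : R) : [set: measurableTypeR R] x -> (0 <= (x ^+ 2 * G a x)%:E)%E.
Proof. by move=> _; rewrite lee_fin mulr_ge0 ?sqr_ge0. Qed.

Let intGZ k a : 0 <= k ->
  (\int[mu]_x (k%:E * (G a x)%:E) = k%:E * \int[mu]_x (G a x)%:E)%E.
Proof. by move=> k0; apply: ge0_integralZl_EFin => //; exact: Gge0. Qed.
Let intXGZ k a : 0 <= k ->
  (\int[mu]_x (k%:E * (x ^+ 2 * G a x)%:E) = k%:E * \int[mu]_x (x ^+ 2 * G a x)%:E)%E.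
Proof. by move=> k0; apply: ge0_integralZl_EFin => //; exact: XGge0. Qed.

Let integral_G a : 0 < a -> (\int[mu]_x (G a x)%:E = (c0 / a)%:E)%E.
Proof.
move=> a0; have := integral_normal_pdf (0 : R) a^-1.
under eq_integral do rewrite (@normal_pdf_G a^-1) ?invr_gt0// invrK EFinM.
have k0 : 0 < (a^-1 * c0)^-1 by rewrite invr_gt0 mulr_gt0// invr_gt0.
rewrite intGZ ?(ltW k0)//.
move/(congr1 (fun z => (a^-1 * c0)%:E * z)%E).
rewrite muleA -EFinM mulfV ?mul1e ?mule1.
  by rewrite mulrC.
by apply: lt0r_neq0; rewrite -invr_gt0.
Qed.

(** The second moment of [G a].  The integral of [G a] is [c0 / a], with
    derivative [- a W a] in [a].  Instead of differentiating under the
    integral, [W_upper] and [W_lower] bound difference quotients by convexity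
    of the exponential, and these squeeze [W a]. *)
Let W a := (\int[mu]_x (x ^+ 2 * G a x)%:E)%E.

Let G_split (a b x : R) : G b x = G a x * expR (- ((b ^+ 2 - a ^+ 2) * x ^+ 2 / 2)).
Proof. by rewrite /G -expRD; congr expR; rewrite !exprMn; lra. Qed.

Let mD k u v : measurable_fun [set: measurableTypeR R]
  (fun x => k%:E * (x ^+ 2 * G u x)%:E + (G v x)%:E)%E.
Proof. by apply: emeasurable_funD; [apply: emeasurable_funM => //; exact: mXGE|exact: mGE]. Qed.
Let intD k u v : 0 <= k ->
  (\int[mu]_x (k%:E * (x ^+ 2 * G u x)%:E) + \int[mu]_x (G v x)%:E =
   \int[mu]_x (k%:E * (x ^+ 2 * G u x)%:E + (G v x)%:E))%E.
Proof.
move=> k0; rewrite ge0_integralD//; try exact: mGE; try exact: Gge0.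
- by move=> x _; rewrite -EFinM lee_fin mulr_ge0// mulr_ge0 ?sqr_ge0.
- by apply: emeasurable_funM => //; exact: mXGE.
Qed.

Let W_upper a b : 0 < a -> a < b ->
  (((b ^+ 2 - a ^+ 2) / 2)%:E * W b + (c0 / b)%:E <= (c0 / a)%:E)%E.
Proof.
move=> a0 ab; have b0 := lt_trans a0 ab.
have k0 : 0 <= (b ^+ 2 - a ^+ 2) / 2.
  by rewrite divr_ge0// subr_ge0 ler_pXn2r ?nnegrE ?(ltW a0) ?(ltW b0) ?(ltW ab).
rewrite -(integral_G a0) -(integral_G b0) /W -intXGZ//.
rewrite intD//.
apply: ge0_le_integral; [by []| |exact: mD|exact: mGE|].
  by move=> x _; rewrite -EFinM -EFinD lee_fin addr_ge0// mulr_ge0// mulr_ge0 ?sqr_ge0.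
- move=> x _; rewrite -EFinM -EFinD lee_fin (G_split b a).
  have -> : - ((a ^+ 2 - b ^+ 2) * x ^+ 2 / 2) = (b ^+ 2 - a ^+ 2) / 2 * x ^+ 2 by lra.
  rewrite mulrA -[X in _ + X]mul1r -mulrDl mulrC ler_wpM2l// addrC.
  exact: expR_ge1Dx.
Qed.

Let W_lower a b : 0 < a -> a < b ->
  ((c0 / a)%:E <= ((b ^+ 2 - a ^+ 2) / 2)%:E * W a + (c0 / b)%:E)%E.
Proof.
move=> a0 ab; have b0 := lt_trans a0 ab.
have k0 : 0 <= (b ^+ 2 - a ^+ 2) / 2.
  by rewrite divr_ge0// subr_ge0 ler_pXn2r ?nnegrE ?(ltW a0) ?(ltW b0) ?(ltW ab).
rewrite -(integral_G a0) -(integral_G b0) /W -intXGZ//.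
rewrite intD//.
apply: ge0_le_integral; [by []|exact: Gge0|exact: mGE|exact: mD|].
- move=> x _; rewrite -EFinM -EFinD lee_fin (G_split a b).
  rewrite mulrA [X in _ <= X + _]mulrC -mulrDr -[leLHS]mulr1 ler_wpM2l//.
  rewrite -lerBlDl mulrAC; apply: le_trans (expR_ge1Dx _); lra.
Qed.

Let WE a : 0 < a -> W a = (c0 / a ^+ 3)%:E.
Proof.
move=> a0.
have W0 : (0 <= W a)%E by apply: integral_ge0 => x _; rewrite lee_fin mulr_ge0 ?sqr_ge0.
have fW : W a \is a fin_num.
  rewrite ge0_fin_numE// ltNge leye_eq; apply/eqP => WE.
  have h2 : 0 < a / 2 by rewrite divr_gt0.
  have h3 : a / 2 < a by rewrite ltr_pdivrMr// ltr_pMr// ltr1n.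
  have := W_upper h2 h3; rewrite WE gt0_muley.
    by rewrite addye// leye_eq.
  rewrite lte_fin divr_gt0// subr_gt0 ltr_pXn2r ?nnegrE ?(ltW h2) ?(ltW a0)//.
have [w w0 Ww] : exists2 w, 0 <= w & W a = w%:E.
  by exists (fine (W a)); rewrite ?fineK// -lee_fin fineK.
rewrite Ww; congr EFin.
have up x : 0 < x -> x < a -> w * (x * a * (x + a)) <= 2 * c0.
  move=> x0 xa; have := W_upper x0 xa; rewrite Ww -EFinM -EFinD lee_fin => h.
  have ax : 0 < a - x by rewrite subr_gt0.
  rewrite -(ler_pM2l ax); have xap : 0 < 2 * x * a by rewrite !mulr_gt0.
  have := ler_wpM2l (ltW xap) h.
  have -> : 2 * x * a * ((a ^+ 2 - x ^+ 2) / 2 * w + c0 / a) =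
      (a - x) * (w * (x * a * (x + a))) + 2 * x * c0 by field; rewrite gt_eqF.
  have -> : 2 * x * a * (c0 / x) = 2 * a * c0 by field; rewrite gt_eqF.
  by rewrite -lerBrDr => /le_trans; apply; rewrite le_eqVlt; apply/orP; left; apply/eqP; ring.
have lo x : a < x -> 2 * c0 <= w * (a * x * (a + x)).
  move=> ax; have x0 := lt_trans a0 ax; have := W_lower a0 ax; rewrite Ww -EFinM -EFinD lee_fin => h.
  have xa : 0 < x - a by rewrite subr_gt0.
  rewrite -(ler_pM2l xa); have xap : 0 < 2 * a * x by rewrite !mulr_gt0.
  have := ler_wpM2l (ltW xap) h.
  have -> : 2 * a * x * ((x ^+ 2 - a ^+ 2) / 2 * w + c0 / x) =
      (x - a) * (w * (a * x * (a + x))) + 2 * a * c0 by field; rewrite gt_eqF.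
  have -> : 2 * a * x * (c0 / a) = 2 * x * c0 by field; rewrite gt_eqF.
  by rewrite -lerBlDr; apply: le_trans; rewrite le_eqVlt; apply/orP; left; apply/eqP; ring.
have a3 : 0 < a ^+ 3 by rewrite exprn_gt0.
have key : w * a ^+ 3 = c0.
  apply/eqP; rewrite eq_le; apply/andP; split.
  - apply/ler_addgt0Pr => e e0.
    pose k := 3 * a ^+ 2 * w; have k0 : 0 <= k by rewrite /k !mulr_ge0 ?(ltW a0).
    pose dl := Num.min (a / 2) (2 * e / (k + 1)).
    have k1 : 0 < k + 1 by rewrite ltr_wpDl.
    have dl0 : 0 < dl by rewrite lt_min !divr_gt0// mulr_gt0.
    have dla : dl <= a / 2 by rewrite ge_min lexx.
    have kdl : k * dl <= 2 * e.
      apply: (@le_trans _ _ (k * (2 * e / (k + 1)))).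
        by rewrite ler_wpM2l// ge_min lexx orbT.
      rewrite mulrCA ger_pMr ?mulr_gt0// ler_pdivrMr// mul1r lerDl ler01//.
    have adl : dl < a by apply: le_lt_trans dla _; rewrite ltr_pdivrMr// ltr_pMr// ltr1n.
    have := up (a - dl); rewrite subr_gt0 adl gtrBl dl0 => /(_ isT isT).
    have -> : w * ((a - dl) * a * (a - dl + a)) = 2 * (w * a ^+ 3) - k * dl + w * a * dl ^+ 2.
      by rewrite /k; ring.
    have : 0 <= w * a * dl ^+ 2 by rewrite !mulr_ge0 ?(ltW a0) ?(ltW dl0).
    move: kdl; move: (k * dl) (w * a * dl ^+ 2) (w * a ^+ 3) => p q r *; lra.
  - apply/ler_addgt0Pr => e e0.
    pose k := (3 * a ^+ 2 + a) * w.
    have k0 : 0 <= k by rewrite /k mulr_ge0// addr_ge0 ?mulr_ge0 ?(ltW a0).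
    pose dl := Num.min 1 (2 * e / (k + 1)).
    have k1 : 0 < k + 1 by rewrite ltr_wpDl.
    have dl0 : 0 < dl by rewrite lt_min ltr01 !divr_gt0// mulr_gt0.
    have dl1 : dl <= 1 by rewrite ge_min lexx.
    have kdl : k * dl <= 2 * e.
      apply: (@le_trans _ _ (k * (2 * e / (k + 1)))).
        by rewrite ler_wpM2l// ge_min lexx orbT.
      rewrite mulrCA ger_pMr ?mulr_gt0// ler_pdivrMr// mul1r lerDl ler01//.
    have := lo (a + dl); rewrite ltrDl dl0 => /(_ isT).
    have -> : w * (a * (a + dl) * (a + (a + dl))) = 2 * (w * a ^+ 3) + k * dl - w * a * dl * (1 - dl).
      by rewrite /k; ring.
    have : 0 <= w * a * dl * (1 - dl) by rewrite !mulr_ge0 ?subr_ge0 ?(ltW a0) ?(ltW dl0).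
    move: kdl; move: (k * dl) (w * a * dl * (1 - dl)) (w * a ^+ 3) => p q r *; lra.
by rewrite -key mulfK// gt_eqF.
Qed.

Lemma normal_pdf_second_moment s : 0 < s ->
  (\int[mu]_x ((x ^+ 2)%:E * (normal_pdf 0 s x)%:E) = (s ^+ 2)%:E)%E.
Proof.
move=> s0; transitivity (\int[mu]_x ((s * c0)^-1%:E * (x ^+ 2 * G s^-1 x)%:E))%E.
  apply: eq_integral => x _; rewrite normal_pdf_G// -!EFinM; congr EFin; ring.
rewrite intXGZ ?invr_ge0 ?mulr_ge0 ?(ltW s0) ?(ltW c0_gt0)//.
rewrite -/(W s^-1) WE ?invr_gt0// -EFinM; congr EFin.
by rewrite exprVn invrK; field; rewrite !gt_eqF.
Qed.

(** A crude constant suffices: (u / 2)^2 <= exp u absorbs [x^4] into a Gaussian of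
    twice the deviation. *)
Lemma normal_pdf_fourth_moment s : 0 < s ->
  (\int[mu]_x ((x ^+ 4)%:E * (normal_pdf 0 s x)%:E) <= (64 * s ^+ 4)%:E)%E.
Proof.
move=> s0; set a := s^-1; have a0 : 0 < a by rewrite invr_gt0.
have a20 : 0 < a / 2 by rewrite divr_gt0.
pose k := (s * c0)^-1 * (256 / 9 * s ^+ 4).
have k0 : 0 <= k by rewrite /k mulr_ge0// ?invr_ge0 ?mulr_ge0 ?exprn_ge0 ?(ltW s0) ?(ltW c0_gt0).
apply: (@le_trans _ _ (\int[mu]_x (k%:E * (G (a / 2) x)%:E))%E).
  apply: ge0_le_integral; [by []| | | |].
  - by move=> x _; rewrite -EFinM lee_fin mulr_ge0 ?normal_pdf_ge0// exprn_even_ge0.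
  - apply: emeasurable_funM; apply/measurable_EFinP; last exact: measurable_normal_pdf.
    exact: measurable_funX.
  - by apply: emeasurable_funM => //; exact: mGE.
  - move=> x _; rewrite -!EFinM lee_fin normal_pdf_G// -/a /k.
    rewrite -[leRHS]mulrA mulrCA ler_wpM2l ?invr_ge0 ?mulr_ge0 ?(ltW s0) ?(ltW c0_gt0)//.
    pose u := 3 * (a * x) ^+ 2 / 8.
    have -> : G a x = G (a / 2) x * expR (- u).
      by rewrite /G -expRD; congr expR; rewrite /u !exprMn; lra.
    rewrite mulrCA mulrC ler_wpM2r//.
    have u0 : 0 <= u by rewrite divr_ge0// mulr_ge0 ?sqr_ge0.
    have hu : (u / 2) ^+ 2 <= expR u.
      have -> : expR u = expR (u / 2) ^+ 2 by rewrite expr2 -expRD -splitr.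
      have u2 : 0 <= u / 2 by exact: divr_ge0 u0 (ler0n _ 2).
      rewrite ler_pXn2r ?nnegrE ?expR_ge0 ?u2//.
      by apply: le_trans (expR_ge1Dx _); rewrite lerDr.
    have -> : x ^+ 4 = 64 / 9 * s ^+ 4 * u ^+ 2.
      by rewrite /u /a; field; rewrite gt_eqF.
    rewrite expRN mulrC ler_pdivrMl ?expR_gt0//.
    rewrite expr_div_n in hu; have s4 : 0 <= s ^+ 4 by rewrite exprn_ge0// ltW.
    have := ler_wpM2l s4 hu; move: (expR u) (s ^+ 4) (u ^+ 2) => p q r; lra.
rewrite intGZ// integral_G// -EFinM lee_fin /k.
have -> : (s * c0)^-1 * (256 / 9 * s ^+ 4) * (c0 / (a / 2)) = 512 / 9 * s ^+ 4.
  by rewrite /a; field; rewrite !gt_eqF.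
by rewrite ler_wpM2r ?exprn_ge0 ?(ltW s0)//; lra.
Qed.
End Gauss.

(** * Square-integrable random variables *)

Section SquareIntegrable.
Context d (T : measurableType d) (R : realType) (P : probability T R).
Implicit Types (f g h : T -> R).

Definition L1 f : Prop := P.-integrable setT (EFin \o f).
Definition L2 f : Prop := measurable_fun setT f /\ L1 (fun w => f w ^+ 2).
(** Expectation as a real number, meaningful under [L1]. *)
Definition Ex f : R := Rintegral P setT f.

Lemma L1_meas f : L1 f -> measurable_fun setT f.
Proof. by move/measurable_int/measurable_EFinP. Qed.

Lemma ExE f : L1 f -> (\int[P]_w (f w)%:E = (Ex f)%:E)%E.
Proof. by move=> hf; rewrite /Ex /Rintegral fineK//; exact: integrable_fin_num. Qed.

Lemma expectE f : L1 f -> ('E_P[f] = (Ex f)%:E)%E.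
Proof. by move=> hf; rewrite unlock ExE. Qed.

Lemma eq_L1 f g : f =1 g -> L1 f -> L1 g.
Proof. by move=> /funext ->. Qed.
Lemma eq_Ex f g : f =1 g -> Ex f = Ex g.
Proof. by move=> /funext ->. Qed.

Lemma L1_le f g : measurable_fun setT f -> (forall w, `|f w| <= g w) -> L1 g -> L1 f.
Proof.
move=> mf fg; apply: le_integrable => //; first exact/measurable_EFinP.
by move=> w _ /=; rewrite lee_fin (le_trans (fg w))// ler_norm.
Qed.

Lemma L1_cst c : L1 (fun=> c).
Proof. exact: finite_measure_integrable_cst. Qed.
Lemma L1D f g : L1 f -> L1 g -> L1 (fun w => f w + g w).
Proof.
move=> hf hg; have := integrableD measurableT hf hg.
by apply: eq_integrable => // w _.
Qed.
Lemma L1Z c f : L1 f -> L1 (fun w => c * f w).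
Proof.
move=> hf; have := integrableZl measurableT c hf.
by apply: eq_integrable => // w _.
Qed.
Lemma L1_sum (I : Type) (r : seq I) (F : I -> T -> R) :
  (forall i, L1 (F i)) -> L1 (fun w => \sum_(i <- r) F i w).
Proof.
move=> h; elim: r => [|i r IH].
  by apply: (eq_L1 (f := fun=> 0)); [move=> w; rewrite big_nil|exact: L1_cst].
apply: (eq_L1 (f := fun w => F i w + \sum_(i <- r) F i w)).
  by move=> w; rewrite big_cons.
exact: L1D.
Qed.

Lemma Ex_cst c : Ex (fun=> c) = c.
Proof. transitivity (c * fine (P setT)); [exact: Rintegral_cst|by rewrite probability_setT mulr1]. Qed.
Lemma ExD f g : L1 f -> L1 g -> Ex (fun w => f w + g w) = Ex f + Ex g.
Proof. by move=> hf hg; exact: RintegralD. Qed.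
Lemma ExB f g : L1 f -> L1 g -> Ex (fun w => f w - g w) = Ex f - Ex g.
Proof. by move=> hf hg; exact: RintegralB. Qed.
Lemma ExZ c f : L1 f -> Ex (fun w => c * f w) = c * Ex f.
Proof. by move=> hf; exact: RintegralZl. Qed.
Lemma Ex_sum (I : Type) (r : seq I) (F : I -> T -> R) :
  (forall i, L1 (F i)) -> Ex (fun w => \sum_(i <- r) F i w) = \sum_(i <- r) Ex (F i).
Proof.
move=> h; elim: r => [|i r IH].
  by rewrite big_nil -[RHS](Ex_cst 0); apply: eq_Ex => w; rewrite big_nil.
rewrite big_cons -IH -ExD//; last exact: L1_sum.
by apply: eq_Ex => w; rewrite big_cons.
Qed.
Lemma Ex_ge0 f : (forall w, 0 <= f w) -> 0 <= Ex f.
Proof. by move=> f0; apply: Rintegral_ge0. Qed.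
Lemma Ex_le f g : L1 f -> L1 g -> (forall w, f w <= g w) -> Ex f <= Ex g.
Proof. by move=> hf hg fg; apply: le_Rintegral. Qed.

Lemma ae_eq_Ex f g : measurable_fun setT f -> measurable_fun setT g ->
  {ae P, forall w, f w = g w} -> Ex f = Ex g.
Proof.
move=> mf mg fg; congr fine; apply: ae_eq_integral => //; try exact/measurable_EFinP.
by apply: filterS fg => w h _; rewrite h.
Qed.

Lemma ae_eq_L1 f g : measurable_fun setT g ->
  {ae P, forall w, f w = g w} -> L1 f -> L1 g.
Proof.
move=> mg fg hf; apply/integrableP; split; first exact/measurable_EFinP.
have /integrableP[mf hf'] := hf; apply: le_lt_trans hf'; rewrite le_eqVlt; apply/orP; left.
apply/eqP; apply: ae_eq_integral => //.
- by apply: measurableT_comp => //; exact/measurable_EFinP.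
- by apply: measurableT_comp => //.
- by apply: filterS fg => w h _ /=; rewrite h.
Qed.

Lemma L1_ge0 f : measurable_fun setT f -> (forall w, 0 <= f w) ->
  (\int[P]_w (f w)%:E < +oo)%E -> L1 f.
Proof.
move=> mf f0 h; apply/integrableP; split; first exact/measurable_EFinP.
by under eq_integral do rewrite /= ger0_norm//.
Qed.

Lemma L2_meas f : L2 f -> measurable_fun setT f. Proof. by case. Qed.
Lemma L2_sq f : L2 f -> L1 (fun w => f w ^+ 2). Proof. by case. Qed.
Lemma eq_L2 f g : f =1 g -> L2 f -> L2 g.
Proof. by move=> /funext ->. Qed.

Lemma L2_mul f g : L2 f -> L2 g -> L1 (fun w => f w * g w).
Proof.
move=> [mf hf] [mg hg]; apply: (@L1_le _ (fun w => f w ^+ 2 + g w ^+ 2)).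
- exact: measurable_funM.
- move=> w; rewrite -subr_ge0; have := sqr_ge0 (`|f w| - `|g w|).
  have := sqr_ge0 (f w); have := sqr_ge0 (g w).
  rewrite normrM sqrrB !real_normK ?num_real//.
  move: (`|f w| * `|g w|) (f w ^+ 2) (g w ^+ 2) => p q r.
  by rewrite -mulr_natr => h1 h2 h3; lra.
- exact: L1D.
Qed.
Lemma L2_cst c : L2 (fun=> c).
Proof. by split; [exact: measurable_cst|exact: L1_cst]. Qed.
Lemma L2_L1 f : L2 f -> L1 f.
Proof.
move=> hf; apply: (eq_L1 (f := fun w => f w * 1)); first by move=> w; rewrite mulr1.
by apply: L2_mul => //; exact: L2_cst.
Qed.
Lemma L2D f g : L2 f -> L2 g -> L2 (fun w => f w + g w).
Proof.
move=> hf hg; split; first by apply: measurable_funD; exact: L2_meas.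
apply: (eq_L1 (f := fun w => f w ^+ 2 + 2 * (f w * g w) + g w ^+ 2)).
  by move=> w; ring.
by apply: L1D; [apply: L1D; [exact: L2_sq|apply: L1Z; exact: L2_mul]|exact: L2_sq].
Qed.
Lemma L2Z c f : L2 f -> L2 (fun w => c * f w).
Proof.
move=> [mf hf]; split; first exact: measurable_funM.
by apply: (eq_L1 (f := fun w => c ^+ 2 * f w ^+ 2)); [move=> w; ring|exact: L1Z].
Qed.
Lemma L2B f g : L2 f -> L2 g -> L2 (fun w => f w - g w).
Proof.
move=> hf hg; apply: (eq_L2 (f := fun w => f w + -1 * g w)).
  by move=> w; rewrite mulN1r.
by apply: L2D => //; exact: L2Z.
Qed.
Lemma L2_sum (I : Type) (r : seq I) (F : I -> T -> R) :
  (forall i, L2 (F i)) -> L2 (fun w => \sum_(i <- r) F i w).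
Proof.
move=> h; elim: r => [|i r IH].
  by apply: (eq_L2 (f := fun=> 0)); [move=> w; rewrite big_nil|exact: L2_cst].
apply: (eq_L2 (f := fun w => F i w + \sum_(i <- r) F i w)).
  by move=> w; rewrite big_cons.
exact: L2D.
Qed.

Lemma L2_expect f : measurable_fun setT f -> ('E_P[fun w => (f w ^+ 2)%R] < +oo)%E -> L2 f.
Proof.
move=> mf; rewrite unlock => h; split => //; apply: L1_ge0 => //.
- exact: measurable_funX.
- by move=> w; exact: sqr_ge0.
Qed.

(** Squared norm of L^2; working with squares avoids roots in the isometries. *)
Definition nrm2 f : R := Ex (fun w => f w ^+ 2).

Lemma nrm2_ge0 f : 0 <= nrm2 f.
Proof. by apply: Ex_ge0 => w; exact: sqr_ge0. Qed.

Lemma nrm2D f g : L2 f -> L2 g ->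
  nrm2 (fun w => f w + g w) = nrm2 f + 2 * Ex (fun w => f w * g w) + nrm2 g.
Proof.
move=> hf hg; rewrite /nrm2 -ExZ; last exact: L2_mul.
have h1 := L2_sq hf; have h2 := L2_sq hg; have h3 := L1Z 2 (L2_mul hf hg).
rewrite -ExD// -ExD//; last exact: L1D.
by apply: eq_Ex => w; ring.
Qed.

Lemma nrm2Z c f : L2 f -> nrm2 (fun w => c * f w) = c ^+ 2 * nrm2 f.
Proof.
by move=> hf; rewrite /nrm2 -ExZ; [apply: eq_Ex => w; ring|exact: L2_sq].
Qed.

Lemma nrm2B f g : L2 f -> L2 g ->
  nrm2 (fun w => f w - g w) = nrm2 f - 2 * Ex (fun w => f w * g w) + nrm2 g.
Proof.
move=> hf hg; rewrite (_ : nrm2 _ = nrm2 (fun w => f w + -1 * g w)).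
  rewrite nrm2D//; last exact: L2Z.
  rewrite nrm2Z// (_ : Ex _ = - Ex (fun w => f w * g w)); first by ring.
  rewrite -[RHS]mulN1r -ExZ; last exact: L2_mul.
  by apply: eq_Ex => w; ring.
by apply: eq_Ex => w; rewrite mulN1r.
Qed.

Lemma nrm2_triangle f g : L2 f -> L2 g ->
  nrm2 (fun w => f w + g w) <= 2 * nrm2 f + 2 * nrm2 g.
Proof.
move=> hf hg; have h := nrm2_ge0 (fun w => f w - g w); rewrite nrm2B// in h.
by rewrite nrm2D//; move: h; move: (nrm2 f) (nrm2 g) (Ex _) => p q r h; lra.
Qed.

Lemma Ex_cs f g : L2 f -> L2 g -> Ex (fun w => f w * g w) ^+ 2 <= nrm2 f * nrm2 g.
Proof.
move=> hf hg; set q := Ex _; set p := nrm2 f; set r := nrm2 g.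
apply: discriminant_le => [||t]; [exact: nrm2_ge0|exact: nrm2_ge0|].
have := nrm2_ge0 (fun w => f w + t * g w); rewrite nrm2D//; last exact: L2Z.
rewrite nrm2Z// (_ : Ex _ = t * q); first by congr (0 <= _); rewrite -/p -/r; ring.
by rewrite /q -ExZ; [apply: eq_Ex => w; ring|exact: L2_mul].
Qed.

End SquareIntegrable.

(** * Independence *)

Section Independence.
Context d (T : measurableType d) (R : realType) (P : probability T R).

(** The joint law of [Y] and [D] is the product of their laws, so Fubini's theorem
    factorizes the expectation. *)
Lemma indep_Ex_mul (Y D : T -> R) :
  (forall A B : set R, measurable A -> measurable B ->
     P (Y @^-1` A `&` D @^-1` B) = (P (Y @^-1` A) * P (D @^-1` B))%E) ->
  L1 P Y -> L1 P D ->
  L1 P (fun w => Y w * D w) /\ Ex P (fun w => Y w * D w) = Ex P Y * Ex P D.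
Proof.
move=> ind iY iD; have mY := L1_meas iY; have mD := L1_meas iD.
pose Y' : {mfun T >-> R} := mfun_Sub (mem_set mY).
pose D' : {mfun T >-> R} := mfun_Sub (mem_set mD).
have mYD : measurable_fun setT (fun w => (Y' w, D' w)) by exact: measurable_fun_pair.
pose Z : {mfun T >-> (R * R)%type} := mfun_Sub (mem_set mYD).
pose m1 := distribution P Y'; pose m2 := distribution P D'; pose m := distribution P Z.
have mE X : measurable X -> (m1 \x m2)%E X = m X.
  apply: product_measure_unique => A B mA mB; rewrite /m1 /m2 /m /distribution /pushforward.
  by rewrite -ind//.
pose f : R * R -> \bar R := fun z => (z.1 * z.2)%:E.
have mf : measurable_fun setT f.
  apply/measurable_EFinP; apply: measurable_funM; [exact: measurable_fst|exact: measurable_snd].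
have i1 : m1.-integrable setT (EFin : R -> \bar R).
  by apply: integrable_pushforward => //; exact: iY.
have i2 : m2.-integrable setT (EFin : R -> \bar R).
  by apply: integrable_pushforward => //; exact: iD.
have fin : (m1 \x m2)%E.-integrable setT f.
  apply/integrable12ltyP => //; rewrite /f /=.
  have -> : (\int[m1]_x \int[m2]_y (`|x * y|%:E) =
      \int[m1]_x (`|x%:E| * \int[m2]_y `|y%:E|))%E.
    apply: eq_integral => x _; rewrite -ge0_integralZl//; last by exact: measurableT_comp.
    by apply: eq_integral => y _; rewrite -abseM -EFinM.
  have /integrableP[_ h1] := i1; have /integrableP[_ h2] := i2.
  rewrite ge0_integralZr//; last 2 first.
    - exact: measurableT_comp.
    - exact: integral_ge0.
  by apply: lte_mul_pinfty => //; [exact: integral_ge0|rewrite ge0_fin_numE//; exact: integral_ge0].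
have fin' : m.-integrable setT f.
  apply/integrableP; split => //; have /integrableP[_] := fin.
  by rewrite (eq_measure_integral m)// => A mA _; first [exact: mE|exact/esym/mE].
have iYD : L1 P (fun w => Y w * D w).
  apply: L1_le (fun w => lexx _) _; first exact: measurable_funM.
  have /integrableP[_] := fin'; rewrite ge0_integral_distribution//; last exact: measurableT_comp.
  move=> h; apply: L1_ge0 => //; first by apply: measurableT_comp => //; exact: measurable_funM.
split => //; apply: EFin_inj; rewrite EFinM -!ExE//.
transitivity (\int[m]_z f z)%E.
  by rewrite integral_distribution.
rewrite -(eq_measure_integral m (m1 := (m1 \x m2)%E)); last by move=> A mA _; first [exact: mE|exact/esym/mE].
rewrite -integral12_prod_meas1//; rewrite /f /=.
have e1 : (\int[m1]_x x%:E = \int[P]_w (Y w)%:E)%E by rewrite integral_distribution.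
have e2 : (\int[m2]_x x%:E = \int[P]_w (D w)%:E)%E by rewrite integral_distribution.
rewrite -e1 -e2.
transitivity (\int[m1]_x (x%:E * \int[m2]_y y%:E))%E.
  apply: eq_integral => x _; rewrite -integralZl//.
by rewrite e2 ExE// integralZr.
Qed.

(** Measurability for the sigma-algebra generated by [G], in terms of preimages as
    for adapted processes. *)
Definition gmeas (G : set (set T)) (Y : T -> R) : Prop :=
  forall U : set R, measurable U -> <<s G >> (Y @^-1` U).

Lemma gmeasP G Y : gmeas G Y <-> measurable_fun [set: g_sigma_algebraType G] Y.
Proof.
split => [h _ U mU|h U mU]; first by rewrite setTI; exact: h.
by have := h measurableT U mU; rewrite setTI.
Qed.

Lemma gmeas_cst G c : gmeas G (fun=> c).
Proof. by apply/gmeasP; exact: measurable_cst. Qed.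
Lemma gmeasD G Y Z : gmeas G Y -> gmeas G Z -> gmeas G (fun w => Y w + Z w).
Proof. by move=> /gmeasP hY /gmeasP hZ; apply/gmeasP; exact: measurable_funD. Qed.
Lemma gmeasM G Y Z : gmeas G Y -> gmeas G Z -> gmeas G (fun w => Y w * Z w).
Proof. by move=> /gmeasP hY /gmeasP hZ; apply/gmeasP; exact: measurable_funM. Qed.
Lemma gmeasB G Y Z : gmeas G Y -> gmeas G Z -> gmeas G (fun w => Y w - Z w).
Proof. by move=> /gmeasP hY /gmeasP hZ; apply/gmeasP; exact: measurable_funB. Qed.
Lemma gmeas_sum G (I : Type) (r : seq I) (F : I -> T -> R) :
  (forall i, gmeas G (F i)) -> gmeas G (fun w => \sum_(i <- r) F i w).
Proof.
move=> h; elim: r => [|i r IH].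
  by under eq_fun do rewrite big_nil; exact: gmeas_cst.
by under eq_fun do rewrite big_cons; exact: gmeasD.
Qed.
End Independence.

(** * Limits in mean square *)

Section L2Limits.
Context d (T : measurableType d) (R : realType) (P : probability T R).
Implicit Types (f g h : T -> R).

Lemma cvg0_le_inv (u : nat -> R) (M : R) :
  (forall n, 0 <= u n <= M / n.+1%:R) -> u @ \oo --> 0.
Proof.
move=> h; apply: (@squeeze_cvgr _ _ _ _ (fun=> 0) (fun n => M * harmonic n)).
- by apply: nearW => n; exact: h.
- exact: cvg_cst.
- by rewrite -[X in _ --> X](mulr0 M); apply: cvgMl_tmp; exact: cvg_harmonic.
Qed.

Lemma cvg0_sq (u : nat -> R) : (fun n => u n ^+ 2) @ \oo --> 0 -> u @ \oo --> 0.
Proof.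
move=> h; apply/cvgrPdist_lt => e e0.
have /cvgrPdist_lt /(_ _ (exprn_gt0 2 e0)) [N _ hN] := h; exists N => // n /hN /=.
rewrite !sub0r !normrN normrX ltr_pXn2r ?nnegrE// ltW//.
Qed.

(** The cross term vanishes in the limit by Cauchy-Schwarz. *)
Lemma L2_cvg_nrm2 (f : nat -> T -> R) I : (forall k, L2 P (f k)) -> L2 P I ->
  (fun k => nrm2 P (fun w => f k w - I w)) @ \oo --> 0 ->
  (fun k => nrm2 P (f k)) @ \oo --> nrm2 P I.
Proof.
move=> hf hI h0.
have E k : nrm2 P (f k) = nrm2 P (fun w => f k w - I w) +
    2 * Ex P (fun w => (f k w - I w) * I w) + nrm2 P I.
  rewrite -nrm2D//; last exact: L2B.
  by apply: eq_Ex => w; rewrite subrK.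
have h1 : (fun k => Ex P (fun w => (f k w - I w) * I w)) @ \oo --> 0.
  apply: cvg0_sq; apply: (@squeeze_cvgr _ _ _ _ (fun=> 0)
     (fun k => nrm2 P (fun w => f k w - I w) * nrm2 P I)).
  - by apply: nearW => n; rewrite sqr_ge0 Ex_cs//; exact: L2B.
  - exact: cvg_cst.
  - by rewrite -[X in _ --> X](mul0r (nrm2 P I)); exact: cvgMr_tmp.
have h2 : (fun k => 2 * Ex P (fun w => (f k w - I w) * I w)) @ \oo --> (2 * 0 : R).
  exact: cvgMl_tmp.
rewrite (_ : (fun k => nrm2 P (f k)) = (fun k => nrm2 P (fun w => f k w - I w) +
    2 * Ex P (fun w => (f k w - I w) * I w) + nrm2 P I)); last exact/funext.
have := cvgD (cvgD h0 h2) (cvg_cst (nrm2 P I)).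
by rewrite mulr0 !add0r => h; apply: h.
Qed.

Lemma nrm2_eq0_ae f : L2 P f -> nrm2 P f = 0 -> {ae P, forall w, f w = 0}.
Proof.
move=> hf f0.
have mf : measurable_fun setT (fun w => (f w ^+ 2)%:E).
  by apply/measurable_EFinP; apply: measurable_funX; exact: (L2_meas hf).
have := (ae_eq_integral_abs P measurableT mf).1.
have -> : (\int[P]_w `|(f w ^+ 2)%:E| = 0)%E.
  under eq_integral do rewrite /= ger0_norm ?sqr_ge0//.
  by rewrite (ExE (L2_sq hf)) -[Ex _ _]/(nrm2 P f) f0.
move=> /(_ erefl); apply: filterS => w /(_ I) [] /eqP.
by rewrite sqrf_eq0 => /eqP.
Qed.

Section Complete.
Variables (f : nat -> T -> R) (C : R).
Hypothesis f2 : forall k, L2 P (f k).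
Hypothesis C0 : 0 <= C.
Hypothesis fC : forall k, nrm2 P (fun w => f k.+1 w - f k w) <= C / 4 ^+ k.

Let g k w := `|f k.+1 w - f k w|.

Let g1 k : L1 P (g k).
Proof. by apply: integrable_norm; apply: L2_L1; exact: L2B. Qed.

Let mg k : measurable_fun setT (g k). Proof. exact: L1_meas. Qed.

Let Eg k : Ex P (g k) <= (C + 1) / 2 ^+ k.
Proof.
have h2 := L2B (f2 k.+1) (f2 k); have p2 : (0 : R) < 2 ^+ k by rewrite exprn_gt0.
(* The weight [2^k] balances the bound [C / 4^k] on the squares. *)
apply: (@le_trans _ _ (Ex P (fun w => 2 ^+ k * (f k.+1 w - f k w) ^+ 2 + (2 ^+ k)^-1))).
  apply: Ex_le => //.
    by apply: L1D; [apply: L1Z; exact: L2_sq|exact: L1_cst].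
  move=> w; rewrite /g; set D := f k.+1 w - f k w.
  rewrite -(real_normK (num_real D)) -subr_ge0.
  have -> : 2 ^+ k * `|D| ^+ 2 + (2 ^+ k)^-1 - `|D| =
      (2 ^+ k)^-1 * ((2 ^+ k * `|D| - 1 / 2) ^+ 2 + 3 / 4).
    by field; rewrite gt_eqF.
  by rewrite mulr_ge0 ?invr_ge0 ?(ltW p2)// addr_ge0 ?sqr_ge0.
rewrite ExD ?ExZ ?Ex_cst; [|exact: L2_sq|by apply: L1Z; exact: L2_sq|exact: L1_cst].
have := fC k; rewrite /nrm2 => h.
rewrite mulrDl mul1r lerD2r; apply: le_trans (ler_wpM2l (ltW p2) h) _.
have -> : (4 : R) ^+ k = 2 ^+ k * 2 ^+ k by rewrite -exprMn -natrM.
by rewrite mulrCA invfM mulVKf ?gt_eqF// mulrC.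
Qed.

Let sum_half n : \sum_(0 <= k < n) (2 ^+ k)^-1 <= 2 :> R.
Proof.
suff -> : \sum_(0 <= k < n) (2 ^+ k)^-1 = 2 - 2 * (2 ^+ n)^-1 :> R.
  by rewrite gerBl mulr_ge0// invr_ge0 exprn_ge0.
elim: n => [|n IH]; first by rewrite big_nil expr0 invr1 mulr1 subrr.
rewrite big_nat_recr//= IH exprS invfM; move: (2 ^+ n)^-1 => p; lra.
Qed.

Let S w := (\sum_(0 <= k <oo) (g k w)%:E)%E.

Let intS : P.-integrable setT S.
Proof.
have mS : measurable_fun setT S.
  apply: ge0_emeasurable_sum => [k w _ _|k _]; first by rewrite lee_fin /g normr_ge0.
  exact/measurable_EFinP.
apply/integrableP; split => //.
have S0 w : (0 <= S w)%E by apply: nneseries_ge0 => k _ _; rewrite lee_fin /g normr_ge0.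
under eq_integral do rewrite gee0_abs//.
rewrite /S integral_nneseries//; last 2 first.
  - by move=> k; exact/measurable_EFinP.
  - by move=> k w _; rewrite lee_fin /g normr_ge0.
apply: (@le_lt_trans _ _ ((C + 1) * 2)%:E); last exact: ltry.
apply: lime_le.
  by apply: is_cvg_nneseries => k _ _; apply: integral_ge0 => w _; rewrite lee_fin /g normr_ge0.
apply: nearW => n; under eq_bigr do rewrite ExE//.
rewrite sumEFin lee_fin.
apply: (@le_trans _ _ (\sum_(0 <= k < n) (C + 1) * (2 ^+ k)^-1)).
  by apply: ler_sum => k _; exact: Eg.
by rewrite -mulr_sumr ler_wpM2l ?sum_half// addr_ge0.
Qed.

Let lim_f w := fine (limn_esup (fun k => (f k w)%:E)).

Let mlim : measurable_fun setT lim_f.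
Proof.
apply: measurableT_comp; first exact: fine_measurable.
by apply: measurable_fun_limn_esup => k; apply/measurable_EFinP; exact: (L2_meas (f2 k)).
Qed.

Let ae_cvg : {ae P, forall w, (fun k => f k w) @ \oo --> lim_f w}.
Proof.
have := integrable_ae measurableT intS; apply: filterS => w /(_ I) hS.
suff [l hl] : exists l : R, (fun k => f k w) @ \oo --> l.
  have hE : (fun k => (f k w)%:E) @ \oo --> l%:E by apply: cvg_EFin => //; exact: nearW.
  by have [_ e] := cvg_limn_einf_sup hE; rewrite /lim_f e.
pose u k := f k.+1 w - f k w.
have cn : cvgn (fun n => \sum_(0 <= k < n) g k w).
  apply: nondecreasing_is_cvgn.
    by apply/nondecreasing_seqP => n; rewrite big_nat_recr//= lerDl /g.
  exists (fine (S w)) => _ [n _ <-] /=; rewrite -lee_fin fineK// -sumEFin.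
  by apply: (nneseries_lim_ge (u_ := fun k => (g k w)%:E)) => k _ _; rewrite lee_fin /g normr_ge0.
have /cvg_ex[l hl] := @normed_cvg _ _ u cn.
exists (l + f 0%N w).
have -> : (fun k => f k w) = (fun k => series u k + f 0%N w).
  by apply/funext => k; rewrite /series /= telescope_sumr// subrK.
by apply: cvgD => //; exact: cvg_cst.
Qed.

Let dist m k : (k <= m)%N -> nrm2 P (fun w => f k w - f m w) <= 4 * C / 4 ^+ k.
Proof.
move=> /subnK <-; move: (m - k)%N => j {m}.
elim: j k => [|j IH] k.
  rewrite add0n (_ : nrm2 P _ = 0) ?divr_ge0 ?mulr_ge0 ?exprn_ge0//.
  rewrite /nrm2 -[RHS](Ex_cst P 0); apply: eq_Ex => w; by rewrite subrr expr0n.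
have -> : nrm2 P (fun w => f k w - f (j.+1 + k)%N w) =
    nrm2 P (fun w => -1 * (f k.+1 w - f k w) + (f k.+1 w - f (j + k.+1)%N w)).
  by apply: eq_Ex => w; rewrite addSnnS; congr (_ ^+ 2); ring.
apply: le_trans (nrm2_triangle _ _) _; [by apply: L2Z; exact: L2B|exact: L2B|].
rewrite nrm2Z; last exact: L2B.
have := IH k.+1; have := fC k; rewrite exprS invfM.
have p4 : (0 : R) < 4 ^+ k by rewrite exprn_gt0.
rewrite -[(-1) ^+ 2]/(-1 * -1); move: (nrm2 _ _) (nrm2 _ _) (4 ^+ k)^-1 => p q r h1 h2.
have h3 : 4 * C * (4^-1 * r) = C * r by field.
by rewrite h3 in h2; lra.
Qed.

(** Since [\sum |f (k+1) - f k|] is integrable, the sequence converges almost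
    surely; Fatou's lemma makes the limit one in L^2. *)
Lemma L2_complete : exists I, L2 P I /\
  (fun k => nrm2 P (fun w => f k w - I w)) @ \oo --> 0.
Proof.
exists lim_f.
have fatouk k : (\int[P]_w ((f k w - lim_f w) ^+ 2)%:E <= (4 * C / 4 ^+ k)%:E)%E.
  pose h m w := ((f k w - f m w) ^+ 2)%:E.
  have mh m : measurable_fun setT (h m).
    by apply/measurable_EFinP; apply: measurable_funX; exact: (L2_meas (L2B (f2 k) (f2 m))).
  have h0 m w : setT w -> (0 <= h m w)%E by move=> _; rewrite lee_fin sqr_ge0.
  have mlimh : measurable_fun setT (fun w => limn_einf (h ^~ w)).
    rewrite /limn_einf; apply: measurableT_comp => //.
    by apply: measurable_fun_limn_esup => m; apply: measurableT_comp.
  rewrite (_ : (\int[P]_w _)%E = (\int[P]_w limn_einf (h ^~ w))%E).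
    apply: le_trans (fatou P measurableT mh h0) _.
    rewrite limn_einf_lim; apply: lime_le; first exact: is_cvg_einfs.
    apply: nearW => n; apply: (@le_trans _ _ (\int[P]_w h (maxn n k) w)%E).
      by apply: ereal_inf_lbound; exists (maxn n k) => //=; exact: leq_maxl.
    rewrite /h ExE; first by rewrite lee_fin; apply: dist; exact: leq_maxr.
    by apply: L2_sq; exact: L2B.
  apply: ae_eq_integral => //.
    by apply/measurable_EFinP; apply: measurable_funX; apply: measurable_funB => //; exact: (L2_meas (f2 k)).
  apply: filterS ae_cvg => w hw _; apply/esym.
  suff hE : (h ^~ w) @ \oo --> ((f k w - lim_f w) ^+ 2)%:E.
    by have [e _] := cvg_limn_einf_sup hE.
  apply: cvg_EFin; first exact: nearW.
  have c1 : (fun m => f k w - f m w) @ \oo --> f k w - lim_f w.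
    by apply: cvgB => //; exact: cvg_cst.
  exact: (cvg_comp _ _ c1 (@exprn_continuous R 2%N _)).
have L2k k : L2 P (fun w => f k w - lim_f w).
  have mk : measurable_fun setT (fun w => f k w - lim_f w).
    by apply: measurable_funB => //; exact: (L2_meas (f2 k)).
  split => //; apply: L1_ge0; first exact: measurable_funX.
    by move=> w; exact: sqr_ge0.
  by apply: le_lt_trans (fatouk k) _; exact: ltry.
split.
  apply: (eq_L2 (f := fun w => f 0%N w - (f 0%N w - lim_f w))).
    by move=> w; rewrite subKr.
  exact: L2B.
apply: (@cvg0_le_inv _ (4 * C)) => k; rewrite nrm2_ge0/=.
have := fatouk k; rewrite (ExE (L2_sq (L2k k))) lee_fin => h; apply: le_trans h _.
rewrite ler_wpM2l ?mulr_ge0// lef_pV2 ?posrE ?exprn_gt0//.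
by rewrite -natrX ler_nat; exact: ltn_expl.
Qed.
End Complete.
End L2Limits.

(** * Discrete stochastic integrals *)

Section Coordinates.
Variables (R : realType) (E : innerProductType R).
Context d (Omega : measurableType d) (P : probability Omega R).
Variable X : R -> Omega -> E.

(** The generators of [past X t]. *)
Definition pgen (t : R) : set (set Omega) :=
  [set A | exists s U, [/\ 0 <= s <= t, @borel R E U & A = X s @^-1` U]].

(** What stochastic integration uses of Brownian motion, in coordinates:
    conditionally on the past of [X], the increments of the [W j] are centred
    with covariance [(i == j) (t - s)].  This covers a Brownian motion in an
    orthonormal basis, as well as a real Brownian motion carried by a line,
    with one coordinate. *)
Record coord_process (m : nat) (W : 'I_m -> R -> Omega -> R) (v : 'I_m -> E) : Prop := {
  cp_decomp : forall t w, X t w = \sum_(j < m) W j t w *: v j ;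
  cp_past : forall s t j, 0 <= s <= t -> gmeas (pgen t) (W j s) ;
  cp_meas : forall t A, 0 <= t <= 1 -> past X t A -> measurable A ;
  cp_L2 : forall s t j, 0 <= s -> s < t -> t <= 1 -> L2 P (fun w => W j t w - W j s w) ;
  cp_mart : forall s t j Y, 0 <= s -> s < t -> t <= 1 -> gmeas (pgen s) Y -> L1 P Y ->
    L1 P (fun w => Y w * (W j t w - W j s w)) /\
    Ex P (fun w => Y w * (W j t w - W j s w)) = 0 ;
  cp_bracket : forall s t i j Y, 0 <= s -> s < t -> t <= 1 -> gmeas (pgen s) Y -> L1 P Y ->
    L1 P (fun w => Y w * ((W i t w - W i s w) * (W j t w - W j s w))) /\
    Ex P (fun w => Y w * ((W i t w - W i s w) * (W j t w - W j s w))) =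
      (i == j)%:R * (t - s) * Ex P Y ;
  cp_start : forall j, {ae P, forall w, W j 0 w = 0}
}.

Section Transform.
Variables (m : nat) (W : 'I_m -> R -> Omega -> R) (v : 'I_m -> E).
Hypothesis cp : coord_process W v.

Lemma gmeas_measurable t (Y : Omega -> R) : 0 <= t <= 1 -> gmeas (pgen t) Y -> measurable_fun setT Y.
Proof. by move=> t01 hY _ U mU; rewrite setTI; apply: (cp_meas cp t01); exact: hY. Qed.

Lemma gmeas_mono s t (Y : Omega -> R) : s <= t -> gmeas (pgen s) Y -> gmeas (pgen t) Y.
Proof.
move=> st hY U mU; have := hY U mU; apply: sub_sigma_algebra2.
by move=> A [r [V [/andP[r0 rs] bV ->]]]; exists r, V; split => //; rewrite r0 (le_trans rs).
Qed.

Lemma coord_meas j t : 0 <= t <= 1 -> measurable_fun setT (W j t).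
Proof.
move=> t01; apply: (gmeas_measurable t01); apply: (cp_past cp).
by case/andP: t01 => -> _ /=.
Qed.

Lemma coord0_L2 j : L2 P (W j 0).
Proof.
have m0 : measurable_fun setT (W j 0) by apply: coord_meas; rewrite lexx ler01.
split => //; apply: (@ae_eq_L1 _ _ _ _ (fun=> 0)).
- exact: measurable_funX.
- by have := cp_start cp j; apply: filterS => w ->; rewrite expr0n.
- exact: L1_cst.
Qed.

Lemma coord_L2 j t : 0 <= t <= 1 -> L2 P (W j t).
Proof.
move=> /andP[t0 t1]; have [->|tn] := eqVneq t 0; first exact: coord0_L2.
apply: (eq_L2 (f := fun w => (W j t w - W j 0 w) + W j 0 w)).
  by move=> w; rewrite subrK.
apply: L2D; last exact: coord0_L2.
by apply: (cp_L2 cp) => //; rewrite lt_neqAle eq_sym tn.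
Qed.

Lemma coord_cov i j t : 0 <= t <= 1 -> Ex P (fun w => W i t w * W j t w) = (i == j)%:R * t.
Proof.
move=> /andP[t0 t1]; have t01 : 0 <= t <= 1 by rewrite t0.
have mm := measurable_funM (coord_meas i t01) (coord_meas j t01).
have [tz|tn] := eqVneq t 0.
  rewrite tz mulr0 -[RHS](Ex_cst P 0); apply: ae_eq_Ex => //; first by rewrite -tz.
  by have := cp_start cp i; apply: filterS => w ->; rewrite mul0r.
have tp : 0 < t by rewrite lt_neqAle eq_sym tn.
have [h1 h2] := cp_bracket cp i j (lexx 0) tp t1 (@gmeas_cst _ Omega R _ 1) (L1_cst P 1).
rewrite Ex_cst mulr1 subr0 in h2; rewrite -h2; apply: ae_eq_Ex => //; first exact: L1_meas h1.
have hi := cp_start cp i; have hj := cp_start cp j.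
by apply: filterS2 hi hj => w -> ->; rewrite !subr0 mul1r.
Qed.

(** The conditional covariances remove the cross terms, and make the increment
    orthogonal to all that is measurable before it. *)
Lemma transform_step s u (eta : 'I_m -> Omega -> R) : 0 <= s -> s < u -> u <= 1 ->
  (forall j, gmeas (pgen s) (eta j)) -> (forall j, L2 P (eta j)) ->
  let dd w := \sum_(j < m) eta j w * (W j u w - W j s w) in
  [/\ L2 P dd, forall Z, gmeas (pgen s) Z -> L2 P Z -> Ex P (fun w => Z w * dd w) = 0,
      nrm2 P dd = (u - s) * \sum_(j < m) nrm2 P (eta j) & gmeas (pgen u) dd].
Proof.
move=> s0 su u1 ge le dd.
have s01 : 0 <= s <= 1 by rewrite s0 (le_trans (ltW su)).
have u01 : 0 <= u <= 1 by rewrite u1 (le_trans s0 (ltW su)).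
have mW j : measurable_fun setT (fun w => W j u w - W j s w).
  by apply: measurable_funB; exact: coord_meas.
have l2 j : L2 P (fun w => eta j w * (W j u w - W j s w)).
  split; first by apply: measurable_funM => //; exact: (L2_meas (le j)).
  have [h _] := cp_bracket cp j j s0 su u1 (gmeasM (ge j) (ge j)) (L2_mul (le j) (le j)).
  by apply: eq_L1 h => w; ring.
have cr i j : L1 P (fun w => (eta i w * eta j w) * ((W i u w - W i s w) * (W j u w - W j s w))) /\
   Ex P (fun w => (eta i w * eta j w) * ((W i u w - W i s w) * (W j u w - W j s w))) =
     (i == j)%:R * (u - s) * Ex P (fun w => eta i w * eta j w).
  exact: (cp_bracket cp i j s0 su u1 (gmeasM (ge i) (ge j)) (L2_mul (le i) (le j))).
split.
- exact: L2_sum.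
- move=> Z gZ lZ.
  have mj j := cp_mart cp j s0 su u1 (gmeasM gZ (ge j)) (L2_mul lZ (le j)).
  transitivity (Ex P (fun w => \sum_(j < m) Z w * eta j w * (W j u w - W j s w))).
    by apply: eq_Ex => w; rewrite /dd mulr_sumr; apply: eq_bigr => j _; rewrite mulrA.
  rewrite Ex_sum; last by move=> j; case: (mj j).
  by apply: big1 => j _; case: (mj j).
- transitivity (Ex P (fun w => \sum_(i < m) \sum_(j < m)
    (eta i w * eta j w) * ((W i u w - W i s w) * (W j u w - W j s w)))).
    apply: eq_Ex => w; rewrite expr2 /dd mulr_suml; apply: eq_bigr => i _.
    by rewrite mulr_sumr; apply: eq_bigr => j _; ring.
  rewrite Ex_sum; last by move=> i; apply: L1_sum => j; case: (cr i j).
  rewrite mulr_sumr; apply: eq_bigr => i _.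
  rewrite Ex_sum; last by move=> j; case: (cr i j).
  rewrite (bigD1 i)//= big1 ?addr0; last first.
    by move=> j ji; have [_ ->] := cr i j; rewrite eq_sym (negPf ji) !mul0r.
  have [_ ->] := cr i i; rewrite eqxx mul1r; congr (_ * _).
- apply: gmeas_sum => j; apply: gmeasM; first exact: gmeas_mono (ltW su) _.
  apply: gmeasB; apply: (cp_past cp); first by rewrite lexx andbT; case/andP: u01.
  by rewrite s0 ltW.
Qed.

(** Pythagoras for steps orthogonal to the sum of the preceding ones. *)
Lemma orth_sum n (dd : nat -> Omega -> R) :
  (forall i, (i < n)%N -> L2 P (dd i)) ->
  (forall i, (i < n)%N -> Ex P (fun w => (\sum_(k < i) dd k w) * dd i w) = 0) ->
  L2 P (fun w => \sum_(i < n) dd i w) /\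
  nrm2 P (fun w => \sum_(i < n) dd i w) = \sum_(i < n) nrm2 P (dd i).
Proof.
elim: n => [|n IH] hL hO.
  rewrite big_ord0; split.
    by apply: (eq_L2 (f := fun=> 0)); [move=> w; rewrite big_ord0|exact: L2_cst].
  rewrite -[RHS](Ex_cst P 0); apply: eq_Ex => w; by rewrite big_ord0 expr0n.
have [||L2n nn] := IH; [by move=> i ni; apply: hL; exact: ltnW|by move=> i ni; apply: hO; exact: ltnW|].
have e : (fun w => \sum_(i < n.+1) dd i w) =1 (fun w => \sum_(i < n) dd i w + dd n w).
  by move=> w; rewrite big_ord_recr.
have ln := hL n (ltnSn n).
split; first by apply: (eq_L2 (fsym e)); exact: L2D.
rewrite (_ : nrm2 P _ = nrm2 P (fun w => \sum_(i < n) dd i w + dd n w)); last first.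
  by apply: eq_Ex => w; rewrite e.
by rewrite nrm2D// hO// mulr0 addr0 nn big_ord_recr.
Qed.

Definition partition01 (n : nat) (t : nat -> R) : Prop :=
  [/\ t 0%N = 0, t n = 1 & forall i, (i < n)%N -> t i < t i.+1].

Section Partition.
Variables (n : nat) (t : nat -> R).
Hypothesis pt : partition01 n t.

Lemma part_le i j : (i <= j)%N -> (j <= n)%N -> t i <= t j.
Proof.
case: pt => _ _ h; elim: j => [|j IH]; first by rewrite leqn0 => /eqP ->.
rewrite leq_eqVlt => /predU1P[->//|ij] jn.
by apply: le_trans (ltW (h _ jn)); apply: IH => //; exact: ltnW.
Qed.
Lemma part_ge0 i : (i <= n)%N -> 0 <= t i.
Proof. by case: (pt) => <- _ _; exact: part_le. Qed.
Lemma part_le1 i : (i <= n)%N -> t i <= 1.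
Proof. by case: (pt) => _ <- _ h; exact: part_le. Qed.
Lemma part_in01 i : (i <= n)%N -> 0 <= t i <= 1.
Proof. by move=> h; rewrite part_ge0// part_le1. Qed.
Lemma part_lt i : (i < n)%N -> t i < t i.+1.
Proof. by case: pt => _ _; apply. Qed.

Lemma part_pick r : 0 < r -> r <= 1 -> exists2 i : 'I_n, t i < r <= t i.+1 &
  forall k : 'I_n, k != i -> ~~ (t k < r <= t k.+1).
Proof.
move=> r0 r1.
have [i in1 hi] : exists2 i, (i < n)%N & t i < r <= t i.+1.
  have : exists k, (k <= n)%N && (r <= t k).
    by exists n; rewrite leqnn; case: pt => _ -> _.
  move=> ek; case: (ex_minnP ek) => -[|k] /andP[kn rk] mk.
    by move: rk; case: pt => -> _ _; rewrite leNgt r0.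
  exists k => //; rewrite rk andbT ltNge; apply/negP => h.
  by have := mk k; rewrite h ltnW// ltnn => /(_ isT).
exists (Ordinal in1) => //= k ki; apply/negP => /andP[k1 k2]; case/andP: hi => i1 i2.
have [ik|ki'] := ltnP k i.
  have := part_le ik (ltnW in1); rewrite leNgt => /negP; apply; exact: lt_le_trans i1 k2.
have {}ki' : (i < k)%N by rewrite ltn_neqAle ki' andbT; apply: contra ki => /eqP e; apply/eqP/val_inj.
have := part_le ki' (ltnW (ltn_ord k)); rewrite leNgt => /negP; apply; exact: lt_le_trans k1 i2.
Qed.

(** Telescoping of the squares of the [t i]. *)
Lemma part_sum_left : \sum_(i < n) (t i.+1 - t i) * t i =
  (1 - \sum_(i < n) (t i.+1 - t i) ^+ 2) / 2.
Proof.
have : \sum_(i < n) (t i.+1 ^+ 2 - t i ^+ 2) = 1.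
  rewrite -(big_mkord xpredT (fun i => t i.+1 ^+ 2 - t i ^+ 2)) telescope_sumr//.
  by case: pt => -> -> _; rewrite expr1n expr0n subr0.
move=> h; rewrite -[X in (X - _) / 2]h -sumrB mulr_suml; apply: eq_bigr => i _.
by field.
Qed.

(** Discrete stochastic integral: [eta i j] multiplies the [i]-th increment of [W
    j]. *)
Definition transform (eta : nat -> 'I_m -> Omega -> R) (k : nat) (w : Omega) : R :=
  \sum_(i < k) \sum_(j < m) eta i j w * (W j (t i.+1) w - W j (t i) w).

(** The steps are orthogonal by [transform_step]: this is the Ito isometry for
    discrete integrals. *)
Lemma transform_isometry eta :
  (forall i j, (i < n)%N -> gmeas (pgen (t i)) (eta i j)) ->
  (forall i j, (i < n)%N -> L2 P (eta i j)) ->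
  L2 P (transform eta n) /\
  nrm2 P (transform eta n) = \sum_(i < n) (t i.+1 - t i) * \sum_(j < m) nrm2 P (eta i j).
Proof.
move=> ge le.
have step i (ni : (i < n)%N) := @transform_step (t i) (t i.+1) (eta i)
  (part_ge0 (ltnW ni)) (part_lt ni) (part_le1 ni) (fun j => ge i j ni) (fun j => le i j ni).
pose dd (i : nat) w := \sum_(j < m) eta i j w * (W j (t i.+1) w - W j (t i) w).
have gs k : (k <= n)%N -> gmeas (pgen (t k)) (fun w => \sum_(i < k) dd i w).
  elim: k => [|k IH] kn.
    under eq_fun do rewrite big_ord0; exact: gmeas_cst.
  under eq_fun do rewrite big_ord_recr /=.
  apply: gmeasD; first exact: (gmeas_mono (ltW (part_lt kn)) (IH (ltnW kn))).
  by have [_ _ _] := step k kn.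
have ls k : (k <= n)%N -> L2 P (fun w => \sum_(i < k) dd i w).
  elim: k => [|k IH] kn.
    by apply: (eq_L2 (f := fun=> 0)); [move=> w; rewrite big_ord0|exact: L2_cst].
  apply: (eq_L2 (f := fun w => \sum_(i < k) dd i w + dd k w)).
    by move=> w; rewrite big_ord_recr.
  by apply: L2D; [exact/IH/ltnW|have [] := step k kn].
have [|i ni|hL hN] := @orth_sum n dd.
- by move=> i ni; have [] := step i ni.
- have [_ h _ _] := step i ni; exact: h _ (gs _ (ltnW ni)) (ls _ (ltnW ni)).
- split => //; rewrite [LHS]hN; apply: eq_bigr => i _.
  by have [_ _ -> _] := step i (ltn_ord i).
Qed.
End Partition.
End Transform.
End Coordinates.

(** * Ito integrals of linear integrands *)

Section StepFunctions.
Variable R : realType.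
Notation mu := (@lebesgue_measure R).

Definition stepf (n : nat) (u v k : nat -> R) (r : R) : R :=
  \sum_(i < n) \1_(`]u i, v i]) r * k i.

Lemma stepf_meas n u v k : measurable_fun [set: measurableTypeR R] (stepf n u v k).
Proof.
by apply: measurable_sum => i; apply: measurable_funM => //; exact: measurable_indic.
Qed.

Let indic_itv_meas (a b : R) : measurable_fun [set: measurableTypeR R] (\1_(`]a, b]) : R -> R).
Proof. exact: measurable_indic. Qed.

Lemma integral_stepf n (u v k : nat -> R) :
  (forall i, (i < n)%N -> [/\ 0 <= u i, u i <= v i, v i <= 1 & 0 <= k i]) ->
  (\int[mu]_(r in `[0%R, 1%R]) (stepf n u v k r)%:E = (\sum_(i < n) k i * (v i - u i))%:E)%E.
Proof.
move=> h; under eq_integral do rewrite /stepf -sumEFin.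
have mI (i : 'I_n) : measurable_fun (`[0%R, 1%R] : set (measurableTypeR R))
    (fun r : measurableTypeR R => (\1_(`]u i, v i]) r * k i)%:E).
  apply/measurable_EFinP; apply: measurable_funM; last exact: measurable_cst.
  by apply: measurable_funTS; exact: indic_itv_meas.
rewrite ge0_integral_sum//; last first.
  by move=> i r _; rewrite lee_fin mulr_ge0//; case: (h i).
rewrite -sumEFin; apply: eq_bigr => i _; have [u0 uv v1 k0] := h i (ltn_ord i).
under eq_integral do rewrite mulrC EFinM.
have mi : measurable_fun (`[0%R, 1%R] : set (measurableTypeR R))
    (fun r : measurableTypeR R => (\1_(`]u i, v i]) r : R)%:E).
  by apply/measurable_EFinP; apply: measurable_funTS; exact: indic_itv_meas.
rewrite ge0_integralZl_EFin//; try exact: mi; try by move=> r _; rewrite lee_fin.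
rewrite integral_indic// setIidl; last first.
  move=> r /=; rewrite !in_itv/= => /andP[ur rv].
  by rewrite (ltW (le_lt_trans u0 ur)) (le_trans rv v1).
rewrite /= lebesgue_measure_itv/= lte_fin; case: ltP => [_|vu]; first by rewrite -EFinB.
have -> : v i = u i by apply/eqP; rewrite eq_le vu.
by rewrite subrr mule0 mulr0.
Qed.

Lemma indic_itvE (a b r : R) : \1_(`]a, b]) r = (a < r <= b)%R%:R :> R.
Proof. by rewrite indicE mem_setE in_itv. Qed.
End StepFunctions.

Lemma cvg0_le_ereal (R : realType) (u : nat -> R) (e : nat -> \bar R) :
  (forall k, 0 <= u k) -> (forall k, ((u k)%:E <= e k)%E) -> e @ \oo --> 0%E -> u @ \oo --> (0 : R).
Proof.
move=> u0 ue h; apply: (@fine_cvg _ _ _ _ (fun k => (u k)%:E)).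
apply: (squeeze_cvge (f := fun=> 0%E) (h := e)) => //; last exact: cvg_cst.
by apply: nearW => k; rewrite ue lee_fin u0.
Qed.

Section Ito.
Variables (R : realType) (E : innerProductType R).
Context d (Omega : measurableType d) (P : probability Omega R).
Variable X : R -> Omega -> E.
Variables (m : nat) (W : 'I_m -> R -> Omega -> R) (v : 'I_m -> E).
Hypothesis cp : coord_process P X W v.
Notation mu := (@lebesgue_measure R).
Variable c : 'I_m -> E -> R.

(** The functional-valued integrands that are linear in the coordinates of the
    process; both integrands of the calibration are of this kind. *)
Definition lin_integrand (t : R) (w : Omega) (y : E) : R := \sum_(l < m) W l t w * c l y.
Notation Phi := lin_integrand.
(** Growth rate of the variance of the integrand evaluated at [y]. *)
Definition coef2 (y : E) : R := \sum_(l < m) c l y ^+ 2.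
(** The same rate, summed over the directions of the noise. *)
Definition coefC : R := \sum_(j < m) coef2 (v j).

Lemma coef2_ge0 y : 0 <= coef2 y.
Proof. by apply: sumr_ge0 => l _; exact: sqr_ge0. Qed.
Lemma coefC_ge0 : 0 <= coefC.
Proof. by apply: sumr_ge0 => l _; exact: coef2_ge0. Qed.

Lemma Phi_L2 t y : 0 <= t <= 1 -> L2 P (fun w => Phi t w y).
Proof.
move=> t01; apply: L2_sum => l; apply: (eq_L2 (f := fun w => c l y * W l t w)).
  by move=> w; rewrite mulrC.
by apply: L2Z; exact: (coord_L2 cp).
Qed.

Lemma Phi_gmeas s t y : 0 <= s <= t -> gmeas (pgen X t) (fun w => Phi s w y).
Proof.
move=> st; apply: gmeas_sum => l; apply: gmeasM; first exact: (cp_past cp).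
exact: gmeas_cst.
Qed.

Lemma Phi_nrm2 t y : 0 <= t <= 1 -> nrm2 P (fun w => Phi t w y) = t * coef2 y.
Proof.
move=> t01.
have lij i j : L1 P (fun w => c i y * c j y * (W i t w * W j t w)).
  by apply: L1Z; apply: L2_mul; exact: (coord_L2 cp).
transitivity (Ex P (fun w => \sum_(i < m) \sum_(j < m) c i y * c j y * (W i t w * W j t w))).
  apply: eq_Ex => w; rewrite expr2 mulr_suml; apply: eq_bigr => i _.
  by rewrite mulr_sumr; apply: eq_bigr => j _; ring.
rewrite Ex_sum; last by move=> i; apply: L1_sum.
rewrite mulr_sumr; apply: eq_bigr => i _; rewrite Ex_sum//.
rewrite (bigD1 i)//= big1 ?addr0; last first.
  move=> j ji; rewrite ExZ; last by apply: L2_mul; exact: (coord_L2 cp).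
  by rewrite (coord_cov cp)// eq_sym (negPf ji) mul0r mulr0.
rewrite ExZ; last by apply: L2_mul; exact: (coord_L2 cp).
by rewrite (coord_cov cp)// eqxx mul1r -expr2 mulrC.
Qed.

(** From [s] to [t] the integrand changes by an increment orthogonal to the past
    of [s]. *)
Lemma nrm2_sub_Phi s t (Y : Omega -> R) y : 0 <= s -> s <= t -> t <= 1 ->
  gmeas (pgen X s) Y -> L2 P Y ->
  nrm2 P (fun w => Y w - Phi t w y) = nrm2 P (fun w => Y w - Phi s w y) + (t - s) * coef2 y.
Proof.
move=> s0; rewrite le_eqVlt => /predU1P[<- _ _ _|st t1 gY lY].
  by rewrite subrr mul0r addr0.
have s01 : 0 <= s <= 1 by rewrite s0 (le_trans (ltW st)).
have [lD oD nD _] := transform_step cp s0 st t1 (eta := fun j _ => c j y)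
  (fun j => @gmeas_cst _ Omega R _ _) (fun j => L2_cst P _).
have lZ : L2 P (fun w => Y w - Phi s w y) by apply: L2B => //; exact: Phi_L2.
have gZ : gmeas (pgen X s) (fun w => Y w - Phi s w y).
  by apply: gmeasB => //; apply: Phi_gmeas; rewrite s0 lexx.
transitivity (nrm2 P (fun w => (Y w - Phi s w y) -
    \sum_(j < m) c j y * (W j t w - W j s w))).
  apply: eq_Ex => w; congr (_ ^+ 2); rewrite -addrA -opprD; congr (_ - _).
  rewrite -big_split; apply: eq_bigr => j _ /=; ring.
rewrite nrm2B// oD// mulr0 subr0 nD; congr (_ + _ * _).
by apply: eq_bigr => j _; exact: Ex_cst.
Qed.

Lemma scalar_sum (f : E -> R) (a : 'I_m -> R) (u : 'I_m -> E) : scalar f ->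
  f (\sum_(j < m) a j *: u j) = \sum_(j < m) a j * f (u j).
Proof.
move=> lf; have f0 : f 0 = 0.
  have := lf 0 0 0; rewrite scaler0 addr0 mul0r add0r => _.
  by have := lf 1 0 0; rewrite scaler0 addr0 mul1r => /eqP; rewrite -subr_eq0 opprD addNKr oppr_eq0 => /eqP.
elim/big_rec2: _ => // j x y _ <-; exact: lf.
Qed.

Section Adapted.
Variable s : simple_process E Omega.
Hypothesis As : simple_adapted P X s.

Lemma adapted_partition : partition01 (sp_n s) (sp_t s).
Proof. by case: As. Qed.
Let pt := adapted_partition.

Lemma adapted_gmeas i y : (i < sp_n s)%N -> gmeas (pgen X (sp_t s i)) (fun w => sp_xi s i w y).
Proof. by move=> ni U mU; case: As => _ _ _ _ /(_ i y ni)[h _]; exact: h. Qed.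

Lemma adapted_L2 i y : (i < sp_n s)%N -> L2 P (fun w => sp_xi s i w y).
Proof.
move=> ni; apply: L2_expect; last by case: As => _ _ _ _ /(_ i y ni)[].
exact: (gmeas_measurable cp (part_in01 pt (ltnW ni)) (adapted_gmeas y ni)).
Qed.

Lemma simple_integral_transform :
  simple_integral X s =1 transform W (sp_t s) (fun i j w => sp_xi s i w (v j)) (sp_n s).
Proof.
move=> w; apply: eq_bigr => i _.
have -> : X (sp_t s i.+1) w - X (sp_t s i) w =
    \sum_(j < m) (W j (sp_t s i.+1) w - W j (sp_t s i) w) *: v j.
  by rewrite !(cp_decomp cp) -sumrB; apply: eq_bigr => j _; rewrite scalerBl.
rewrite scalar_sum; first by apply: eq_bigr => j _; rewrite mulrC.
by case: As => _ _ _ h _; exact: h.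
Qed.

(** Coefficients of the left-point sum along the partition of [s]. *)
Definition left_eta (i : nat) (j : 'I_m) (w : Omega) := Phi (sp_t s i) w (v j).

Definition coef_err (i : nat) (y : E) : R :=
  nrm2 P (fun w => sp_xi s i w y - Phi (sp_t s i) w y).

(** Mean square error of the simple process at time [r].  The term in [r - sp_t s
    i] is the price of being constant on an interval, which no choice of
    adapted values can reduce. *)
Definition err_fun (y : E) (r : R) : R :=
  \sum_(i < sp_n s) \1_(`]sp_t s i, sp_t s i.+1]) r * (coef_err i y + coef2 y * (r - sp_t s i)).

Lemma err_fun_meas y : measurable_fun [set: measurableTypeR R] (err_fun y).
Proof.
apply: measurable_sum => i; apply: measurable_funM; first exact: measurable_indic.
apply: measurable_funD => //; apply: measurable_funM => //.
exact: measurable_funB.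
Qed.

Lemma err_funE y r : 0 <= r <= 1 ->
  ('E_P[fun w => ((simple_val s r w y - Phi r w y) ^+ 2)%R] = (err_fun y r)%:E)%E.
Proof.
move=> /andP[r0 r1]; have r01 : 0 <= r <= 1 by rewrite r0.
have [rz|rn] := eqVneq r 0.
  have z (i : 'I_(sp_n s)) : \1_(`]sp_t s i, sp_t s i.+1]) r = 0 :> R.
    by rewrite indic_itvE rz ltNge (part_ge0 pt (ltnW (ltn_ord i))).
  rewrite (_ : (fun w => _) = (fun w => Phi r w y ^+ 2)); last first.
    apply/funext => w; rewrite /simple_val big1 ?sub0r ?sqrrN// => i _.
    by rewrite z mul0r.
  rewrite expectE; last by apply: L2_sq; exact: Phi_L2.
  rewrite -/(nrm2 P (fun w => Phi r w y)) Phi_nrm2// rz mul0r /err_fun.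
  by rewrite big1// => i _; rewrite -rz z mul0r.
have rp : 0 < r by rewrite lt_neqAle eq_sym rn.
have [i ir ki] := part_pick pt rp r1.
have zi : \1_(`]sp_t s i, sp_t s i.+1]) r = 1 :> R by rewrite indic_itvE ir.
have zk (k : 'I_(sp_n s)) : k != i -> \1_(`]sp_t s k, sp_t s k.+1]) r = 0 :> R.
  by move=> /ki /negPf h; rewrite indic_itvE h.
rewrite (_ : (fun w => _) = (fun w => (sp_xi s i w y - Phi r w y) ^+ 2)); last first.
  apply/funext => w; rewrite /simple_val (bigD1 i)//= zi mul1r big1 ?addr0//.
  by move=> k /zk ->; rewrite mul0r.
have lx := adapted_L2 y (ltn_ord i).
rewrite expectE; last by apply: L2_sq; apply: L2B => //; exact: Phi_L2.
rewrite /err_fun (bigD1 i)//= zi mul1r big1 ?addr0; last by move=> k /zk ->; rewrite mul0r.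
case/andP: ir => ti _; congr EFin; rewrite -[LHS]/(nrm2 P _).
rewrite (nrm2_sub_Phi y (part_ge0 pt (ltnW (ltn_ord i))) (ltW ti) r1)//.
  by rewrite mulrC.
exact: adapted_gmeas.
Qed.

Definition approx_err (y : E) : \bar R := (\int[mu]_(r in `[0%R, 1%R])
  'E_P[fun w => ((simple_val s r w y - Phi r w y) ^+ 2)%R])%E.

Lemma approx_errE y : approx_err y = (\int[mu]_(r in `[0%R, 1%R]) (err_fun y r)%:E)%E.
Proof.
apply: eq_integral => r; rewrite mem_setE in_itv/= => r01; exact: err_funE.
Qed.

Lemma approx_err_ge_step y (u k : nat -> R) :
  (forall i, (i < sp_n s)%N -> [/\ sp_t s i <= u i, u i <= sp_t s i.+1, 0 <= k i &
     k i <= coef_err i y + coef2 y * (u i - sp_t s i)]) ->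
  ((\sum_(i < sp_n s) k i * (sp_t s i.+1 - u i))%:E <= approx_err y)%E.
Proof.
move=> h; rewrite approx_errE -(integral_stepf (v := fun i => sp_t s i.+1)); last first.
  move=> i ni; have [h1 h2 h3 h4] := h i ni; split => //.
    by apply: le_trans h1; exact: (part_ge0 pt (ltnW ni)).
  exact: (part_le1 pt).
apply: ge0_le_integral => //.
- move=> r _; rewrite lee_fin; apply: sumr_ge0 => i _.
  by apply: mulr_ge0 => //; case: (h i (ltn_ord i)).
- apply: measurable_funTS; apply/measurable_EFinP; exact: stepf_meas.
- apply: measurable_funTS; apply/measurable_EFinP; exact: err_fun_meas.
- move=> r _; rewrite lee_fin; apply: ler_sum => i _.
  have [h1 h2 h3 h4] := h i (ltn_ord i).
  rewrite !indic_itvE; have [/andP[ur rt]|nr] := boolP (u i < r <= sp_t s i.+1).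
    rewrite (le_lt_trans h1 ur) rt !mul1r; apply: le_trans h4 _.
    by rewrite lerD2l ler_wpM2l ?coef2_ge0// lerD2r ltW.
  rewrite mul0r; have [/andP[tr _]|_] := boolP (sp_t s i < r <= _); last by rewrite mul0r.
  rewrite mul1r addr_ge0 ?nrm2_ge0// mulr_ge0 ?coef2_ge0// subr_ge0 ltW//.
Qed.

Lemma approx_err_coef y :
  ((\sum_(i < sp_n s) coef_err i y * (sp_t s i.+1 - sp_t s i))%:E <= approx_err y)%E.
Proof.
apply: (@approx_err_ge_step y (sp_t s) (coef_err ^~ y)) => i ni; split => //.
- exact: ltW (part_lt pt ni).
- exact: nrm2_ge0.
- by rewrite subrr mulr0 addr0.
Qed.

(** On the second half of each interval the integrand has already moved by a fixed
    fraction of the mesh, so a good approximation needs a fine partition,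
    provided that [coef2 y] is not 0. *)
Lemma approx_err_mesh y :
  ((coef2 y / 4 * \sum_(i < sp_n s) (sp_t s i.+1 - sp_t s i) ^+ 2)%:E <= approx_err y)%E.
Proof.
have := @approx_err_ge_step y (fun i => (sp_t s i + sp_t s i.+1) / 2)
  (fun i => coef2 y * ((sp_t s i.+1 - sp_t s i) / 2)).
rewrite (_ : \sum_(i < _) _ = coef2 y / 4 * \sum_(i < sp_n s) (sp_t s i.+1 - sp_t s i) ^+ 2).
  apply=> i ni; have lt := part_lt pt ni; split; [lra|lra| |].
    by rewrite mulr_ge0 ?coef2_ge0// divr_ge0// subr_ge0 ltW.
  rewrite -[leLHS]add0r lerD ?nrm2_ge0// le_eqVlt; apply/orP; left; apply/eqP.
  by congr (_ * _); field.
by rewrite mulr_sumr; apply: eq_bigr => i _; field.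
Qed.

Lemma left_transform : L2 P (transform W (sp_t s) left_eta (sp_n s)) /\
  nrm2 P (transform W (sp_t s) left_eta (sp_n s)) =
    coefC * ((1 - \sum_(i < sp_n s) (sp_t s i.+1 - sp_t s i) ^+ 2) / 2).
Proof.
have [||hL hN] := transform_isometry cp pt (eta := left_eta).
- move=> i j ni; apply: Phi_gmeas; by rewrite lexx (part_ge0 pt (ltnW ni)).
- move=> i j ni; apply: Phi_L2; exact: (part_in01 pt (ltnW ni)).
split => //; rewrite hN -(part_sum_left pt) mulr_sumr; apply: eq_bigr => i _.
rewrite mulrCA; congr (_ * _); rewrite mulrC mulr_sumr; apply: eq_bigr => j _.
by rewrite /left_eta Phi_nrm2// (part_in01 pt (ltnW (ltn_ord i))).
Qed.

Lemma simple_integral_L2 : L2 P (simple_integral X s).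
Proof.
apply: (eq_L2 (fsym simple_integral_transform)).
have [||//] := transform_isometry cp pt (eta := fun i j w => sp_xi s i w (v j)).
- by move=> i j ni; exact: adapted_gmeas.
- by move=> i j ni; exact: adapted_L2.
Qed.

(** On a common partition the two sums differ by a discrete integral, whose
    coefficients are the errors of [s] at the left ends of the intervals. *)
Lemma simple_vs_left :
  ((nrm2 P (fun w => simple_integral X s w - transform W (sp_t s) left_eta (sp_n s) w))%:E
   <= \sum_(j < m) approx_err (v j))%E.
Proof.
have [||hL hN] := transform_isometry cp pt
  (eta := fun i j w => sp_xi s i w (v j) - left_eta i j w).
- move=> i j ni; apply: gmeasB; first exact: adapted_gmeas.
  by apply: Phi_gmeas; rewrite lexx (part_ge0 pt (ltnW ni)).
- move=> i j ni; apply: L2B; first exact: adapted_L2.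
  by apply: Phi_L2; exact: (part_in01 pt (ltnW ni)).
rewrite (_ : nrm2 P _ = nrm2 P (transform W (sp_t s)
   (fun i j w => sp_xi s i w (v j) - left_eta i j w) (sp_n s))); last first.
  apply: eq_Ex => w; congr (_ ^+ 2); rewrite simple_integral_transform /transform -sumrB.
  by apply: eq_bigr => i _; rewrite -sumrB; apply: eq_bigr => j _; rewrite mulrBl.
rewrite hN.
have -> : \sum_(i < sp_n s) (sp_t s i.+1 - sp_t s i) *
    \sum_(j < m) nrm2 P (fun w => sp_xi s i w (v j) - left_eta i j w) =
  \sum_(j < m) \sum_(i < sp_n s) coef_err i (v j) * (sp_t s i.+1 - sp_t s i).
  rewrite exchange_big; apply: eq_bigr => i _; rewrite mulr_sumr.
  by apply: eq_bigr => j _; rewrite mulrC.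
by rewrite -sumEFin; apply: lee_sum => j _; exact: approx_err_coef.
Qed.
End Adapted.

(** The definition of the integral admits arbitrary approximating simple
    processes.  Replacing each by the left-point process on its own partition
    does not change the limit, and leaves sums that can be computed. *)
Lemma ito_left_limit I : is_ito P X Phi I -> exists s : nat -> simple_process E Omega,
  [/\ L2 P I, forall k, simple_adapted P X (s k),
   (fun k => coefC * \sum_(i < sp_n (s k)) (sp_t (s k) i.+1 - sp_t (s k) i) ^+ 2) @ \oo --> 0 &
   (fun k => nrm2 P (fun w =>
      transform W (sp_t (s k)) (left_eta (s k)) (sp_n (s k)) w - I w)) @ \oo --> 0].
Proof.
move=> [mI I2 [s [As qs hs]]]; exists s.
have LI : L2 P I by exact: L2_expect.
have ae y k : approx_err (s k) y = (\int[mu]_(t in `[0%R, 1%R])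
   'E_P[fun w => ((simple_val (s k) t w y - Phi t w y) ^+ 2)%R])%E by [].
have ae0 y k : (0 <= approx_err (s k) y)%E.
  by apply: integral_ge0 => r _; apply: expectation_ge0 => w; exact: sqr_ge0.
have e0 : (fun k => (\sum_(j < m) (4%:E * approx_err (s k) (v j)))%E) @ \oo --> 0%E.
  rewrite -[X in _ --> X](_ : (\sum_(j < m) (4%:E * 0))%E = 0%E); last first.
    by rewrite big1// => j _; rewrite mule0.
  by apply: cvg_nnesum => // j _; [apply: nearW => k; apply: mule_ge0 => //|
    apply: cvgeZl => //; exact: qs].
split => //.
- apply: cvg0_le_ereal e0 => k.
    by rewrite mulr_ge0 ?coefC_ge0// sumr_ge0// => i _; exact: sqr_ge0.
  rewrite (_ : coefC * _ = \sum_(j < m) 4 * (coef2 (v j) / 4 *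
      \sum_(i < sp_n (s k)) (sp_t (s k) i.+1 - sp_t (s k) i) ^+ 2)).
    rewrite -sumEFin; apply: lee_sum => j _; rewrite EFinM lee_wpmul2l ?lee_fin//.
    exact: approx_err_mesh.
  by rewrite mulr_suml; apply: eq_bigr => j _; field.
- have h1 : (fun k => nrm2 P (fun w => simple_integral X (s k) w - I w)) @ \oo --> 0.
    apply: (cvg0_le_ereal (e := fun k =>
      'E_P[fun w => ((simple_integral X (s k) w - I w) ^+ 2)%R]%E)) => // k.
      exact: nrm2_ge0.
    by rewrite expectE//; apply: L2_sq; apply: L2B => //; exact: simple_integral_L2.
  have h2 : (fun k => nrm2 P (fun w => simple_integral X (s k) w -
      transform W (sp_t (s k)) (left_eta (s k)) (sp_n (s k)) w)) @ \oo --> 0.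
    apply: cvg0_le_ereal e0 => k; first exact: nrm2_ge0.
    apply: le_trans (simple_vs_left (As k)) _; apply: lee_sum => j _.
    by rewrite -[leLHS]mul1e lee_wpmul2r// lee_fin ler1n.
  apply: (@squeeze_cvgr _ _ _ _ (fun=> 0) (fun k =>
    2 * nrm2 P (fun w => simple_integral X (s k) w -
      transform W (sp_t (s k)) (left_eta (s k)) (sp_n (s k)) w) +
    2 * nrm2 P (fun w => simple_integral X (s k) w - I w))).
  + apply: nearW => k; rewrite nrm2_ge0/=.
    have [lL _] := left_transform (As k); have lS := simple_integral_L2 (As k).
    rewrite (_ : nrm2 P _ = nrm2 P (fun w => -1 * (simple_integral X (s k) w -
      transform W (sp_t (s k)) (left_eta (s k)) (sp_n (s k)) w) +
      (simple_integral X (s k) w - I w))); last first.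
      by apply: eq_Ex => w; congr (_ ^+ 2); ring.
    apply: le_trans (nrm2_triangle _ _) _; [by apply: L2Z; exact: L2B|exact: L2B|].
    by rewrite nrm2Z; [rewrite sqrrN expr1n mul1r|exact: L2B].
  + exact: cvg_cst.
  + have k1 : (fun k => 2 * nrm2 P (fun w => simple_integral X (s k) w - I w)) @ \oo --> (2 * 0 : R).
      exact: cvgMl_tmp.
    have k2 : (fun k => 2 * nrm2 P (fun w => simple_integral X (s k) w -
      transform W (sp_t (s k)) (left_eta (s k)) (sp_n (s k)) w)) @ \oo --> (2 * 0 : R).
      exact: cvgMl_tmp.
    by have := cvgD k2 k1; rewrite mulr0 addr0; apply.
Qed.

(** The second moments of the left-point sums are known up to the mesh term, which
    tends to 0. *)
Theorem ito_second_moment I : is_ito P X Phi I -> L2 P I /\ nrm2 P I = coefC / 2.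
Proof.
move=> /ito_left_limit[s [LI As mesh lim]]; split => //.
have h := L2_cvg_nrm2 (fun k => (left_transform (As k)).1) LI lim.
apply: (cvg_real_unique h).
rewrite (_ : (fun k => _) = (fun k => coefC / 2 -
   coefC * (\sum_(i < sp_n (s k)) (sp_t (s k) i.+1 - sp_t (s k) i) ^+ 2) / 2)); last first.
  by apply/funext => k; rewrite (left_transform (As k)).2; field.
rewrite -[X in _ --> X]subr0; apply: cvgB; first exact: cvg_cst.
by rewrite -[X in _ --> X](mul0r 2^-1); exact: cvgMr_tmp.
Qed.

Section Existence.
Hypothesis clin : forall l, scalar (c l).

Definition unit_grid (N i : nat) : R := i%:R / N%:R.

Lemma unit_grid_partition N : (0 < N)%N -> partition01 N (unit_grid N).
Proof.
move=> N0; split; rewrite /unit_grid ?mul0r ?divff ?pnatr_eq0 ?gtn_eqF// => i _.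
by rewrite ltr_pM2r ?invr_gt0 ?ltr0n// ltr_nat.
Qed.

Definition left_process (N : nat) : simple_process E Omega :=
  SimpleProcess N (unit_grid N) (fun i w y => Phi (unit_grid N i) w y).

Lemma left_process_adapted N : (0 < N)%N -> simple_adapted P X (left_process N).
Proof.
move=> N0; have pt := unit_grid_partition N0; have [p0 p1 plt] := pt; split => //=.
- move=> i w ni a x y; rewrite /lin_integrand mulr_sumr -big_split; apply: eq_bigr => l _ /=.
  by rewrite clin /=; ring.
- move=> i y ni; split.
    move=> U mU; apply: (Phi_gmeas (s := unit_grid N i) y _ mU).
    by rewrite (part_ge0 pt (ltnW ni)) lexx.
  have l2 := Phi_L2 y (part_in01 pt (ltnW ni)).
  by rewrite expectE; [exact: ltry|exact: L2_sq].
Qed.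

Lemma left_process_err N y : (0 < N)%N ->
  (approx_err (left_process N) y <= (coef2 y / N%:R)%:E)%E.
Proof.
move=> N0; have As := left_process_adapted N0; have pt := adapted_partition As.
rewrite (approx_errE As).
apply: (@le_trans _ _ (\int[mu]_(r in `[0%R, 1%R]) (coef2 y / N%:R)%:E)%E); last first.
  by rewrite integral_cst//= lebesgue_measure_itv/= lte01 -EFinD subr0 mule1.
have k0 : 0 <= coef2 y / N%:R by rewrite divr_ge0 ?coef2_ge0.
have ce i : coef_err (left_process N) i y = 0.
  by rewrite /coef_err /nrm2 -[RHS](Ex_cst P 0); apply: eq_Ex => w; rewrite subrr expr0n.
apply: ge0_le_integral => //.
- move=> r _; rewrite lee_fin; apply: sumr_ge0 => i _; rewrite ce add0r indic_itvE.
  have [/andP[h _]|_] := boolP (sp_t _ i < r <= _); last by rewrite mul0r.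
  by rewrite mul1r mulr_ge0 ?coef2_ge0// subr_ge0 ltW.
- apply: measurable_funTS; apply/measurable_EFinP; exact: err_fun_meas.
- move=> r; rewrite /= in_itv/= => /andP[r0 r1]; rewrite lee_fin /err_fun.
  have [rz|rn] := eqVneq r 0.
    rewrite big1// => i _; rewrite indic_itvE rz ltNge.
    by rewrite (part_ge0 pt (ltnW (ltn_ord i))) mul0r.
  have rp : 0 < r by rewrite lt_neqAle eq_sym rn.
  have [i ir ki] := part_pick pt rp r1.
  rewrite (bigD1 i)//= big1 ?addr0; last first.
    by move=> k /ki /negPf h; rewrite indic_itvE h mul0r.
  rewrite indic_itvE ir mul1r ce add0r ler_wpM2l ?coef2_ge0//.
  case/andP: ir => _ h; rewrite lerBlDl; apply: le_trans h _.
  by rewrite /= /unit_grid -[in leLHS]addn1 natrD mulrDl mul1r.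
Qed.

Lemma refine4 (t : nat -> R) (eta : nat -> 'I_m -> Omega -> R) n w :
  \sum_(i < n) \sum_(j < m) eta i j w * (W j (t (4 * i.+1)%N) w - W j (t (4 * i)%N) w) =
  transform W t (fun i j w => eta (i %/ 4)%N j w) (4 * n) w.
Proof.
elim: n => [|n IH]; first by rewrite muln0 /transform !big_ord0.
rewrite big_ord_recr/= IH /transform (_ : (4 * n.+1 = (4 * n).+4)%N); last by rewrite mulnS.
rewrite !big_ord_recr/= -!addrA; congr (_ + _).
have q k : (k < 4)%N -> ((4 * n + k) %/ 4 = n)%N.
  by move=> k4; rewrite mulnC divnMDl// divn_small ?addn0.
have q0 := q 0%N isT; have q1 := q 1%N isT; have q2 := q 2%N isT; have q3 := q 3%N isT.
rewrite ?addn0 ?addn1 ?addn2 ?addn3 in q0 q1 q2 q3; rewrite q0 q1 q2 q3 -!big_split.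
by apply: eq_bigr => j _ /=; rewrite -!mulrDr; congr (_ * _); ring.
Qed.

(** The change under refinement is of order 1/N, hence geometric along the grids
    with [N = 4^k], as [L2_complete] requires. *)
Lemma left_process_step N : (0 < N)%N ->
  nrm2 P (fun w => simple_integral X (left_process (4 * N)) w -
     simple_integral X (left_process N) w) <= coefC / N%:R.
Proof.
move=> N0; have N4 : (0 < 4 * N)%N by rewrite muln_gt0.
have pt := unit_grid_partition N4; set t := unit_grid (4 * N) in pt *.
have gt i : unit_grid N i = t (4 * i)%N.
  rewrite /t /unit_grid !natrM; field; by rewrite !pnatr_eq0 -lt0n N0.
pose eta i j w := Phi (t i) w (v j) - Phi (t (4 * (i %/ 4))%N) w (v j).
have q4 i : (4 * (i %/ 4) <= i)%N by rewrite mulnC leq_divM.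
have [||hL hN] := transform_isometry cp pt (eta := eta).
- move=> i j ni; apply: gmeasB; apply: Phi_gmeas; first by rewrite lexx (part_ge0 pt (ltnW ni)).
  rewrite (part_le pt (q4 i) (ltnW ni)) andbT; apply: (part_ge0 pt).
  exact: leq_trans (q4 i) (ltnW ni).
- move=> i j ni; apply: L2B; apply: Phi_L2; first exact: (part_in01 pt (ltnW ni)).
  exact: (part_in01 pt (leq_trans (q4 i) (ltnW ni))).
rewrite (_ : nrm2 P _ = nrm2 P (transform W t eta (4 * N))); last first.
  apply: eq_Ex => w; congr (_ ^+ 2).
  rewrite (simple_integral_transform (left_process_adapted N4)).
  rewrite (simple_integral_transform (left_process_adapted N0)) /=.
  rewrite [X in _ - X](_ : _ = transform W t (fun i j w => Phi (unit_grid N (i %/ 4)%N) w (v j)) (4 * N) w).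
    rewrite /transform -sumrB; apply: eq_bigr => i _; rewrite -sumrB; apply: eq_bigr => j _.
    by rewrite /eta mulrBl gt.
  rewrite -(refine4 t (fun i j w => Phi (unit_grid N i) w (v j))).
  by apply: eq_bigr => i _; apply: eq_bigr => j _; rewrite !gt.
rewrite hN.
apply: (@le_trans _ _ (\sum_(i < 4 * N) (t i.+1 - t i) * (coefC / N%:R))).
  apply: ler_sum => i _; have ni := ltn_ord i.
  rewrite ler_wpM2l ?subr_ge0 ?(ltW (part_lt pt ni))// /coefC mulr_suml.
  apply: ler_sum => j _; set s0 := t (4 * (i %/ 4))%N.
  have s00 : 0 <= s0 by apply: (part_ge0 pt); exact: leq_trans (q4 i) (ltnW ni).
  have st : s0 <= t i by exact: (part_le pt (q4 i) (ltnW ni)).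
  rewrite (_ : nrm2 P _ = nrm2 P (fun w => Phi s0 w (v j) - Phi (t i) w (v j))); last first.
    by apply: eq_Ex => w; rewrite -sqrrN opprB.
  rewrite (nrm2_sub_Phi (v j) s00 st (part_le1 pt (ltnW ni))); last 2 first.
  - by apply: Phi_gmeas; rewrite s00 lexx.
  - by apply: Phi_L2; rewrite s00 (le_trans st (part_le1 pt (ltnW ni))).
  rewrite (_ : nrm2 P _ = 0); last first.
    by rewrite /nrm2 -[RHS](Ex_cst P 0); apply: eq_Ex => w; rewrite subrr expr0n.
  rewrite add0r mulrC ler_wpM2l ?coef2_ge0//.
  rewrite /s0 /t /unit_grid -mulrBl -natrB ?q4//.
  rewrite ler_pdivrMr ?ltr0n// natrM mulrCA mulVf ?mulr1 ?pnatr_eq0 -?lt0n//.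
  rewrite ler_nat leq_subLR.
  by rewrite {1}(divn_eq i 4) (mulnC (i %/ 4)%N) leq_add2l ltnW// ltn_mod.
rewrite -mulr_suml -(big_mkord xpredT (fun i => t i.+1 - t i)) telescope_sumr//.
by case: pt => -> -> _; rewrite subr0 mul1r.
Qed.

Theorem ito_exists : exists I, is_ito P X Phi I.
Proof.
have N0 k : (0 < 4 ^ k)%N by rewrite expn_gt0.
pose f k := simple_integral X (left_process (4 ^ k)).
have lf k : L2 P (f k) by exact: simple_integral_L2 (left_process_adapted (N0 k)).
have [|I [LI hI]] := L2_complete lf coefC_ge0.
  move=> k; rewrite /f expnS; apply: le_trans (left_process_step (N0 k)) _.
  by rewrite natrX.
exists I; split; first exact: L2_meas LI.
  by rewrite expectE; [exact: ltry|exact: L2_sq].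
exists (fun k => left_process (4 ^ k)); split.
- by move=> k; exact: left_process_adapted.
- move=> y; apply: (squeeze_cvge (f := fun=> 0%E) (h := fun k => (coef2 y / (4 ^ k)%:R)%:E)).
  + apply: nearW => k; rewrite left_process_err// andbT.
    by apply: integral_ge0 => r _; apply: expectation_ge0 => w; exact: sqr_ge0.
  + exact: cvg_cst.
  + apply: cvg_EFin; first exact: nearW.
    apply: (@cvg0_le_inv _ _ (coef2 y)) => k /=; rewrite divr_ge0 ?coef2_ge0//=.
    rewrite ler_wpM2l ?coef2_ge0// lef_pV2 ?posrE ?ltr0n// ler_nat; exact: ltn_expl.
- rewrite (_ : (fun k => _) = (fun k => (nrm2 P (fun w => f k w - I w))%:E)); last first.
    by apply/funext => k; rewrite (expectE (L2_sq (L2B (lf k) LI))).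
  by apply: cvg_EFin; first exact: nearW.
Qed.
End Existence.
End Ito.

(** * Coordinates of Brownian motion *)

Section Borel.
Variables (R : realType).

Lemma borel_preimage (E F : innerProductType R) (g : E -> F) (U : set F) :
  continuous g -> @borel R F U -> @borel R E (g @^-1` U).
Proof.
move=> cg; have : <<s @open F >> `<=` [set V | @borel R E (g @^-1` V)].
  apply: smallest_sub; last first.
    by move=> V oV; apply: sub_sigma_algebra; apply: open_comp => // x _; exact: cg.
  have sa := smallest_sigma_algebra (@setT E) (@open E); case: sa => s0 sC sU.
  split => //=.
  - by move=> V hV; exact: sC hV.
  - by move=> V hV; rewrite /borel preimage_bigcup; exact: sU.
by apply.
Qed.

Lemma borel_preimage_real (E : innerProductType R) (h : E -> R) (U : set R) :
  continuous h -> measurable U -> @borel R E (h @^-1` U).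
Proof.
move=> ch mU.
have mh : measurable_fun [set: g_sigma_algebraType (@open E)] h.
  apply: (@measurability _ _ (g_sigma_algebraType (@open E)) (measurableTypeR R) setT h (@RGenOpens.G R)).
    exact: RGenOpens.measurableE.
  move=> _ [_ [x [y ->]] <-]; rewrite setTI; apply: sub_sigma_algebra.
  by apply: open_comp => [z _|]; [exact: ch|exact: itv_open].
by have := mh measurableT U mU; rewrite setTI.
Qed.

Lemma inner_continuous (E : innerProductType R) (e : E) : continuous (inner e).
Proof.
move=> x; apply/cvgrPdist_lt => eps e0.
have n0 : 0 < `|e| + 1 by rewrite ltr_wpDl.
near=> y; rewrite -innerBr; apply: le_lt_trans (cauchy_schwarz _ _) _.
apply: (@le_lt_trans _ _ ((`|e| + 1) * `|x - y|)); first by rewrite ler_wpM2r// lerDl.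
rewrite mulrC -ltr_pdivlMr//; near: y.
by have /cvgrPdist_lt/(_ _ (divr_gt0 e0 n0)) := @cvg_id _ (nbhs x).
Unshelve. all: by end_near. Qed.
End Borel.

Section GaussianIncrement.
Variables (R : realType).
Context d (Omega : measurableType d) (P : probability Omega R).

Lemma normal_moments (D : Omega -> R) (s : R) : measurable_fun setT D -> 0 < s ->
  (forall U, measurable U -> P (D @^-1` U) = normal_prob 0 s U) ->
  [/\ L2 P D, nrm2 P D = s ^+ 2, L2 P (fun w => D w ^+ 2) &
      nrm2 P (fun w => D w ^+ 2) <= 64 * s ^+ 4].
Proof.
move=> mD s0 hD.
pose D' : {mfun Omega >-> measurableTypeR R} := 
  @mfun_Sub _ _ Omega (measurableTypeR R) D (mem_set mD).
have key (f : R -> R) : measurable_fun setT f -> (forall x, 0 <= f x) ->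
    (\int[P]_w (f (D w))%:E = \int[lebesgue_measure]_x ((f x)%:E * (normal_pdf 0 s x)%:E))%E.
  move=> mf f0; have -> : (\int[P]_w (f (D w))%:E = \int[distribution P D']_x (f x)%:E)%E.
    rewrite ge0_integral_distribution//; first exact/measurable_EFinP.
  have mp : measurable_fun [set: measurableTypeR R] (normal_pdf 0 s) by exact: measurable_normal_pdf.
  have p0 : forall x, 0 <= normal_pdf 0 s x by move=> x; exact: normal_pdf_ge0.
  have hd U : measurable U ->
     distribution P D' U = (\int[@lebesgue_measure R]_(x in U) (normal_pdf 0 s x)%:E)%E.
    by move=> mU; rewrite -[LHS]/(P (D @^-1` U)) hD.
  have h := @integral_density _ (measurableTypeR R) R (@lebesgue_measure R) (distribution P D')
    (normal_pdf 0 s) mp p0 hd f mf f0.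
  exact: h.
have m2 : measurable_fun [set: R] (fun x : R => x ^+ 2) by exact: measurable_funX.
have m4 : measurable_fun [set: R] (fun x : R => x ^+ 4) by exact: measurable_funX.
have x40 (x : R) : 0 <= x ^+ 4 by rewrite -[4%N]/(2 * 2)%N exprM sqr_ge0.
have k2 := key _ m2 (fun x => sqr_ge0 x).
rewrite normal_pdf_second_moment// in k2.
have k4 := key _ m4 x40.
have k4' := normal_pdf_fourth_moment s0; rewrite -k4 in k4'.
have l2 : L1 P (fun w => D w ^+ 2).
  apply: L1_ge0; [exact: measurable_funX|by move=> w; exact: sqr_ge0|].
  by rewrite k2 ltry.
have l4 : L1 P (fun w => D w ^+ 4).
  apply: L1_ge0; [exact: measurable_funX|by move=> w; exact: x40|].
  by apply: le_lt_trans k4' _; rewrite ltry.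
have e4 w : D w ^+ 4 = (D w ^+ 2) ^+ 2 by rewrite -exprM.
split.
- by split.
- by apply: EFin_inj; rewrite -k2 ExE.
- by split; [exact: measurable_funX|exact: eq_L1 e4 l4].
- by rewrite -lee_fin /nrm2 -(eq_Ex P e4) -(ExE l4).
Qed.
End GaussianIncrement.

Section BrownianCoordinates.
Variables (R : realType) (E F : innerProductType R).
Context d (Omega : measurableType d) (P : probability Omega R).
Variables (X : R -> Omega -> E) (X' : R -> Omega -> F).
Hypothesis bX : is_brownian P X.

Lemma past_measurable t A : 0 <= t <= 1 -> past X t A -> measurable A.
Proof.
move=> /andP[t0 t1]; have [h _ _ _] := bX.
have : <<s pgen X t >> `<=` measurable.
  apply: smallest_sub; first exact: sigma_algebra_measurable.
  by move=> B [s [U [/andP[s0 st] bU ->]]]; apply: h => //; rewrite s0 (le_trans st).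
by apply.
Qed.

Lemma increment_moments (e : E) s t : 0 <= s -> s < t -> t <= 1 -> `|e| = 1 ->
  let D w := inner e (X t w) - inner e (X s w) in
  [/\ L2 P D, nrm2 P D = t - s, L2 P (fun w => D w ^+ 2) &
      nrm2 P (fun w => D w ^+ 2) <= 64 * (t - s) ^+ 2].
Proof.
move=> s0 st t1 ne D; have [h1 _ _ h4] := bX.
have m r : 0 <= r <= 1 -> measurable_fun setT (fun w => inner e (X r w)).
  move=> r01 _ U mU; rewrite setTI.
  exact: (h1 r r01 _ (borel_preimage_real (@inner_continuous R E e) mU)).
have mD : measurable_fun setT D.
  apply: measurable_funB; apply: m; first by rewrite t1 (le_trans s0 (ltW st)).
  by rewrite s0 (le_trans (ltW st)).
have ts : 0 < t - s by rewrite subr_gt0.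
have [|U mU|a b c f] := @normal_moments _ _ _ P D (Num.sqrt (t - s)) mD.
- by rewrite sqrtr_gt0.
- rewrite -(h4 s t _ t1 e ne U mU) ?s0//; congr (P _); apply/seteqP; split => w /=;
    by rewrite /D innerBr.
- rewrite sqr_sqrtr ?ltW// in b; split => //; apply: le_trans f _.
  by rewrite -[4%N]/(2 * 2)%N exprM sqr_sqrtr// ltW.
Qed.

(** <-e, dX> and <e, dX> have the same law. *)
Lemma increment_mean (e : E) s t : 0 <= s -> s < t -> t <= 1 -> `|e| = 1 ->
  Ex P (fun w => inner e (X t w) - inner e (X s w)) = 0.
Proof.
move=> s0 st t1 ne; have [h1 _ _ h4] := bX.
have ne' : `|- e| = 1 by rewrite normrN.
set D := fun w => _.
have [lD _ _ _] := increment_moments s0 st t1 ne.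
have [lN _ _ _] := increment_moments s0 st t1 ne'.
pose D1 : {mfun Omega >-> R} := mfun_Sub (mem_set (L2_meas lD)).
pose D2 : {mfun Omega >-> R} := mfun_Sub (mem_set (L2_meas lN)).
have law : forall A, measurable A -> distribution P D1 A = distribution P D2 A.
  move=> U mU; rewrite /distribution /pushforward /=.
  transitivity (normal_prob 0 (Num.sqrt (t - s)) U).
    rewrite -(h4 s t _ t1 e ne U mU) ?s0//; congr (P _); apply/seteqP; split => w /=;
    by rewrite innerBr.
  rewrite -(h4 s t _ t1 (- e) ne' U mU) ?s0//; congr (P _); apply/seteqP; split => w /=;
    by rewrite innerBr.
have eN : Ex P (fun w => inner (- e) (X t w) - inner (- e) (X s w)) = - Ex P D.
  rewrite -mulN1r -ExZ; last exact: L2_L1.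
  by apply: eq_Ex => w; rewrite /D !innerNl; ring.
have : Ex P D = Ex P (fun w => inner (- e) (X t w) - inner (- e) (X s w)).
  apply: EFin_inj; rewrite -!ExE//; try exact: L2_L1.
  transitivity (\int[distribution P D1]_x x%:E)%E.
    by rewrite integral_distribution//; exact: L2_L1 lD.
  transitivity (\int[distribution P D2]_x x%:E)%E.
    by apply: eq_measure_integral => A mA _; exact: law.
  by rewrite integral_distribution//; exact: L2_L1 lN.
rewrite eN; move: (Ex P D) => z h; lra.
Qed.

Lemma increment_indep (f : E -> R) s t Y : continuous f -> 0 <= s -> s < t -> t <= 1 ->
  gmeas (pgen X s) Y -> L1 P Y -> L1 P (fun w => f (X t w - X s w)) ->
  L1 P (fun w => Y w * f (X t w - X s w)) /\
  Ex P (fun w => Y w * f (X t w - X s w)) = Ex P Y * Ex P (fun w => f (X t w - X s w)).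
Proof.
move=> cf s0 st t1 gY iY iD; have [_ _ h3 _] := bX; apply: indep_Ex_mul => // A B mA mB.
have := h3 s t _ t1 (Y @^-1` A) (f @^-1` B); rewrite s0 => /(_ st); apply.
- exact: gY.
- exact: borel_preimage_real.
Qed.

(* [X'] is the image of [X] under [g], and the continuous [h j] recover from it
   the coordinates along [u]; these are then adapted to the past of [X'],
   which lies in the past of [X]. *)
Variables (m : nat) (u : 'I_m -> E) (v : 'I_m -> F) (g : E -> F) (h : 'I_m -> F -> R).
Hypothesis u_on : forall i j, inner (u i) (u j) = (i == j)%:R.
Hypothesis gE : forall x, g x = \sum_(j < m) inner (u j) x *: v j.
Hypothesis g_continuous : continuous g.
Hypothesis h_continuous : forall j, continuous (h j).
Hypothesis hE : forall j x, h j (g x) = inner (u j) x.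
Hypothesis X'E : forall t w, X' t w = g (X t w).

Let pgen_sub t : pgen X' t `<=` pgen X t.
Proof.
move=> A [s [U [st bU ->]]]; exists s, (g @^-1` U); split => //.
  exact: borel_preimage.
by apply/seteqP; split => w /=; rewrite X'E.
Qed.

Let gmeas_sub t (Y : Omega -> R) : gmeas (pgen X' t) Y -> gmeas (pgen X t) Y.
Proof. by move=> gY U mU; have := gY U mU; apply: sub_sigma_algebra2; exact: pgen_sub. Qed.

Let u_norm j : `|u j| = 1.
Proof.
have := inner_normE (u j); rewrite u_on eqxx => /esym/eqP.
by rewrite sqrf_eq1 => /orP[/eqP//|/eqP h0]; have := normr_ge0 (u j); rewrite h0 ler0N1.
Qed.

Let W j t w := inner (u j) (X t w).

(** For distinct indices, the variance along the unit vector [(u i + u j) / sqrt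
    2] determines the covariance. *)
Let increment_cov s t i j : 0 <= s -> s < t -> t <= 1 ->
  L1 P (fun w => (W i t w - W i s w) * (W j t w - W j s w)) /\
  Ex P (fun w => (W i t w - W i s w) * (W j t w - W j s w)) = (i == j)%:R * (t - s).
Proof.
move=> s0 st t1.
have [li vi _ _] := increment_moments s0 st t1 (u_norm i).
have [lj vj _ _] := increment_moments s0 st t1 (u_norm j).
split; first exact: L2_mul.
have [<-|ij] := eqVneq i j; first by rewrite mul1r -vi; apply: eq_Ex => w; rewrite expr2.
pose e := (Num.sqrt 2)^-1 *: (u i + u j).
have s2 : (Num.sqrt 2)^-1 ^+ 2 = 2^-1 :> R by rewrite exprVn sqr_sqrtr.
have ne : `|e| = 1.
  have : `|e| ^+ 2 = 1.
    rewrite -inner_normE /e innerZl innerZr mulrA -expr2 s2.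
    rewrite innerDl !innerDr !u_on !eqxx [j == i]eq_sym.
    by rewrite (negPf ij) /= add0r addr0 -[1 + 1]/2%:R mulVf.
  by move/eqP; rewrite sqrf_eq1 => /orP[/eqP//|/eqP h0]; have := normr_ge0 e; rewrite h0 ler0N1.
have [le ve _ _] := increment_moments s0 st t1 ne.
have : nrm2 P (fun w => inner e (X t w) - inner e (X s w)) =
   2^-1 * nrm2 P (fun w => (W i t w - W i s w) + (W j t w - W j s w)).
  rewrite -s2 -nrm2Z; last exact: L2D.
  by apply: eq_Ex => w; rewrite /e !innerZl !innerDl /W; congr (_ ^+ 2); ring.
rewrite ve nrm2D// vi vj mul0r; move: (Ex P _) => q h0; lra.
Qed.

Let W_fE j s t w : W j t w - W j s w = inner (u j) (X t w - X s w).
Proof. by rewrite /W innerBr. Qed.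

Lemma brownian_coord_process : coord_process P X' W v.
Proof.
split.
- by move=> t w; rewrite X'E gE.
- move=> s t j st U mU; apply: sub_sigma_algebra.
  exists s, (h j @^-1` U); split => //; first exact: borel_preimage_real.
  by apply/seteqP; split => w /=; rewrite X'E hE.
- move=> t A t01 pA; apply: (past_measurable t01); move: pA; apply: sub_sigma_algebra2.
  exact: pgen_sub.
- by move=> s t j s0 st t1; have [] := increment_moments s0 st t1 (u_norm j).
- move=> s t j Y s0 st t1 gY iY.
  have [l _ _ _] := increment_moments s0 st t1 (u_norm j).
  have [|//|//|//||//||l' e'] := @increment_indep (inner (u j)) s t Y.
  + exact: inner_continuous.
  + exact: gmeas_sub.
  + by apply: eq_L1 (L2_L1 l) => w; rewrite innerBr.
  + split; first by apply: eq_L1 l' => w; rewrite W_fE.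
    transitivity (Ex P (fun w => Y w * inner (u j) (X t w - X s w))).
      by apply: eq_Ex => w; rewrite W_fE.
    rewrite e' (_ : Ex P (fun w => inner _ _) = 0) ?mulr0//.
    rewrite -[RHS](increment_mean s0 st t1 (u_norm j)).
    by apply: eq_Ex => w; rewrite innerBr.
- move=> s t i j Y s0 st t1 gY iY.
  have [l e] := increment_cov i j s0 st t1.
  have ff w : (W i t w - W i s w) * (W j t w - W j s w) =
     inner (u i) (X t w - X s w) * inner (u j) (X t w - X s w) by rewrite !W_fE.
  have [|//|//|//||//||l' e'] := @increment_indep (fun x => inner (u i) x * inner (u j) x) s t Y.
  + by move=> x; apply: cvgM; exact: inner_continuous.
  + exact: gmeas_sub.
  + exact: eq_L1 ff l.
  + split; first by apply: eq_L1 l' => w; rewrite ff.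
    rewrite (eq_Ex P (g := fun w => Y w * (inner (u i) (X t w - X s w) * inner (u j) (X t w - X s w)))); last first.
      by move=> w; rewrite ff.
    by rewrite e' -(eq_Ex P ff) e mulrC.
- move=> j; have [_ h2 _ _] := bX; apply: filterS h2 => w [w0 _].
  by rewrite /W w0 inner0r.
Qed.
End BrownianCoordinates.

(** * Quadratic variation *)

Section QuadraticVariation.
Variables (R : realType) (E : innerProductType R).
Context d (Omega : measurableType d) (P : probability Omega R).
Variables (X : R -> Omega -> E) (b : R -> Omega -> R) (e : E).
Hypothesis cp : coord_process P X (fun _ : 'I_1 => b) (fun=> e).
Hypothesis b4 : forall s t, 0 <= s -> s < t -> t <= 1 ->
  L2 P (fun w => (b t w - b s w) ^+ 2) /\
  nrm2 P (fun w => (b t w - b s w) ^+ 2) <= 64 * (t - s) ^+ 2.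

Let incr (t : nat -> R) i w := (b (t i.+1) w - b (t i) w) ^+ 2 - (t i.+1 - t i).

(** The compensated square of an increment is orthogonal to the past, and small in
    mean square by the fourth moment. *)
Lemma incr_step s t : 0 <= s -> s < t -> t <= 1 ->
  let D w := (b t w - b s w) ^+ 2 - (t - s) in
  [/\ L2 P D, nrm2 P D <= 64 * (t - s) ^+ 2, gmeas (pgen X t) D &
      forall Z, gmeas (pgen X s) Z -> L2 P Z -> Ex P (fun w => Z w * D w) = 0].
Proof.
move=> s0 st t1 D; have [l4 n4] := b4 s0 st t1.
have l2 := cp_L2 cp ord0 s0 st t1.
have lD : L2 P D by apply: L2B => //; exact: L2_cst.
have br Z gZ iZ := @cp_bracket _ _ _ _ _ _ _ _ _ cp s t ord0 ord0 Z s0 st t1 gZ iZ.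
split => //.
- rewrite /D nrm2B//; last exact: L2_cst.
  have [_] := br _ (@gmeas_cst _ Omega R _ 1) (L1_cst P 1).
  rewrite Ex_cst mulr1 eqxx mul1r => h.
  have -> : Ex P (fun w => (b t w - b s w) ^+ 2 * (t - s)) = (t - s) * (t - s).
    rewrite -[X in _ * X]h -ExZ; last by apply: eq_L1 (L2_sq l2) => w; rewrite mul1r.
    by apply: eq_Ex => w; ring.
  rewrite /nrm2 Ex_cst -/(nrm2 P _); apply: le_trans n4.
  rewrite -expr2; have := sqr_ge0 (t - s).
  by move: ((t - s) ^+ 2) (nrm2 _ _) => p q h0; lra.
- apply: gmeasB; last exact: gmeas_cst.
  have gb r : 0 <= r <= t -> gmeas (pgen X t) (b r) by move=> rt; exact: (cp_past cp ord0 rt).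
  have gB : gmeas (pgen X t) (fun w => b t w - b s w).
    by apply: gmeasB; apply: gb; rewrite ?lexx ?s0 ?(ltW st)// (le_trans s0 (ltW st)).
  by have := gmeasM gB gB; congr gmeas; apply/funext => w; rewrite expr2.
- move=> Z gZ lZ; have [h1 h2] := br Z gZ (L2_L1 lZ).
  transitivity (Ex P (fun w => Z w * ((b t w - b s w) * (b t w - b s w)) - (t - s) * Z w)).
    by apply: eq_Ex => w; rewrite /D; ring.
  rewrite ExB//; last by apply: L1Z; exact: L2_L1.
  by rewrite h2 ExZ ?eqxx ?mul1r ?subrr//; exact: L2_L1.
Qed.

Lemma quadratic_variation n (t : nat -> R) : partition01 n t ->
  L2 P (fun w => \sum_(i < n) incr t i w) /\
  nrm2 P (fun w => \sum_(i < n) incr t i w) <= 64 * \sum_(i < n) (t i.+1 - t i) ^+ 2.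
Proof.
move=> pt.
have step i (ni : (i < n)%N) := @incr_step (t i) (t i.+1)
  (part_ge0 pt (ltnW ni)) (part_lt pt ni) (part_le1 pt ni).
have gs k : (k <= n)%N -> gmeas (pgen X (t k)) (fun w => \sum_(i < k) incr t i w).
  elim: k => [|k IH] kn.
    by under eq_fun do rewrite big_ord0; exact: gmeas_cst.
  under eq_fun do rewrite big_ord_recr /=.
  apply: gmeasD; first exact: (gmeas_mono (ltW (part_lt pt kn)) (IH (ltnW kn))).
  by have [_ _] := step k kn.
have ls k : (k <= n)%N -> L2 P (fun w => \sum_(i < k) incr t i w).
  elim: k => [|k IH] kn.
    by apply: (eq_L2 (f := fun=> 0)); [move=> w; rewrite big_ord0|exact: L2_cst].
  apply: (eq_L2 (f := fun w => \sum_(i < k) incr t i w + incr t k w)).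
    by move=> w; rewrite big_ord_recr.
  by apply: L2D; [exact/IH/ltnW|have [] := step k kn].
have [i ni|i ni|hL hN] := @orth_sum _ _ _ P n (incr t).
- by have [] := step i ni.
- have [_ _ _ h] := step i ni; exact: h _ (gs _ (ltnW ni)) (ls _ (ltnW ni)).
- split => //; rewrite hN mulr_sumr; apply: ler_sum => i _.
  by have [_ h _ _] := step i (ltn_ord i).
Qed.

Variable c : 'I_1 -> E -> R.
Let a := c ord0 e / 2.

(** Summation of [2 x (y - x) = y^2 - x^2 - (y - x)^2]. *)
Lemma left_sum_square (s : simple_process E Omega) w :
  transform (fun _ : 'I_1 => b) (sp_t s) (left_eta (fun _ : 'I_1 => b) (fun=> e) c s) (sp_n s) w =
  a * (b (sp_t s (sp_n s)) w ^+ 2 - b (sp_t s 0%N) w ^+ 2 -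
     \sum_(i < sp_n s) (b (sp_t s i.+1) w - b (sp_t s i) w) ^+ 2).
Proof.
rewrite /transform.
have <- : \sum_(i < sp_n s) (b (sp_t s i.+1) w ^+ 2 - b (sp_t s i) w ^+ 2) =
    b (sp_t s (sp_n s)) w ^+ 2 - b (sp_t s 0%N) w ^+ 2.
  by rewrite -(big_mkord xpredT (fun i => b (sp_t s i.+1) w ^+ 2 - b (sp_t s i) w ^+ 2)) telescope_sumr.
rewrite -sumrB mulr_sumr; apply: eq_bigr => i _.
by rewrite big_ord1 /left_eta /lin_integrand big_ord1 /a; field.
Qed.

(** The left-point sums converge to the integral, and by quadratic variation to
    the right-hand side.  If [a = 0] the partitions need not become fine, but
    then the sums vanish. *)
Lemma ito_square (I : Omega -> R) : is_ito P X (lin_integrand (fun _ : 'I_1 => b) c) I ->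
  {ae P, forall w, I w = a * (b 1 w ^+ 2 - 1)}.
Proof.
move=> /(ito_left_limit cp)[s [LI As hmesh hJ]].
have l01 : L2 P (fun w => b 1 w - b 0 w) by exact: (cp_L2 cp ord0 (lexx 0) ltr01 (lexx 1)).
have b0 := cp_start cp ord0.
have m1 : measurable_fun setT (b 1) by apply: (coord_meas cp ord0); rewrite lexx ler01.
have L1sq : L2 P (fun w => b 1 w ^+ 2).
  have [l4 _] := b4 (lexx 0) ltr01 (lexx 1).
  split; first exact: measurable_funX.
  apply: (@ae_eq_L1 _ _ _ P (fun w => ((b 1 w - b 0 w) ^+ 2) ^+ 2)); last exact: L2_sq.
    by apply: measurable_funX; exact: measurable_funX.
  by apply: filterS b0 => w ->; rewrite subr0.
pose G w := a * (b 1 w ^+ 2 - 1).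
have LG : L2 P G by apply: L2Z; apply: L2B => //; exact: L2_cst.
pose J k := transform (fun _ : 'I_1 => b) (sp_t (s k)) (left_eta (fun _ : 'I_1 => b) (fun=> e) c (s k)) (sp_n (s k)).
have CE : coefC (fun _ : 'I_1 => e) c = 4 * a ^+ 2.
  by rewrite /coefC /coef2 !big_ord1 /a; field.
have LJ k : L2 P (J k) by have [] := left_transform cp c (As k).
have JG k : nrm2 P (fun w => J k w - G w) <=
    16 * (coefC (fun _ : 'I_1 => e) c * \sum_(i < sp_n (s k)) (sp_t (s k) i.+1 - sp_t (s k) i) ^+ 2).
  have pt := adapted_partition (As k); have [p0 p1 _] := pt.
  have [ql qn] := quadratic_variation pt.
  have -> : nrm2 P (fun w => J k w - G w) =
     nrm2 P (fun w => - a * \sum_(i < sp_n (s k)) incr (sp_t (s k)) i w).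
    apply: ae_eq_Ex.
    - by apply: measurable_funX; exact: (L2_meas (L2B (LJ k) LG)).
    - by apply: measurable_funX; exact: (L2_meas (L2Z _ ql)).
    apply: filterS b0 => w w0; congr (_ ^+ 2); rewrite /J left_sum_square p0 p1 w0 /G /incr sumrB.
    have -> : \sum_(i < sp_n (s k)) (sp_t (s k) i.+1 - sp_t (s k) i) = 1.
      rewrite -(big_mkord xpredT (fun i => sp_t (s k) i.+1 - sp_t (s k) i)) telescope_sumr// p0 p1.
      by rewrite subr0.
    by ring.
  rewrite nrm2Z// sqrrN CE; apply: le_trans (ler_wpM2l (sqr_ge0 a) qn) _.
  by rewrite le_eqVlt; apply/orP; left; apply/eqP; ring.
have n0 : nrm2 P (fun w => I w - G w) = 0.
  apply: (@cvg_real_unique _ (fun=> nrm2 P (fun w => I w - G w))); first exact: cvg_cst.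
  apply: (@cvg0_le_ereal _ _ (fun k => (2 * nrm2 P (fun w => J k w - I w) + 2 *
     (16 * (coefC (fun _ : 'I_1 => e) c *
       \sum_(i < sp_n (s k)) (sp_t (s k) i.+1 - sp_t (s k) i) ^+ 2)))%:E)).
  - by move=> k; exact: nrm2_ge0.
  - move=> k; rewrite lee_fin.
    have h1 : nrm2 P (fun w => I w - G w) = nrm2 P (fun w => - 1 * (J k w - I w) + (J k w - G w)).
      by apply: eq_Ex => w; congr (_ ^+ 2); ring.
    rewrite h1; apply: le_trans (nrm2_triangle (L2Z _ (L2B (LJ k) LI)) (L2B (LJ k) LG)) _.
    rewrite nrm2Z; last exact: L2B.
    by rewrite sqrrN expr1n mul1r lerD2l ler_wpM2l.
  - apply: cvg_EFin; first by apply: nearW.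
    have : (fun k => 2 * nrm2 P (fun w => J k w - I w) + 2 *
     (16 * (coefC (fun _ : 'I_1 => e) c *
       \sum_(i < sp_n (s k)) (sp_t (s k) i.+1 - sp_t (s k) i) ^+ 2))) @ \oo --> (2 * 0 + 2 * (16 * 0) : R).
      apply: cvgD; first by apply: cvgMl_tmp.
      by apply: cvgMl_tmp; apply: cvgMl_tmp.
    by rewrite !mulr0 addr0; apply.
have := nrm2_eq0_ae (L2B LI LG) n0.
by apply: filterS => w /eqP; rewrite subr_eq0 => /eqP.
Qed.
End QuadraticVariation.

Section Processes.
Variables (R : realType) (E : innerProductType R).
Context d (Omega : measurableType d) (P : probability Omega R).

Lemma nth_ortho (s : seq E) (i j : 'I_(size s)) : ortho_seq s ->
  inner s`_i s`_j = (i == j)%:R.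
Proof.
move=> [us os]; rewrite (orthonormal_inner os) /= ?mem_nth//.
by rewrite nth_uniq.
Qed.

Lemma proj_seq_nth (s : seq E) x : proj_seq s x = \sum_(j < size s) inner s`_j x *: s`_j.
Proof. by rewrite /proj_seq (big_nth 0) big_mkord. Qed.

Lemma brownian_basis_process (X : R -> Omega -> E) (s : seq E) : is_brownian P X ->
  ortho_seq s -> (forall x, proj_seq s x = x) ->
  coord_process P X (fun (j : 'I_(size s)) t w => inner s`_j (X t w)) (fun j => s`_j).
Proof.
move=> bX os hs.
apply: (@brownian_coord_process _ _ _ _ _ _ X X bX _ _ _ id (fun j => inner s`_j)) => //.
- by move=> i j; exact: nth_ortho.
- by move=> x; rewrite -proj_seq_nth hs.
- by move=> x; exact: cvg_id.
- by move=> j; exact: inner_continuous.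
Qed.

Lemma brownian_line_process (b : R -> Omega -> R^o) (e : E) : is_brownian P b -> `|e| = 1 ->
  coord_process P (fun t w => (b t w : R) *: e) (fun _ : 'I_1 => b) (fun=> e).
Proof.
move=> bb ne.
have := @brownian_coord_process R R^o E _ _ P b (fun t w => (b t w : R) *: e) bb 1%N
  (fun=> 1) (fun=> e) (fun r => (r : R) *: e) (fun=> inner e).
have -> : (fun (j : 'I_1) t w => inner (1 : R^o) (b t w)) = (fun _ : 'I_1 => b).
  by apply/funext => j; apply/funext => t; apply/funext => w; rewrite /inner /= mul1r.
apply => //.
- by move=> i j; rewrite !ord1 eqxx /inner /= mul1r.
- by move=> x; rewrite big_ord1 /inner /= mul1r.
- by move=> x; apply: cvgZr_tmp; exact: cvg_id.
- by move=> _; exact: inner_continuous.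
- by move=> _ x; rewrite innerZr inner_normE ne expr1n mulr1 /inner /= mul1r.
Qed.

Lemma brownian_fourth (b : R -> Omega -> R^o) : is_brownian P b ->
  forall s t, 0 <= s -> s < t -> t <= 1 ->
  L2 P (fun w => ((b t w : R) - b s w) ^+ 2) /\
  nrm2 P (fun w => ((b t w : R) - b s w) ^+ 2) <= 64 * (t - s) ^+ 2.
Proof.
move=> bb s t s0 st t1.
have [|_ _ h1 h2] := increment_moments bb s0 st t1 (e := 1 : R^o); first by rewrite normr1.
have e w : (inner (1 : R^o) (b t w) - inner (1 : R^o) (b s w)) ^+ 2 = ((b t w : R) - b s w) ^+ 2.
  by rewrite /inner /= !mul1r.
split; first exact: eq_L2 e h1.
by apply: le_trans h2; rewrite le_eqVlt; apply/orP; left; apply/eqP; apply: eq_Ex => w; rewrite e.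
Qed.
End Processes.

(** * The calibrated gauges *)

Section Trace.
Variables (R : realType) (E : innerProductType R) (fE : @findim R E).
Implicit Types (x y z : E) (T : E -> E).

Lemma tens_linear x y : linear (tens x y).
Proof. by move=> a u v; rewrite /tens innerDr innerZr scalerDl scalerA. Qed.

Lemma tr_comp_tens T x y (sg : R) : linear T ->
  tr (fun z => T (tens x y z + sg *: tens y x z)) = inner y (T x) + sg * inner x (T y).
Proof.
move=> lT; have [s [us Cs os hs]] := onb_ortho_seq fE; rewrite (tr_seq fE _ os hs); last first.
  move=> a u v; rewrite !tens_linear -lT; congr (T _).
  by rewrite !scalerDr !scalerA [sg * a]mulrC; rewrite addrACA.
rewrite -[X in _ = inner X _ + _](hs y) -[X in _ = _ + _ * inner X _](hs x) !inner_proj_seq mulr_sumr -big_split; apply: eq_bigr => e _ /=.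
rewrite (linpD lT) !(linpZ lT) innerDr !innerZr (innerC y e) (innerC x e); ring.
Qed.

Lemma tr_comp_tens1 T x : linear T -> tr (T \o tens x x) = inner x (T x).
Proof.
move=> lT; rewrite -[RHS]addr0 -[X in _ + X](mul0r (inner x (T x))) -tr_comp_tens//.
by congr tr; apply/funext => z /=; rewrite scale0r addr0.
Qed.

Lemma tr_comp_sym T x y : linear T ->
  tr (T \o (tens x y + tens y x)) = inner y (T x) + inner x (T y).
Proof.
move=> lT; have := tr_comp_tens x y 1 lT; rewrite mul1r => <-.
by congr tr; apply/funext => z /=; rewrite scale1r.
Qed.

Lemma tr_comp_skew T x y : linear T ->
  tr (T \o (tens x y - tens y x)) = inner y (T x) - inner x (T y).
Proof.
move=> lT; have := tr_comp_tens x y (-1) lT; rewrite mulN1r => <-.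
by congr tr; apply/funext => z /=; rewrite scaleN1r.
Qed.

Lemma hs2_findim T s : ortho_seq s -> @onb R E = [set` s] ->
  hs2 (@onb R E) T = (\sum_(e <- s) `|T e| ^+ 2)%:E.
Proof. by move=> [us _] ->; rewrite /hs2 esum_seq// => e _; exact: sqr_ge0. Qed.
End Trace.

Section AreaGauge.
Variables (R : realType) (E : innerProductType R) (fE : @findim R E).

(** The integrand is [y |-> -2 <K B_t, y>], with coefficient functionals [-2 <K
    e_l, . >]; their squares sum to four times the squared Hilbert-Schmidt
    norm. *)
Lemma area_integral_moment (B : brownian E) (K : E -> E) : skew_adjoint K ->
  let I := ito (bm_prob B) B (fun t w y => tr (adj K \o (tens (B t w) y - tens y (B t w)))) in
  L2 (bm_prob B) I /\ ((nrm2 (bm_prob B) I)%:E = 2%:E * hs2 (@onb R E) K)%E.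
Proof.
move=> sK I; have lK := skew_linear sK.
have [s [us Cs os hs]] := onb_ortho_seq fE.
have cp := brownian_basis_process (bmP B) os hs.
pose W := (fun (j : 'I_(size s)) t w => inner s`_j (B t w)).
pose c := (fun (l : 'I_(size s)) (y : E) => - 2 * inner (K s`_l) y).
have PhiE : (fun t w y => tr (adj K \o (tens (B t w) y - tens y (B t w)))) = lin_integrand W c.
  apply/funext => t; apply/funext => w; apply/funext => y.
  rewrite (adj_skew sK) tr_comp_skew//; last first.
    by move=> a u v; rewrite lK opprD scalerN.
  rewrite !innerNr opprK (innerC y) -[inner (B t w) (K y)]opprK -(sK.2) /lin_integrand /c.
  have {1 2}-> : B t w = \sum_(j < size s) W j t w *: s`_j.
    by rewrite -[LHS]hs proj_seq_nth.
  rewrite (linp_sum lK) !inner_suml -sumrN -big_split; apply: eq_bigr => j _ /=.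
  by rewrite (linpZ lK) innerZl; ring.
have iI : is_ito (bm_prob B) B (lin_integrand W c) I.
  rewrite /I PhiE /ito; apply: xgetPex; apply: (ito_exists cp).
  by move=> l a x y; rewrite /c innerDr innerZr; ring.
have [LI nI] := ito_second_moment cp iI; split => //.
rewrite nI (hs2_findim _ os Cs) -EFinM; congr EFin.
rewrite /coefC /coef2 exchange_big /= mulr_suml (big_nth 0) big_mkord mulr_sumr.
apply: eq_bigr => l _; rewrite -[in RHS](hs (K s`_l)) norm_ortho_sum//.
rewrite (big_nth 0) big_mkord mulr_suml mulr_sumr; apply: eq_bigr => j _.
by rewrite /c (innerC (s`_j)); field.
Qed.

Lemma cA_hs_norm (B : brownian E) (K : E -> E) : skew_adjoint K -> cA B K = hs_norm K.
Proof.
move=> sK; rewrite /cA /hs_norm -/(hs2 (@onb R E) K); case: asboolP => [h0|_].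
  have -> : hs2 (@onb R E) K = 0%E.
    by apply: esum1 => e _; rewrite (h0 (K e)) normr0 expr0n.
  by rewrite poweR0r// invr_eq0.
have [LI nI] := area_integral_moment B sK; congr poweR.
set I := ito _ _ _ in LI nI *.
have e w : `|2^-1 * I w| ^+ 2 = 4^-1 * I w ^+ 2.
  by rewrite real_normK ?num_real// exprMn; congr (_ * _); field.
have l1 : L1 (bm_prob B) (fun w => `|2^-1 * I w| ^+ 2).
  by apply: eq_L1 (fsym e) _; apply: L1Z; exact: L2_sq.
rewrite (expectE l1) (eq_Ex _ e) ExZ; last exact: L2_sq.
rewrite -/(nrm2 _ I) EFinM nI !muleA -!EFinM (_ : 2 * 4^-1 * 2 = 1) ?mul1e//.
by field.
Qed.
End AreaGauge.

Section QuadraticGauge.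
Variables (R : realType) (E : innerProductType R) (fE : @findim R E).
Variable b : brownian R^o.
Variable S : E -> E.
Hypothesis sS : self_adjoint S.

(** The square of [b 1] in the endpoint term cancels the one in the integral. *)
Lemma quadratic_defect_ae (e : E) : `|e| = 1 ->
  measurable_fun setT (quadratic_defect (b := b) S e) /\
  {ae bm_prob b, forall w, quadratic_defect (b := b) S e w = inner e (S e)}.
Proof.
move=> ne; have lS := sa_linear sS.
have cp := brownian_line_process (bmP b) ne.
pose c := (fun (l : 'I_1) (y : E) => 2 * inner (S e) y).
have PhiE : (fun t w' y => tr (S \o (tens (line_process (b := b) e t w') y + tens y (line_process (b := b) e t w'))))
   = lin_integrand (fun _ : 'I_1 => (b : R -> bm_space b -> R)) c.
  apply/funext => t; apply/funext => w; apply/funext => y.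
  rewrite tr_comp_sym// -(sS.2 _ y) (innerC y) /lin_integrand big_ord1 /c /line_process (linpZ lS).
  by rewrite innerZl; ring.
pose I := ito (bm_prob b) (line_process (b := b) e) (fun t w' y =>
  tr (S \o (tens (line_process (b := b) e t w') y + tens y (line_process (b := b) e t w')))).
have iI : is_ito (bm_prob b) (line_process (b := b) e) (lin_integrand (fun _ : 'I_1 => (b : R -> bm_space b -> R)) c) I.
  rewrite /I PhiE /ito; apply: xgetPex; apply: (ito_exists cp).
  by move=> l a x y; rewrite /c innerDr innerZr; ring.
have m1 : measurable_fun setT (b 1 : bm_space b -> R).
  by apply: (coord_meas cp ord0); rewrite lexx ler01.
have dE : quadratic_defect (b := b) S e = fun w => (b 1 w : R) ^+ 2 * inner e (S e) - I w.
  apply/funext => w; rewrite /quadratic_defect -/I tr_comp_tens1// /line_process.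
  by rewrite (linpZ lS) innerZl innerZr mulrA expr2.
rewrite dE; split.
  apply: measurable_funB; last by case: iI.
  by apply: measurable_funM => //; exact: measurable_funX.
have := ito_square cp (brownian_fourth (bmP b)) iI.
by apply: filterS => w ->; rewrite /c (innerC (S e)); field.
Qed.

Lemma quadratic_defect_norm (e : E) : `|e| = 1 ->
  ('N[bm_prob b]_(2%:E)[EFin \o quadratic_defect (b := b) S e] = `|inner e (S e)|%:E)%E.
Proof.
move=> ne; have [md ae] := quadratic_defect_ae ne.
rewrite unlock /=.
have -> : (\int[bm_prob b]_x (`|(quadratic_defect (b := b) S e x)%:E| `^ 2) = (inner e (S e) ^+ 2)%:E)%E.
  transitivity (\int[bm_prob b]_x (quadratic_defect (b := b) S e x ^+ 2)%:E)%E.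
    apply: eq_integral => x _; rewrite abse_EFin poweR_EFin; congr EFin.
    by rewrite powR_mulrn// real_normK ?num_real.
  rewrite (ae_eq_integral (fun=> (inner e (S e) ^+ 2)%:E))//.
  - by rewrite (ExE (L1_cst _ _)) Ex_cst.
  - by apply/measurable_EFinP; exact: measurable_funX.
  - by apply: filterS ae => w -> .
rewrite poweR_EFin powR12_sqrt ?sqr_ge0// sqrtr_sqr//.
Qed.

(** Polarize <y, S x> for the unit vector [y] along [S x]. *)
Lemma quadratic_form_norm : ~ (forall x : E, x = 0) ->
  ereal_sup [set `|inner e (S e)|%:E | e in [set e : E | `|e| = 1]] = op_norm S.
Proof.
move=> nz; have lS := sa_linear sS; have [M0 M0p hM0] := sa_bound sS.
apply/eqP; rewrite eq_le; apply/andP; split.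
  apply: ge_ereal_sup => _ [e ne <-]; apply: (@le_trans _ _ `|S e|%:E).
    by rewrite lee_fin; apply: le_trans (cauchy_schwarz _ _) _; rewrite ne mul1r.
  by apply: ereal_sup_ubound; exists e => //=; rewrite ne.
set M := ereal_sup _.
have [e0 ne0] : exists e : E, `|e| = 1.
  have [x x0] : exists x : E, x <> 0 by apply/existsNP.
  exists (`|x|^-1 *: x); rewrite normrZ normfV normr_id mulVf// normr_eq0; exact/eqP.
have ge e : `|e| = 1 -> (`|inner e (S e)|%:E <= M)%E.
  by move=> ne; apply: ereal_sup_ubound; exists e.
have [m mE] : exists m, M = m%:E.
  exists (fine M); rewrite fineK// ge0_fin_numE; last exact: le_trans (ge _ ne0).
  apply: (@le_lt_trans _ _ M0%:E); last exact: ltry.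
  apply: ge_ereal_sup => _ [e ne <-]; rewrite lee_fin; apply: le_trans (cauchy_schwarz _ _) _.
  by rewrite ne mul1r; apply: le_trans (hM0 e) _; rewrite ne mulr1.
have m0 : 0 <= m by rewrite -lee_fin -mE; apply: le_trans (ge _ ne0); rewrite lee_fin.
have q x : `|inner x (S x)| <= m * `|x| ^+ 2.
  have [->|x0] := eqVneq x 0; first by rewrite inner0l normr0 mulr_ge0 ?sqr_ge0.
  have nx : 0 < `|x| by rewrite normr_gt0.
  have := ge (`|x|^-1 *: x); rewrite normrZ normfV normr_id mulVf ?gt_eqF// mE lee_fin => /(_ erefl).
  rewrite (linpZ lS) innerZl innerZr mulrA -expr2 normrM normrX normfV normr_id exprVn.
  by rewrite mulrC ler_pdivrMr ?exprn_gt0.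
rewrite mE; apply: ge_ereal_sup => _ [x /= nx <-]; rewrite lee_fin.
have [Sx0|Sx0] := eqVneq (S x) 0; first by rewrite Sx0 normr0.
have ns : 0 < `|S x| by rewrite normr_gt0.
pose y := `|S x|^-1 *: S x.
have ny : `|y| = 1 by rewrite normrZ normfV normr_id mulVf ?gt_eqF.
have ey : inner y (S x) = `|S x|.
  by rewrite innerZl inner_normE expr2 mulrA mulVf ?mul1r ?gt_eqF.
have pol : 4 * inner y (S x) = inner (x + y) (S (x + y)) - inner (x - y) (S (x - y)).
  rewrite (linpD lS) (linpB lS) !innerDl !innerBr !innerDr !innerNl -(sS.2 x y) (innerC (S x) y); ring.
have h1 := q (x + y); have h2 := q (x - y).
have par : `|x + y| ^+ 2 + `|x - y| ^+ 2 <= 4.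
  rewrite normD_sq normB_sq ny expr1n.
  have : `|x| ^+ 2 <= 1 by rewrite expr_le1.
  move: (`|x| ^+ 2) (inner x y) => p r h; lra.
have := ler_wpM2l m0 par; have := ler_normB (inner (x + y) (S (x + y))) (inner (x - y) (S (x - y))).
rewrite -pol ey normrM (ger0_norm (ltW ns)) (ger0_norm (_ : 0 <= 4))//.
move: h1 h2; move: (`|inner (x + y) _|) (`|inner (x - y) _|) (`|x + y| ^+ 2) (`|x - y| ^+ 2) (`|S x|).
move=> a1 a2 a3 a4 a5 h1 h2 h3 h4; lra.
Qed.

Lemma cQ_op_norm : cQ b S = op_norm S.
Proof.
rewrite /cQ; case: asboolP => [h0|nz].
  apply/esym/eqP; rewrite eq_le; apply/andP; split.
    by apply: ge_ereal_sup => _ [x _ <-]; rewrite (h0 (S x)) normr0.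
  by apply: ereal_sup_ubound; exists 0; rewrite /= ?(h0 (S 0)) normr0.
rewrite -quadratic_form_norm//; congr ereal_sup; apply/seteqP; split => _ [e ne <-]; exists e => //;
  by rewrite quadratic_defect_norm.
Qed.
End QuadraticGauge.

(** * Dual gauges *)

Section FiniteDimension.
Variables (R : realType) (E : innerProductType R) (fE : @findim R E).
Implicit Types (T K S a q : E -> E).
Let cE : @cauchy_complete R E := findim_complete fE.

Lemma hs_norm_sqrt (F : innerProductType R) (T : F -> F) (k : R) :
  hs2 (@onb R F) T = k%:E -> hs_norm T = (Num.sqrt k)%:E.
Proof.
move=> h; have k0 : 0 <= k by rewrite -lee_fin -h hs2_ge0.
by rewrite /hs_norm -/(hs2 _ _) h poweR_EFin powR12_sqrt.
Qed.

Lemma findim_hs2 T : exists2 k, 0 <= k & hs2 (@onb R E) T = k%:E.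
Proof.
have [s [us Cs os hs]] := onb_ortho_seq fE.
by rewrite (hs2_findim T os Cs); eexists; last reflexivity; apply: sumr_ge0 => e _; exact: sqr_ge0.
Qed.

Lemma findim_hs2_lty T : (hs2 (@onb R E) T < +oo)%E.
Proof. by have [k _ ->] := findim_hs2 T; exact: ltry. Qed.

Lemma skew_scale (F : innerProductType R) (T : F -> F) (c : R) :
  skew_adjoint T -> skew_adjoint (fun x => c *: T x).
Proof.
move=> /skewE sT; apply/skewE; have := signed_lincomb c sT (signed_0 F (-1)).
by congr signed_adjoint; apply/funext => x; rewrite addr0.
Qed.

(** Cauchy-Schwarz for the Hilbert-Schmidt pairing, with equality at [a] divided
    by its norm. *)
Lemma dualA_hs_norm (B : brownian E) a : skew_adjoint a -> dualA B a = hs_norm a.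
Proof.
move=> sa; have la := skew_linear sa.
have [s [us Cs os hs]] := onb_ortho_seq fE.
pose A := \sum_(e <- s) `|a e| ^+ 2; pose r := Num.sqrt A.
have A0 : 0 <= A by apply: sumr_ge0 => e _; exact: sqr_ge0.
have r0 : 0 <= r := sqrtr_ge0 A.
have rA : r ^+ 2 = A by rewrite sqr_sqrtr.
have nE : hs_norm a = r%:E by apply: hs_norm_sqrt; exact: hs2_findim.
have trE K : skew_adjoint K -> tr (adj K \o a) = \sum_(e <- s) inner (K e) (a e).
  move=> sK; have lK := skew_linear sK; rewrite (tr_seq fE _ os hs).
    by apply: eq_bigr => e _; rewrite /= (adj_skew sK) innerNr (sK.2).
  by move=> c x y /=; rewrite (adj_skew sK) la lK opprD scalerN.
apply/eqP; rewrite eq_le; apply/andP; split.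
  apply: ge_ereal_sup => _ [K [sK hK] <-]; rewrite nE lee_fin trE//.
  have kE := hs2_findim K os Cs; set k := \sum_(e <- s) _ in kE.
  have k0 : 0 <= k by apply: sumr_ge0 => e _; exact: sqr_ge0.
  have k1 : k <= 1.
    move: hK; rewrite (cA_hs_norm fE B sK) (hs_norm_sqrt kE) lee_fin.
    by rewrite -[X in _ <= X]sqrtr1 ler_sqrt.
  (* From 2 r <K e, a e> <= r^2 |K e|^2 + |a e|^2, where r^2 is the sum of the |a
     e|^2. *)
  have key (sg : R) : sg ^+ 2 = 1 -> sg * \sum_(e <- s) inner (K e) (a e) <= r.
    move=> sg1; have [rz|rn] := eqVneq r 0.
      rewrite big_seq big1 ?mulr0 ?rz// => e es; suff -> : a e = 0 by rewrite inner0r.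
      have /eqP := rA; rewrite rz expr0n eq_sym /= /A psumr_eq0; last by move=> e' _; exact: sqr_ge0.
      by move=> /allP/(_ _ es)/=; rewrite norm_sq0 => /eqP.
    have rp : 0 < r by rewrite lt_neqAle eq_sym rn.
    rewrite -(ler_pM2l rp) -expr2 rA.
    have : \sum_(e <- s) 2 * (r * sg * inner (K e) (a e)) <= \sum_(e <- s) (r ^+ 2 * `|K e| ^+ 2 + `|a e| ^+ 2).
      apply: ler_sum => e _; have := sqr_ge0 (`|(r * sg) *: K e - a e|).
      rewrite normB_sq innerZl normrZ exprMn real_normK ?num_real// exprMn sg1 mulr1.
      by move: (_ ^+ 2 * _) (inner _ _) => p q h; lra.
    rewrite -!mulr_sumr big_split /= -mulr_sumr -/k -/A rA.
    have : A * k <= A by rewrite ler_piMr.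
    by rewrite [r * (sg * _)]mulrA; move: (A * k) (r * sg * \sum_(e <- s) _) => p q; lra.
  rewrite ler_norml; apply/andP; split.
    by rewrite lerNl -mulN1r; apply: key; rewrite sqrrN expr1n.
  by rewrite -[leLHS]mul1r; apply: key; rewrite expr1n.
have sK := skew_scale r^-1 sa.
have kE := hs2_findim (fun x => r^-1 *: a x) os Cs.
rewrite nE; apply: (@le_trans _ _ `|tr (adj (fun x => r^-1 *: a x) \o a)|%:E).
  rewrite lee_fin trE//.
  under eq_bigr do rewrite innerZl inner_normE.
  rewrite -mulr_sumr -/A -rA expr2 mulrA; have [->|rn] := eqVneq r 0; first by rewrite mulr0.
  by rewrite mulVf// mul1r ler_norm.
apply: ereal_sup_ubound; exists (fun x => r^-1 *: a x) => //; split => //.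
rewrite (cA_hs_norm fE B sK) (hs_norm_sqrt kE) lee_fin -[leRHS]sqrtr1 ler_sqrt//.
under eq_bigr do rewrite normrZ exprMn.
rewrite -mulr_sumr -/A real_normK ?num_real// -rA -exprMn.
have [->|rn] := eqVneq r 0; first by rewrite mulr0 expr0n.
by rewrite mulVf// expr1n.
Qed.

(** In an eigenbasis of [q] the pairing is [\sum lam e <e, S e>], at most [\sum
    |lam e|] for contractions [S], with equality when [S] is diagonal with the
    signs of the eigenvalues. *)
Lemma dualQ_trace_norm (b : brownian R^o) q : self_adjoint q -> dualQ b q = trace_norm q.
Proof.
move=> sq; have lq := sa_linear sq.
have [B [lam [oB eB]]] := spectral_hs cE sq (findim_hs2_lty q).
have [t [ut Ct ht]] := onb_findim fE oB.
have ot : ortho_seq t by apply: (onb_seq oB) => //; rewrite Ct.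
have tB e : e \in t -> B e by rewrite Ct.
have tE : trace_norm q = (\sum_(e <- t) `|lam e|)%:E.
  rewrite (trace_norm_eig cE sq (findim_hs2_lty q) oB eB) Ct esum_seq//.
have trE S : self_adjoint S -> tr (S \o q) = \sum_(e <- t) lam e * inner e (S e).
  move=> sS; have lS := sa_linear sS; rewrite (tr_seq fE _ ot ht).
    by rewrite !big_seq; apply: eq_bigr => e et; rewrite /= (eB _ (tB _ et)) (linpZ lS) innerZr.
  by move=> c x y /=; rewrite lq lS.
apply/eqP; rewrite eq_le; apply/andP; split.
  apply: ge_ereal_sup => _ [S [sS hS] <-]; rewrite tE lee_fin trE//.
  apply: le_trans (ler_norm_sum _ _ _) _; rewrite !big_seq; apply: ler_sum => e et.
  rewrite normrM ler_piMr//; rewrite (cQ_op_norm fE b sS) in hS.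
  have ne : `|e| = 1 := on_norm (onb_orthonormal oB) (tB _ et).
  apply: le_trans (cauchy_schwarz _ _) _; rewrite ne mul1r -lee_fin; apply: le_trans hS.
  by apply: ereal_sup_ubound; exists e => //=; rewrite ne.
have sg1 e : B e -> `|Num.sg (lam e)| <= 1.
  by move=> _; rewrite normr_sg lern1 leq_b1.
have [S [sS SE SI]] := diagonal_exists cE oB sg1.
apply: (@le_trans _ _ `|tr (S \o q)|%:E).
  rewrite tE lee_fin trE//; apply: le_trans (ler_norm _).
  rewrite !big_seq; apply: ler_sum => e et; rewrite (SE _ (tB _ et)) innerZr inner_normE.
  by rewrite (on_norm (onb_orthonormal oB) (tB _ et)) expr1n mulr1 normrEsg mulrC.
apply: ereal_sup_ubound; exists S => //; split => //; rewrite (cQ_op_norm fE b sS).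
apply: ge_ereal_sup => _ [x /= nx <-]; rewrite lee_fin; apply: le_trans nx.
rewrite -(@ler_pXn2r _ 2)// ?nnegrE// -[in leLHS](ht (S x)) -[in leRHS](ht x) !norm_ortho_sum//.
rewrite !big_seq; apply: ler_sum => e et; rewrite (SI _ _ (tB _ et)) exprMn ler_piMl ?sqr_ge0//.
by rewrite -(real_normK (num_real (Num.sg _))) expr_le1// sg1//; exact: tB.
Qed.
End FiniteDimension.

(** * Restriction to a supporting subspace *)

Section Restriction.
Variables (R : realType) (H : innerProductType R) (cH : @cauchy_complete R H).
Variables (E : lsubspace H) (fE : @findim R E).
Variables (T : H -> H) (supT : supported_on E T).
Notation sval := (@subspace_val R H E).

Lemma val_restr (x : E) : sval (restr T x) = T (sval x).
Proof. exact: (insubdK (0 : E) (supT.1 _)). Qed.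

Lemma restr_signed sg : signed_adjoint sg T -> signed_adjoint sg (restr (E := E) T).
Proof.
move=> sT; have [[lT _] aT] := sT.
have lr : linear (restr (E := E) T).
  by move=> c x y; apply: val_inj; rewrite /= val_restr lT -!val_restr.
split; first by split => //; exact: findim_linear_continuous.
by move=> x y; rewrite /inner /= !val_restr aT.
Qed.
Lemma restr_sa : self_adjoint T -> self_adjoint (restr (E := E) T).
Proof. by move=> /saE sT; apply/saE; exact: restr_signed. Qed.
Lemma restr_skew : skew_adjoint T -> skew_adjoint (restr (E := E) T).
Proof. by move=> /skewE sT; apply/skewE; exact: restr_signed. Qed.

Lemma subspace_val_inj : injective sval.
Proof. exact: val_inj. Qed.

(** A basis of [E] completed to one of [H] sees an operator supported on [E] only
    through [E]. *)
Lemma onb_of_subspace (B : set E) : is_onb B ->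
  exists2 C : set H, is_onb C & sval @` B `<=` C /\
    forall e, C e -> ~ (sval @` B) e -> T e = 0.
Proof.
move=> oB; have [nB iB tB] := oB.
have oV : orthonormal (sval @` B).
  split; first by move=> _ [e Be <-]; exact: nB.
  move=> _ _ [e Be <-] [f Bf <-] ef; apply: iB => // ef'; by apply: ef; rewrite ef'.
have [C VC oC] := onb_extend oV; exists C => //; split => // e Ce nVe.
apply: supT.2 => y.
have [s [us Bs hs]] := onb_findim fE oB.
have os : ortho_seq s by apply: (onb_seq oB) => //; rewrite Bs.
rewrite -(hs y).
have -> : sval (proj_seq s y) = \sum_(f <- s) inner f y *: sval f.
  by rewrite /proj_seq; elim/big_rec2: _ => // f u v _ <-.
rewrite inner_suml big_seq big1// => f fs; rewrite innerZl.
have Vf : (sval @` B) (sval f) by exists f => //; rewrite Bs.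
rewrite (on_ortho (onb_orthonormal oC)) ?mulr0//; first exact: VC.
by move=> fe; apply: nVe; rewrite -fe.
Qed.

Lemma esum_subspace (B : set E) (g : H -> R) :
  (\esum_(e in B) (g (sval e))%:E = \esum_(e in sval @` B) (g e)%:E)%E.
Proof.
rewrite (reindex_esum B (sval @` B) sval)//.
split; first by move=> e Be; exists e.
- by move=> e f _ _; exact: subspace_val_inj.
- by move=> _ [e Be <-]; exists e.
Qed.

Lemma hs2_restr : sym_or_skew T -> hs2 (@onb R E) (restr (E := E) T) = hs2 (@onb R H) T.
Proof.
move=> hT; have [C oC [VC zC]] := onb_of_subspace (onbP E).
rewrite (hs2_onb cH hT (onbP H) oC) /hs2 -(esum_supp_eq VC).
- rewrite -esum_subspace; apply: eq_esum => e _; by rewrite -val_restr.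
- by move=> e _; rewrite lee_fin sqr_ge0.
- by move=> e Ce nV; rewrite zC// normr0 expr0n.
Qed.

Lemma hs_norm_restr : sym_or_skew T -> hs_norm (restr (E := E) T) = hs_norm T.
Proof. by move=> hT; rewrite /hs_norm; congr poweR; exact: hs2_restr. Qed.

Lemma supported_hs2_lty : sym_or_skew T -> (hs2 (@onb R H) T < +oo)%E.
Proof. by move=> hT; rewrite -hs2_restr//; exact: findim_hs2_lty. Qed.

Lemma trace_norm_restr : self_adjoint T -> trace_norm (restr (E := E) T) = trace_norm T.
Proof.
move=> sT; have sr := restr_sa sT; have hr := findim_hs2_lty fE (restr (E := E) T).
have hT := supported_hs2_lty (sa_sos sT).
have [B [lam [oB eB]]] := spectral_hs (findim_complete fE) sr hr.
have eB' e : B e -> restr T e = inner e (restr T e) *: e.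
  move=> Be; rewrite eB// innerZr inner_normE (on_norm (onb_orthonormal oB) Be).
  by rewrite expr1n mulr1.
have [C oC [VC zC]] := onb_of_subspace oB.
have eC e : C e -> T e = inner e (T e) *: e.
  move=> Ce; have [[f Bf <-]|nV] := pselect ((sval @` B) e); last first.
    by rewrite zC// inner0r scale0r.
  by rewrite -val_restr {1}(eB' f Bf).
rewrite (trace_norm_eig (findim_complete fE) sr hr oB eB') (trace_norm_eig cH sT hT oC eC).
rewrite -(esum_supp_eq VC).
- rewrite -(esum_subspace B (fun e => `|inner e (T e)|)).
  by apply: eq_esum => e _; rewrite -val_restr.
- by move=> e _; rewrite lee_fin.
- by move=> e Ce nV; rewrite zC// inner0r normr0.
Qed.
End Restriction.

(** * Finite rank operators *)

Section FiniteRank.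
Variables (R : realType) (H : innerProductType R).
Implicit Types (T S : H -> H) (s : seq H).

Lemma finite_rank_lincomb a T S : finite_rank T -> finite_rank S ->
  finite_rank (fun x => a *: T x + S x).
Proof.
move=> [n [e he]] [m [f hf]].
exists (n + m)%N, (fun i => match fintype.split i with inl j => e j | inr j => f j end) => x.
have [c ->] := he x; have [d ->] := hf x.
exists (fun i => match fintype.split i with inl j => a * c j | inr j => d j end).
rewrite big_split_ord /= scaler_sumr; congr (_ + _); apply: eq_bigr => i _.
  by rewrite (unsplitK (inl _ i)) scalerA.
by rewrite (unsplitK (inr _ i)).
Qed.

Lemma finite_rank_0 : finite_rank (fun=> 0 : H).
Proof. by exists 0%N, (fun=> 0) => x; exists (fun=> 0); rewrite big_ord0. Qed.

Lemma finite_rank_seq s T (c : H -> H -> R) :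
  (forall x, T x = \sum_(e <- s) c e x *: e) -> finite_rank T.
Proof.
move=> h; exists (size s), (fun i : 'I_(size s) => s`_i) => x.
by exists (fun i : 'I_(size s) => c s`_i x); rewrite h (big_nth 0) big_mkord.
Qed.
End FiniteRank.

(** * Completions *)

Section Completion.
Variable R : realType.

Lemma is_completion_gauge (V : lmodType R) (D : set V) (g g' : V -> \bar R) X N :
  (forall x, D x -> g x = g' x) -> is_completion D g X N -> is_completion D g' X N.
Proof. by move=> gg [a b [DX h] d e]; split => //; split => // x Dx; rewrite h// gg. Qed.

(** Triangle inequality for [x] and [- x]. *)
Lemma completion_ge0 (V : lmodType R) (D : set V) g X (N : V -> \bar R) x :
  is_completion D g X N -> X x -> (0 <= N x)%E.
Proof.
move=> [[_ _ X0 XP] [Nf ND NZ _] _ _ _] Xx.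
have XN : X (- x) by rewrite -scaleN1r -[_ *: _]addr0; exact: XP.
have := ND _ _ Xx XN; have := NZ 0 x Xx; have := NZ (-1) x Xx.
rewrite normrN normr1 mul1e scaleN1r => ->; rewrite scale0r normr0 mul0e subrr => ->.
have := Nf x Xx; case: (N x) => // r _; rewrite -EFinD !lee_fin => h; lra.
Qed.

(** Lets the three factors of the response space be completed separately. *)
Lemma is_completion_prod (V1 V2 : lmodType R) (D1 : set V1) (D2 : set V2) g1 g2 X1 X2
    (N1 : V1 -> \bar R) (N2 : V2 -> \bar R) :
  is_completion D1 g1 X1 N1 -> is_completion D2 g2 X2 N2 ->
  is_completion [set x : (V1 * V2)%type | D1 x.1 /\ D2 x.2]
    (fun x => maxe (g1 x.1) (g2 x.2)) [set x : (V1 * V2)%type | X1 x.1 /\ X2 x.2]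
    (fun x => maxe (N1 x.1) (N2 x.2)).
Proof.
move=> c1 c2; have ge1 x := completion_ge0 c1 (x := x); have ge2 x := completion_ge0 c2 (x := x).
case: c1 => -[D10 D1P X10 X1P] [f1 T1 Z1 z1] [DX1 G1] A1 C1.
case: c2 => -[D20 D2P X20 X2P] [f2 T2 Z2 z2] [DX2 G2] A2 C2.
have le1 a b : (a <= maxe a b :> \bar R)%E by rewrite le_max lexx.
have le2 a b : (b <= maxe a b :> \bar R)%E by rewrite le_max lexx orbT.
have XB1 x y : X1 x -> X1 y -> X1 (x - y).
  by move=> hx hy; rewrite addrC -scaleN1r; exact: X1P.
have XB2 x y : X2 x -> X2 y -> X2 (x - y).
  by move=> hx hy; rewrite addrC -scaleN1r; exact: X2P.
split.
- split => //.
  + by move=> a x y [x1 x2] [y1 y2]; split; [exact: D1P|exact: D2P].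
  + by move=> a x y [x1 x2] [y1 y2]; split; [exact: X1P|exact: X2P].
- split.
  + move=> x [x1 x2]; have := f1 _ x1; have := f2 _ x2.
    by case: (N1 x.1) (N2 x.2) => // r [] // q _ _; rewrite -EFin_max.
  + move=> x y [x1 x2] [y1 y2]; rewrite ge_max; apply/andP; split.
      by apply: le_trans (T1 _ _ x1 y1) _; exact: leeD.
    by apply: le_trans (T2 _ _ x2 y2) _; exact: leeD.
  + move=> a x [x1 x2]; rewrite (Z1 _ _ x1) (Z2 _ _ x2) maxe_pMr//.
  + move=> x [x1 x2] h; have /eqP := h; rewrite eq_le ge_max => /andP[/andP[h1 h2] _].
    case: x x1 x2 {h} h1 h2 => x y /= x1 x2 h1 h2; congr (_, _).
      by apply: z1 => //; apply/eqP; rewrite eq_le h1 ge1.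
    by apply: z2 => //; apply/eqP; rewrite eq_le h2 ge2.
- split; first by move=> x [x1 x2]; split; [exact: DX1|exact: DX2].
  by move=> x [x1 x2]; rewrite G1// G2.
- move=> x eps [x1 x2] e0; have [y1 Dy1 h1] := A1 _ _ x1 e0; have [y2 Dy2 h2] := A2 _ _ x2 e0.
  by exists (y1, y2) => //; rewrite gt_max h1 h2.
- move=> u Xu cu.
  have [|e e0|a Xa ha] := C1 (fun n => (u n).1); first by move=> n; case: (Xu n).
    have [n0 hn] := cu _ e0; exists n0 => m n mn nn; apply: le_lt_trans (hn m n mn nn); exact: le1.
  have [|e e0|b Xb hb] := C2 (fun n => (u n).2); first by move=> n; case: (Xu n).
    have [n0 hn] := cu _ e0; exists n0 => m n mn nn; apply: le_lt_trans (hn m n mn nn); exact: le2.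
  exists (a, b) => //.
  apply: (squeeze_cvge (f := fun=> 0%E) (h := fun n => (N1 ((u n).1 - a)%R + N2 ((u n).2 - b)%R)%E)).
  + apply: nearW => n; have [h1 h2] := Xu n.
    have p1 := ge1 _ (XB1 _ _ h1 Xa); have p2 := ge2 _ (XB2 _ _ h2 Xb).
    by rewrite le_max p1 /= ge_max leeDl// leeDr.
  + exact: cvg_cst.
  + by have := cvgeD _ ha hb; rewrite adde0; apply.
Qed.

Lemma is_completion_self (V : normedModType R) :
  (forall u : nat -> V, (forall eps : R, 0 < eps -> exists N, forall m n,
     (N <= m)%N -> (N <= n)%N -> `|u m - u n| < eps) -> exists l : V, u @ \oo --> l) ->
  is_completion [set: V] (fun x => `|x|%:E) [set: V] (fun x => `|x|%:E).
Proof.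
move=> cV; split => //.
- split => //.
  + by move=> x y _ _; rewrite lee_fin ler_normD.
  + by move=> a x _; rewrite normrZ.
  + by move=> x _ [] /normr0_eq0.
- by move=> x e _ e0; exists x => //; rewrite subrr normr0 lte_fin.
- move=> u _ cu; have [|l hl] := cV u.
    by move=> e e0; have [N hN] := cu e e0; exists N => m n hm hn; have := hN m n hm hn.
  exists l => //; apply: cvg_EFin; first exact: nearW.
  rewrite -[X in _ --> X](normr0 V) -[X in `|X|](subrr l).
  by apply: cvg_norm; apply: cvgB => //; exact: cvg_cst.
Qed.
End Completion.

(** * The Hilbert-Schmidt norm *)

Section HSNorm.
Variables (R : realType) (H : innerProductType R) (cH : @cauchy_complete R H).
Implicit Types (T K S : H -> H) (s : seq H).
Notation C := (@onb R H).
Let oC : is_onb C := onbP H.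

Lemma hs2_seq (T : H -> H) s : uniq s -> [set` s] `<=` C ->
  ((\sum_(e <- s) `|T e| ^+ 2)%:E <= hs2 C T)%E.
Proof. exact: seq_le_esum. Qed.

Lemma hs_normE T : (hs2 C T < +oo)%E -> exists k, [/\ 0 <= k, hs2 C T = k%:E & hs_norm T = (Num.sqrt k)%:E].
Proof.
move=> h; have hk : hs2 C T = (fine (hs2 C T))%:E by rewrite fineK// ge0_fin_numE// hs2_ge0.
exists (fine (hs2 C T)); split => //; last exact: hs_norm_sqrt.
by apply: fine_ge0; exact: hs2_ge0.
Qed.

Lemma hs_norm_lty T : (hs_norm T < +oo)%E <-> (hs2 C T < +oo)%E.
Proof.
split; last by move=> /hs_normE[k [_ _ ->]]; exact: ltry.
rewrite /hs_norm -/(hs2 C T); have := hs2_ge0 C T; case: (hs2 C T) => //.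
  by move=> r _ _; exact: ltry.
by rewrite poweRyr ?ltxx// invr_eq0.
Qed.

Lemma hs_norm_le T r : 0 <= r -> (hs_norm T <= r%:E)%E <-> (hs2 C T <= (r ^+ 2)%:E)%E.
Proof.
move=> r0; split => h.
  have /hs_norm_lty/hs_normE[k [k0 e1 e2]] : (hs_norm T < +oo)%E by apply: le_lt_trans h (ltry _).
  move: h; rewrite e1 e2 !lee_fin => h.
  by rewrite -(sqr_sqrtr k0) ler_pXn2r ?nnegrE ?sqrtr_ge0.
have /hs_normE[k [k0 e1 e2]] : (hs2 C T < +oo)%E by apply: le_lt_trans h (ltry _).
move: h; rewrite e1 e2 !lee_fin => h.
by rewrite -[leRHS]ger0_norm// -sqrtr_sqr ler_wsqrtr.
Qed.

Lemma hs2_le_sq T (r : R) : (forall s, uniq s -> [set` s] `<=` C ->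
   \sum_(e <- s) `|T e| ^+ 2 <= r) -> (hs2 C T <= r%:E)%E.
Proof. by move=> h; apply: esum_le_seq => s us sC; rewrite lee_fin; exact: h. Qed.

Lemma sum_cauchy_schwarz (T : Type) (s : seq T) (a b : T -> R) :
  (\sum_(e <- s) a e * b e) ^+ 2 <= (\sum_(e <- s) a e ^+ 2) * (\sum_(e <- s) b e ^+ 2).
Proof.
apply: discriminant_le => [||t]; try by apply: sumr_ge0 => e _; exact: sqr_ge0.
have : 0 <= \sum_(e <- s) (a e + t * b e) ^+ 2 by apply: sumr_ge0 => e _; exact: sqr_ge0.
congr (0 <= _); rewrite !mulr_sumr -!big_split; apply: eq_bigr => e _ /=; ring.
Qed.

Lemma hs_norm_ge0 T : (0 <= hs_norm T)%E.
Proof. exact: poweR_ge0. Qed.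

(** Minkowski's inequality, on finite parts of the sum. *)
Lemma hs_normD T S : (hs_norm (fun x => (T x + S x)%R) <= hs_norm T + hs_norm S)%E.
Proof.
have [|] := ltP (hs_norm T) +oo%E; last first.
  by rewrite leye_eq => /eqP ->; rewrite addye ?leey// gt_eqF// (lt_le_trans _ (hs_norm_ge0 S))// ltNyr.
have [|] := ltP (hs_norm S) +oo%E; last first.
  by rewrite leye_eq => /eqP ->; rewrite addey ?leey// gt_eqF// (lt_le_trans _ (hs_norm_ge0 T))// ltNyr.
move=> /hs_norm_lty/hs_normE[l [l0 El ->]] /hs_norm_lty/hs_normE[k [k0 Ek ->]].
rewrite -EFinD; apply/hs_norm_le; first by rewrite addr_ge0 ?sqrtr_ge0.
set p := Num.sqrt k; set q := Num.sqrt l.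
have pk : p ^+ 2 = k := sqr_sqrtr k0.
have ql : q ^+ 2 = l := sqr_sqrtr l0.
have p0 : 0 <= p := sqrtr_ge0 k.
have q0 : 0 <= q := sqrtr_ge0 l.
apply: hs2_le_sq => s us sC.
have := sum_cauchy_schwarz s (fun e => `|T e|) (fun e => `|S e|).
set A := \sum_(e <- s) `|T e| ^+ 2; set B := \sum_(e <- s) `|S e| ^+ 2; set m := \sum_(e <- s) _ => cs.
have hk : A <= p ^+ 2 by rewrite pk -lee_fin -Ek; exact: hs2_seq.
have hl : B <= q ^+ 2 by rewrite ql -lee_fin -El; exact: hs2_seq.
have B0 : 0 <= B by apply: sumr_ge0 => e _; exact: sqr_ge0.
have A0 : 0 <= A by apply: sumr_ge0 => e _; exact: sqr_ge0.
have m0 : 0 <= m by apply: sumr_ge0 => e _; rewrite mulr_ge0.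
have hm : m <= p * q.
  rewrite -(@ler_pXn2r _ 2)// ?nnegrE ?mulr_ge0// exprMn; apply: le_trans cs _.
  exact: ler_pM.
apply: (@le_trans _ _ (A + 2 * m + B)).
  rewrite /A /B /m mulr_sumr -!big_split; apply: ler_sum => e _ /=.
  by rewrite normD_sq lerD2r lerD2l ler_wpM2l// inner_le.
by rewrite sqrrD -mulr_natl; move: hk hl hm; move: (p ^+ 2) (q ^+ 2) (p * q) => x y z; lra.
Qed.

Lemma hs_normZ a T : hs_norm (fun x => a *: T x) = (`|a|%:E * hs_norm T)%E.
Proof.
rewrite /hs_norm.
have -> : (\esum_(e in C) (`|a *: T e| ^+ 2)%:E = (`|a| ^+ 2)%:E * hs2 C T)%E.
  rewrite -esumZl ?sqr_ge0//.
  by apply: eq_esum => e _; rewrite normrZ exprMn.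
rewrite poweRM ?lee_fin ?sqr_ge0//; last exact: hs2_ge0.
by rewrite poweR_EFin powR12_sqrt ?sqr_ge0// sqrtr_sqr normr_id.
Qed.

Lemma hs_norm_eq0 T : linear T -> sym_or_skew T -> hs_norm T = 0%E -> T = fun=> 0.
Proof.
move=> lT hT h; have h0 : hs2 C T = 0%E by apply: poweR_eq0_eq0 h; exact: hs2_ge0.
apply/funext => x; have := hs2_norm_le cH x lT hT oC; rewrite h0 mule0 lee_fin => h1.
by apply/eqP; rewrite -norm_sq0 eq_le h1 sqr_ge0.
Qed.
End HSNorm.

Lemma norm_limit_le (R : realType) (V : normedModType R) (f : nat -> V) l r n0 :
  f @ \oo --> l -> (forall n, (n0 <= n)%N -> `|f n| <= r) -> `|l| <= r.
Proof.
move=> /cvgrPdist_lt fl hf; rewrite leNgt; apply/negP => lr.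
have [|N _ hN] := fl (`|l| - r); first by rewrite subr_gt0.
have h1 := hN (maxn N n0) (leq_maxl _ _); have h2 := hf (maxn N n0) (leq_maxr _ _).
have := ler_normD (l - f (maxn N n0)) (f (maxn N n0)); rewrite subrK.
by move: h1 h2 => /=; move: `|l - _| `|f _| `|l| => x y z; lra.
Qed.

Section HSLimit.
Variables (R : realType) (H : innerProductType R) (cH : @cauchy_complete R H).
Notation C := (@onb R H).
Let oC : is_onb C := onbP H.
Variables (sg : R) (u : nat -> H -> H).
Hypothesis sg1 : `|sg| = 1.
Hypothesis su : forall n, signed_adjoint sg (u n).
Hypothesis cu : forall eps : R, 0 < eps -> exists n0, forall m n,
  (n0 <= m)%N -> (n0 <= n)%N -> (hs_norm (u m - u n)%R < eps%:E)%E.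

Let diff_signed m n : signed_adjoint sg (u m - u n).
Proof.
have := signed_lincomb (-1) (su n) (su m); congr signed_adjoint.
by apply/funext => x /=; rewrite scaleN1r addrC.
Qed.

Let diff_bound eps m n x : 0 <= eps -> (hs_norm (u m - u n)%R <= eps%:E)%E ->
  `|u m x - u n x| <= eps * `|x|.
Proof.
move=> e0 /(hs_norm_le _ e0) h; have [[l _] _] := diff_signed m n.
rewrite -(@ler_pXn2r _ 2)// ?nnegrE ?mulr_ge0// exprMn mulrC.
rewrite -lee_fin; apply: (@le_trans _ _ ((`|x| ^+ 2)%:E * hs2 C (u m - u n)%R)%E); last first.
  by rewrite (EFinM (`|x| ^+ 2)) lee_wpmul2l// lee_fin sqr_ge0.
exact: (hs2_norm_le cH x l (signed_sos sg1 (diff_signed m n)) oC).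
Qed.

(** A Cauchy sequence for the Hilbert-Schmidt norm converges pointwise, and the
    norm is lower semicontinuous for pointwise convergence since its finite
    parts are continuous. *)
Lemma hs_limit : exists T, [/\ signed_adjoint sg T, forall x, u n x @[n --> \oo] --> T x,
  forall eps, 0 < eps -> exists n0, forall n, (n0 <= n)%N -> (hs_norm (u n - T)%R <= eps%:E)%E &
  forall n, signed_adjoint sg (u n - T)].
Proof.
have /choice[T hT] : forall x, exists l : H, u n x @[n --> \oo] --> l.
  move=> x; apply: cH => e e0; have xp : 0 < `|x| + 1 by rewrite ltr_wpDl.
  have [N hN] := cu (divr_gt0 e0 xp); exists N => m n hm hn.
  apply: le_lt_trans (diff_bound x _ (ltW (hN m n hm hn))) _; first by rewrite ltW ?divr_gt0.
  by rewrite mulrAC ltr_pdivrMr// ltr_pM2l// ltrDl.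
have lT : linear T.
  move=> a x y; have h1 : u n (a *: x + y) @[n --> \oo] --> a *: T x + T y.
    under eq_fun do rewrite (su _).1.1.
    by apply: cvgD; [apply: cvgZl_tmp; exact: hT|exact: hT].
  by rewrite -(cvg_lim (@norm_hausdorff _ _) h1) (cvg_lim (@norm_hausdorff _ _) (hT _)).
have aT x y : inner (T x) y = sg * inner x (T y).
  have h1 := cvg_innerl (y := y) (hT x); have h2 := cvg_innerl (y := x) (hT y).
  rewrite innerC; apply: (cvg_real_unique h1).
  have -> : (fun n => inner y (u n x)) = (fun n => sg * inner x (u n y)).
    by apply/funext => n; rewrite innerC (su n).2.
  exact: cvgMl_tmp h2.
have dT eps : 0 < eps -> exists n0, forall n, (n0 <= n)%N ->
   (hs_norm (u n - T)%R <= eps%:E)%E /\ forall x, `|u n x - T x| <= eps * `|x|.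
  move=> e0; have [n0 hn0] := cu e0; exists n0 => n hn; split.
    apply/hs_norm_le; first exact: ltW.
    apply: hs2_le_sq => s us sC.
    have hc : \sum_(e <- s) `|u n e - u m e| ^+ 2 @[m --> \oo] --> \sum_(e <- s) `|u n e - T e| ^+ 2.
      elim: (s) => [|e t IH]; first by under eq_fun do rewrite big_nil; rewrite big_nil; exact: cvg_cst.
      under eq_fun do rewrite big_cons; rewrite big_cons; apply: cvgD => //.
      by apply: cvg_norm_sq; apply: cvgB => //; exact: cvg_cst.
    apply: le_trans (ler_norm _) _; apply: (norm_limit_le (n0 := n0) hc) => m hm.
    rewrite ger0_norm; last by apply: sumr_ge0 => e _; exact: sqr_ge0.
    rewrite -lee_fin; apply: le_trans (hs2_seq (u n - u m) us sC) _.
    by apply/hs_norm_le; [exact: ltW|exact: ltW (hn0 n m hn hm)].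
  move=> x; have hc : u n x - u m x @[m --> \oo] --> u n x - T x.
    by apply: cvgB => //; exact: cvg_cst.
  apply: (norm_limit_le (n0 := n0) hc) => m hm.
  by apply: diff_bound; [exact: ltW|exact: ltW (hn0 n m hn hm)].
have sT : signed_adjoint sg T.
  split => //; split => //; have [n0 hn0] := dT 1 ltr01; have [_ hb] := hn0 n0 (leqnn _).
  have [M M0 hM] := signed_bound (su n0).
  apply: (@linp_bound_continuous _ _ _ _ lT (M + 1)) => x.
  have -> : T x = u n0 x - (u n0 x - T x) by rewrite opprB addrC subrK.
  by apply: le_trans (ler_normB _ _) _; rewrite mulrDl lerD.
exists T; split => //.
  by move=> eps /dT[n0 h]; exists n0 => n /h[].
move=> n; have := signed_lincomb (-1) sT (su n); congr signed_adjoint.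
by apply/funext => x /=; rewrite scaleN1r addrC.
Qed.
End HSLimit.

(** * Approximation by finite rank operators *)

Section Projection.
Variables (R : realType) (H : innerProductType R).
Variables (s : seq H) (os : ortho_seq s).
Notation P := (proj_seq s).
Implicit Types x y : H.

Lemma proj_seq_linear : linear P.
Proof. by move=> a x y; rewrite proj_seqD proj_seqZ. Qed.
Lemma proj_seq_sym x y : inner (P x) y = inner x (P y).
Proof.
rewrite inner_proj_seq innerC inner_proj_seq; apply: eq_bigr => e _; exact: mulrC.
Qed.
Lemma proj_seq_norm2 x : `|P x| ^+ 2 = \sum_(e <- s) inner e x ^+ 2.
Proof. exact: norm_ortho_sum. Qed.
Lemma proj_seq_contract x : `|P x| <= `|x|.
Proof. by rewrite -(@ler_pXn2r _ 2)// ?nnegrE// proj_seq_norm2 bessel. Qed.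
Lemma proj_seq_in e : e \in s -> P e = e.
Proof.
move=> es; rewrite /proj_seq -[RHS]scale1r (bigD1_seq e)//=; last by case: os.
rewrite (orthonormal_inner os.2)// eqxx big_seq_cond big1 ?addr0// => f /andP[fs fe].
by rewrite (orthonormal_inner os.2)// (negPf fe) scale0r.
Qed.
Lemma proj_seq_out (C : set H) e : orthonormal C -> [set` s] `<=` C -> C e -> e \notin s -> P e = 0.
Proof.
move=> oC sC Ce nes; rewrite /proj_seq big_seq big1// => f fs.
rewrite (on_ortho oC) ?scale0r//; first exact: sC.
by move=> fe; move: nes; rewrite -fe fs.
Qed.
End Projection.

Section Compression.
Variables (R : realType) (H : innerProductType R) (cH : @cauchy_complete R H).
Implicit Types (T K S : H -> H) (s : seq H).
Notation C := (@onb R H).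
Let oC : is_onb C := onbP H.
Variable sg : R.
Hypothesis sg1 : `|sg| = 1.
Let sg2 : sg ^+ 2 = 1.
Proof. by rewrite -(real_normK (num_real sg)) sg1 expr1n. Qed.

Lemma compression_signed s K : ortho_seq s -> signed_adjoint sg K ->
  signed_adjoint sg (fun x => proj_seq s (K (proj_seq s x))).
Proof.
move=> os sK; have [M M0 hM] := signed_bound sK; have [[lK _] aK] := sK.
have l : linear (fun x => proj_seq s (K (proj_seq s x))).
  by move=> a x y; rewrite proj_seq_linear lK proj_seq_linear.
split; last by move=> x y; rewrite proj_seq_sym aK proj_seq_sym.
split => //; apply: (@linp_bound_continuous _ _ _ _ l M) => x.
apply: le_trans (proj_seq_contract os _) _; apply: le_trans (hM _) _.
by rewrite ler_wpM2l ?(ltW M0)//; exact: proj_seq_contract.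
Qed.

(** Composition with the complementary projection kills the basis vectors of [s]
    and leaves the tail of the sum. *)
Lemma hs2_tail s K d k : uniq s -> [set` s] `<=` C -> linear K ->
  hs2 C K = k%:E -> k - d <= \sum_(e <- s) `|K e| ^+ 2 ->
  (hs2 C (fun x => (K (x - proj_seq s x))%R) <= d%:E)%E.
Proof.
move=> us sC lK kE hd; have os := onb_seq oC us sC.
apply: hs2_le_sq => u uu uC.
have -> : \sum_(e <- u) `|K (e - proj_seq s e)| ^+ 2 = \sum_(e <- u | e \notin s) `|K e| ^+ 2.
  rewrite [RHS]big_mkcond /=; rewrite !big_seq; apply: eq_bigr => e eu.
  have [es|nes] := boolP (e \in s).
    by rewrite proj_seq_in// subrr (linp0 lK) normr0 expr0n.
  by rewrite (proj_seq_out (onb_orthonormal oC) sC (uC _ eu))// subr0.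
have : ((\sum_(e <- s ++ [seq e <- u | e \notin s]) `|K e| ^+ 2)%:E <= hs2 C K)%E.
  apply: hs2_seq.
    rewrite cat_uniq us filter_uniq// andbT; apply/hasPn => e.
    by rewrite mem_filter => /andP[].
  by move=> e /=; rewrite mem_cat mem_filter => /orP[/sC//|/andP[_ /uC]].
rewrite kE lee_fin big_cat /= big_filter; move: hd.
by move: (\sum_(e <- s) _) (\sum_(e <- u | _) _) => p q; lra.
Qed.

(** [K - P K P = (1 - P) K + P K (1 - P)].  The second term is dominated by [K (1
    - P)], and the first has the same Hilbert-Schmidt norm as [K (1 - P)], to
    which it is adjoint up to sign. *)
Lemma hs2_compression s K : ortho_seq s -> signed_adjoint sg K ->
  (hs2 C (fun x => (K x - proj_seq s (K (proj_seq s x)))%R) <=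
    4%:E * hs2 C (fun x => (K (x - proj_seq s x))%R))%E.
Proof.
move=> os [[lK cK] aK]; set Z := hs2 C (fun x => K _).
have YX : hs2 C (fun x => K x - proj_seq s (K x)) = Z.
  apply: hs2_adjoint => // x y.
  rewrite innerBl proj_seq_sym -innerBr aK exprMn sg2 mul1r//.
have [|] := ltP Z +oo%E; last first.
  by rewrite leye_eq => /eqP ->; rewrite gt0_muley ?leey// lte_fin.
move=> Zfin; have Z0 : (0 <= Z)%E := hs2_ge0 _ _.
have zE : Z = (fine Z)%:E by rewrite fineK// ge0_fin_numE.
rewrite zE -EFinM; apply: hs2_le_sq => u uu uC.
have h1 : \sum_(e <- u) `|K e - proj_seq s (K e)| ^+ 2 <= fine Z.
  by rewrite -lee_fin -zE -YX; exact: hs2_seq.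
have h2 : \sum_(e <- u) `|K (e - proj_seq s e)| ^+ 2 <= fine Z.
  by rewrite -lee_fin -zE; exact: hs2_seq.
apply: (@le_trans _ _ (2 * \sum_(e <- u) `|K e - proj_seq s (K e)| ^+ 2 +
    2 * \sum_(e <- u) `|K (e - proj_seq s e)| ^+ 2)); last by lra.
rewrite !mulr_sumr -big_split; apply: ler_sum => e _ /=.
have -> : K e - proj_seq s (K (proj_seq s e)) =
    (K e - proj_seq s (K e)) + proj_seq s (K (e - proj_seq s e)).
  by rewrite (linpB lK) (linpB (proj_seq_linear s)) addrA subrK.
set a := K e - _; set b := proj_seq s _.
have hb : `|b| ^+ 2 <= `|K (e - proj_seq s e)| ^+ 2.
  by rewrite ler_pXn2r ?nnegrE// proj_seq_contract.
have := sqr_ge0 `|a - b|; rewrite normB_sq normD_sq.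
by move: hb; move: (`|b| ^+ 2) (`|a| ^+ 2) (inner a b) (`|K _| ^+ 2) => x y z w; lra.
Qed.

Lemma hs_density K eps : signed_adjoint sg K -> (hs2 C K < +oo)%E -> 0 < eps ->
  exists T, [/\ signed_adjoint sg T, finite_rank T & (hs_norm (K - T)%R < eps%:E)%E].
Proof.
move=> sK /hs_normE[k [k0 kE _]] e0.
(* The compression costs a factor 4, and 4 (eps^2 / 16) = (eps / 2)^2. *)
have d0 : 0 < eps ^+ 2 / 16 by rewrite divr_gt0 ?exprn_gt0.
have [s [us sC hs]] := esum_approx kE d0.
have os := onb_seq oC us sC; have [[lK _] _] := sK.
exists (fun x => proj_seq s (K (proj_seq s x))); split; first exact: compression_signed.
  by apply: (@finite_rank_seq _ _ s _ (fun e x => inner e (K (proj_seq s x)))).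
apply: (@le_lt_trans _ _ (eps / 2)%:E); last by rewrite lte_fin; lra.
apply/hs_norm_le; first by rewrite ltW ?divr_gt0.
apply: le_trans (hs2_compression os sK) _.
apply: le_trans (lee_wpmul2l _ (hs2_tail us sC lK kE (ltW hs))) _; first by rewrite lee_fin.
by rewrite -EFinM lee_fin le_eqVlt; apply/orP; left; apply/eqP; field.
Qed.

Lemma finite_rank_proj T : finite_rank T -> exists2 s, ortho_seq s & forall x, proj_seq s (T x) = T x.
Proof.
move=> [n [e he]]; have [s [os [_ hs]]] := gram_schmidt e; exists s => // x.
have [c ->] := he x; elim/big_ind: _ => [|y z hy hz|i _].
- by rewrite (linp0 (proj_seq_linear s)).
- by rewrite proj_seqD hy hz.
- by rewrite proj_seqZ hs.
Qed.

(** As [T = P T] for a projection [P] of finite rank, [T] is up to sign the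
    adjoint of [T P], which vanishes on all but finitely many vectors of a
    basis adapted to [P]. *)
Lemma finite_rank_hs T : signed_adjoint sg T -> finite_rank T -> (hs2 C T < +oo)%E.
Proof.
move=> [[lT _] aT] /finite_rank_proj[s os hs]; have [us os'] := os.
have [D sD oD] := onb_extend os'.
rewrite (@hs2_adjoint _ _ cH C D T (fun x => T (proj_seq s x)))//; last first.
  by move=> x y; rewrite -hs proj_seq_sym aT exprMn sg2 mul1r.
rewrite /hs2 -(esum_supp_eq sD).
- by rewrite esum_seq// ltry.
- by move=> e _; rewrite lee_fin sqr_ge0.
- move=> e De nes; rewrite (proj_seq_out (onb_orthonormal oD) sD De) ?(linp0 lT) ?normr0 ?expr0n//.
  exact/negP.
Qed.

Lemma hs2_lincomb a T S : (hs2 C T < +oo)%E -> (hs2 C S < +oo)%E ->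
  (hs2 C (fun x => (a *: T x + S x)%R) < +oo)%E.
Proof.
move=> /hs_norm_lty hT /hs_norm_lty hS; apply/hs_norm_lty.
apply: le_lt_trans (hs_normD _ _) _; rewrite hs_normZ; apply: lte_add_pinfty => //.
apply: lte_mul_pinfty => //; rewrite ?lee_fin//.
Qed.
End Compression.

Lemma ereal_cvg0 (R : realType) (a : nat -> \bar R) : (forall n, (0 <= a n)%E) ->
  (forall eps : R, 0 < eps -> exists n0, forall n, (n0 <= n)%N -> (a n <= eps%:E)%E) ->
  a @ \oo --> 0%E.
Proof.
move=> a0 h; apply/fine_cvgP; split.
  have [n0 h0] := h 1 ltr01; exists n0 => // n /= hn.
  by rewrite ge0_fin_numE//; exact: le_lt_trans (h0 n hn) (ltry _).
apply/cvgrPdist_le => eps e0; have [n0 h0] := h eps e0; exists n0 => // n /= hn.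
rewrite sub0r normrN ger0_norm; last exact: fine_ge0.
rewrite -lee_fin fineK ?h0//.
by rewrite ge0_fin_numE//; exact: le_lt_trans (h0 n hn) (ltry _).
Qed.

(** * Completions of the two operator spaces *)

Section HSCompletion.
Variables (R : realType) (H : innerProductType R) (cH : @cauchy_complete R H).
Implicit Types (T K S : H -> H) (s : seq H).
Notation C := (@onb R H).

Let n1 : `|-1 : R| = 1. Proof. by rewrite normrN1. Qed.

Lemma skew_hsP K : skew_adjoint K /\ hilbert_schmidt K <-> signed_adjoint (-1) K /\ (hs2 C K < +oo)%E.
Proof.
split=> [[/skewE sK [_ /hs_norm_lty hK]]//|[/skewE sK hK]]; split => //; split; first by case: sK.
exact/hs_norm_lty.
Qed.

Lemma hs_completion : @is_completion R (H -> H)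
  [set K | skew_adjoint K /\ finite_rank K] (@hs_norm R H)
  [set K | skew_adjoint K /\ hilbert_schmidt K] (@hs_norm R H).
Proof.
have DX K : skew_adjoint K -> finite_rank K -> skew_adjoint K /\ hilbert_schmidt K.
  move=> /skewE sK fK; apply/skew_hsP; split => //; exact: (finite_rank_hs cH n1 sK fK).
have D0 : skew_adjoint (0 : H -> H) /\ finite_rank (0 : H -> H).
  by split; [apply/skewE; exact: signed_0|exact: finite_rank_0].
split.
- split => //.
  + move=> a x y [/skewE sx fx] [/skewE sy fy]; split; last exact: finite_rank_lincomb.
    by apply/skewE; exact: signed_lincomb.
  + by case: D0 => h1 h2; exact: DX.
  + move=> a x y /skew_hsP[sx hx] /skew_hsP[sy hy]; apply/skew_hsP.
    by split; [exact: signed_lincomb|exact: hs2_lincomb].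
- split.
  + by move=> x [_ [_ h]]; rewrite ge0_fin_numE// hs_norm_ge0.
  + by move=> x y _ _; exact: hs_normD.
  + by move=> a x _; exact: hs_normZ.
  + move=> x [sx _]; have lx := skew_linear sx; apply: (hs_norm_eq0 cH lx); exact: skew_sos.
- by split => // x [h1 h2]; exact: DX.
- move=> x eps /skew_hsP[sx hx] e0; have [T [sT fT hT]] := hs_density cH n1 sx hx e0.
  by exists T => //; split => //; exact/skewE.
- move=> u Xu cu.
  have su n : signed_adjoint (-1) (u n) by apply/skewE; case: (Xu n).
  have [T [sT uT hT dT]] := hs_limit cH n1 su cu.
  have [n0 h0] := hT _ ltr01; exists T.
    apply/skew_hsP; split => //.
    have -> : T = fun x => (-1 *: (u n0 - T)%R x + u n0 x).
      by apply/funext => x /=; rewrite scaleN1r opprB subrK.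
    apply: hs2_lincomb; first by apply/hs_norm_lty; exact: le_lt_trans (h0 _ (leqnn _)) (ltry _).
    by case: (Xu n0) => _ [_ /hs_norm_lty].
  by apply: ereal_cvg0 => // n; exact: hs_norm_ge0.
Qed.
End HSCompletion.

Section TraceCompletion.
Variables (R : realType) (H : innerProductType R) (cH : @cauchy_complete R H).
Implicit Types (T K S : H -> H) (s : seq H).
Notation C := (@onb R H).

Let n1 : `|1 : R| = 1. Proof. exact: normr1. Qed.

Lemma sa_trace_classP S : self_adjoint S /\ trace_class S <->
  [/\ signed_adjoint 1 S, (hs2 C S < +oo)%E & (nuc S < +oo)%E].
Proof.
split=> [[sS tS]|[/saE sS hS nS]]; last by split => //; exact: (hs_trace_class cH sS hS nS).
have hS := trace_class_hs sS tS; split => //; first exact/saE.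
by rewrite -(trace_norm_nuc cH sS hS); case: tS.
Qed.

Lemma trace_norm_nucE S : self_adjoint S /\ trace_class S -> trace_norm S = nuc S.
Proof. by move=> [sS tS]; apply: (trace_norm_nuc cH sS); exact: (trace_class_hs sS tS). Qed.

(** <f, S f> = <S P f, P f> for a projection [P] of finite rank, and [\sum |P
    f|^2] is bounded over orthonormal families. *)
Lemma finite_rank_trace_class S : self_adjoint S -> finite_rank S -> trace_class S.
Proof.
move=> sS fS; have /saE sS' := sS; have [M M0 hM] := sa_bound sS.
have hS := finite_rank_hs cH n1 sS' fS.
apply: (hs_trace_class cH sS hS).
have [s os hs] := finite_rank_proj fS.
apply: (@le_lt_trans _ _ (M * \sum_(e <- s) `|e| ^+ 2)%:E); last exact: ltry.
apply: nuc_le => t ot; rewrite lee_fin.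
apply: (@le_trans _ _ (\sum_(f <- t) M * `|proj_seq s f| ^+ 2)).
  apply: ler_sum => f _.
  have -> : inner f (S f) = inner (S (proj_seq s f)) (proj_seq s f).
    by rewrite -{1}hs -proj_seq_sym -(sS.2) -[X in inner X f]hs proj_seq_sym.
  apply: le_trans (cauchy_schwarz _ _) _; rewrite expr2 mulrA ler_wpM2r//.
rewrite -mulr_sumr ler_wpM2l ?(ltW M0)//.
under eq_bigr do rewrite proj_seq_norm2//.
rewrite exchange_big /=; apply: ler_sum => e _.
by under eq_bigr do rewrite innerC; exact: bessel.
Qed.

(** Truncating the eigenvector expansion leaves an operator with the remaining
    eigenvalues. *)
Lemma trace_density S eps : self_adjoint S -> trace_class S -> 0 < eps ->
  exists T, [/\ self_adjoint T, finite_rank T & (trace_norm (S - T)%R < eps%:E)%E].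
Proof.
move=> sS tS e0; have hS := trace_class_hs sS tS; have lS := sa_linear sS.
have [B [lam [oB eB]]] := spectral_hs cH sS hS.
have tE := trace_norm_eig cH sS hS oB eB.
have [k kE] : exists k, trace_norm S = k%:E.
  exists (fine (trace_norm S)); rewrite fineK// ge0_fin_numE; first by case: tS.
  by rewrite tE; apply: esum_ge0 => e _; rewrite lee_fin.
have e20 : 0 < eps / 2 by rewrite divr_gt0.
have [s [us sB hs]] := esum_approx (esym (etrans (esym kE) tE)) e20.
have os := onb_seq oB us sB.
pose T x := S (proj_seq s x).
have ST x : S (proj_seq s x) = \sum_(e <- s) (lam e * inner e x) *: e.
  rewrite /proj_seq (linp_sum lS) !big_seq; apply: eq_bigr => e es.
  by rewrite (linpZ lS) (eB _ (sB _ es)) scalerA mulrC.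
have sT : self_adjoint T.
  have [M M0 hM] := sa_bound sS.
  have l : linear T by move=> a x y; rewrite /T proj_seq_linear lS.
  split; last first.
    move=> x y; rewrite /T !ST inner_suml inner_sumr; apply: eq_bigr => e _.
    by rewrite innerZl innerZr (innerC x e); ring.
  split => //; apply: (@linp_bound_continuous _ _ _ _ l M) => x; apply: le_trans (hM _) _.
  by rewrite ler_wpM2l ?(ltW M0)//; exact: proj_seq_contract.
have fT : finite_rank T by apply: (@finite_rank_seq _ _ s _ (fun e x => lam e * inner e x)).
have tT := finite_rank_trace_class sT fT; have hT := trace_class_hs sT tT.
exists T; split => //.
have sD : self_adjoint (S - T)%R.
  have := sa_lincomb (-1) sT sS; congr self_adjoint.
  by apply/funext => x /=; rewrite scaleN1r addrC.
have hD : (hs2 C (S - T)%R < +oo)%E.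
  have := hs2_lincomb (-1) hT hS; congr (hs2 _ _ < _)%E.
  by apply/funext => x /=; rewrite scaleN1r addrC.
have eD e : B e -> (S - T)%R e = (if e \in s then 0 else lam e) *: e.
  move=> Be; rewrite [LHS]/= /T -[LHS]/(S e - S (proj_seq s e)); have [es|nes] := boolP (e \in s).
    by rewrite proj_seq_in// subrr scale0r.
  by rewrite (proj_seq_out (onb_orthonormal oB) sB Be nes) (linp0 lS) subr0 eB.
rewrite (trace_norm_eig cH sD hD oB eD).
apply: (@le_lt_trans _ _ (eps / 2)%:E); last by rewrite lte_fin; lra.
apply: esum_le_seq => u uu uB; rewrite lee_fin.
have -> : \sum_(e <- u) `|if e \in s then 0 else lam e| = \sum_(e <- u | e \notin s) `|lam e|.
  by rewrite [RHS]big_mkcond /=; apply: eq_bigr => e _; case: ifP => //; rewrite normr0.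
have : ((\sum_(e <- s ++ [seq e <- u | e \notin s]) `|lam e|)%:E <= trace_norm S)%E.
  rewrite tE; apply: seq_le_esum.
    rewrite cat_uniq us filter_uniq// andbT; apply/hasPn => e.
    by rewrite mem_filter => /andP[].
  by move=> e /=; rewrite mem_cat mem_filter => /orP[/sB//|/andP[_ /uB]].
rewrite kE lee_fin big_cat /= big_filter; move: hs.
by move: (\sum_(e <- s) _) (\sum_(e <- u | _) _) => p q; lra.
Qed.

Lemma hs_norm_le_nuc T eps : self_adjoint T -> (hs2 C T < +oo)%E -> 0 <= eps ->
  (nuc T <= eps%:E)%E -> (hs_norm T <= eps%:E)%E.
Proof.
move=> sT hT e0 h; apply/hs_norm_le => //; apply: le_trans (hs2_le_nuc cH sT hT) _.
by rewrite expr2 EFinM; apply: lee_pmul => //; exact: nuc_ge0.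
Qed.

(** Each finite sum in [nuc] is continuous for pointwise convergence. *)
Lemma nuc_limit_le (u : nat -> H -> H) T S (eps : R) n0 :
  (forall x, u n x @[n --> \oo] --> T x) ->
  (forall n, (n0 <= n)%N -> (nuc (S - u n)%R <= eps%:E)%E) -> (nuc (S - T)%R <= eps%:E)%E.
Proof.
move=> uT h; apply: nuc_le => s os; rewrite lee_fin.
have hc : \sum_(f <- s) `|inner f (S f - u n f)| @[n --> \oo] --> \sum_(f <- s) `|inner f (S f - T f)|.
  elim: (s) => [|e t IH]; first by under eq_fun do rewrite big_nil; rewrite big_nil; exact: cvg_cst.
  under eq_fun do rewrite big_cons; rewrite big_cons; apply: cvgD => //.
  apply: cvg_norm; apply: cvg_innerl; apply: cvgB => //; exact: cvg_cst.
apply: le_trans (ler_norm _) _; apply: (norm_limit_le (n0 := n0) hc) => n hn.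
rewrite ger0_norm; last by apply: sumr_ge0 => e _.
by rewrite -lee_fin; apply: le_trans (h n hn); exact: (nuc_ge (S - u n)%R).
Qed.

(** A Cauchy sequence for the trace norm is one for the Hilbert-Schmidt norm;
    lower semicontinuity of [nuc] turns the Hilbert-Schmidt limit into a limit
    in trace norm. *)
Lemma trace_completion : @is_completion R (H -> H)
  [set S | self_adjoint S /\ finite_rank S] (@trace_norm R H)
  [set S | self_adjoint S /\ trace_class S] (@trace_norm R H).
Proof.
have DX S : self_adjoint S -> finite_rank S -> self_adjoint S /\ trace_class S.
  by move=> sS fS; split => //; exact: finite_rank_trace_class.
have D0 : self_adjoint (0 : H -> H) /\ finite_rank (0 : H -> H).
  by split; [apply/saE; exact: signed_0|exact: finite_rank_0].
have XP (a : R) (x y : H -> H) : self_adjoint x /\ trace_class x -> self_adjoint y /\ trace_class y ->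
    self_adjoint (a *: x + y) /\ trace_class (a *: x + y).
  move=> /sa_trace_classP[sx hx nx] /sa_trace_classP[sy hy ny]; apply/sa_trace_classP; split.
  - exact: signed_lincomb.
  - exact: hs2_lincomb.
  - apply: le_lt_trans (nucD _ _) _; rewrite nucZ; apply: lte_add_pinfty => //.
    by apply: lte_mul_pinfty => //; rewrite ?lee_fin.
have XB (x y : H -> H) : self_adjoint x /\ trace_class x -> self_adjoint y /\ trace_class y ->
    self_adjoint (x - y) /\ trace_class (x - y).
  by move=> hx hy; rewrite addrC -scaleN1r; exact: XP.
have XZ (a : R) (x : H -> H) : self_adjoint x /\ trace_class x -> self_adjoint (a *: x) /\ trace_class (a *: x).
  by move=> hx; rewrite -[a *: x]addr0; apply: XP => //; case: D0 => h1 h2; exact: DX.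
have XD (x y : H -> H) : self_adjoint x /\ trace_class x -> self_adjoint y /\ trace_class y ->
    self_adjoint (x + y) /\ trace_class (x + y).
  by move=> hx hy; rewrite -[x]scale1r; exact: XP.
split.
- split => //.
  + move=> a x y [sx fx] [sy fy]; split; last exact: finite_rank_lincomb.
    exact: sa_lincomb.
  + by case: D0 => h1 h2; exact: DX.
- split.
  + move=> x hx; rewrite trace_norm_nucE// ge0_fin_numE ?nuc_ge0//.
    by case/sa_trace_classP: hx.
  + move=> x y hx hy; rewrite !trace_norm_nucE//; first exact: nucD.
    exact: XD.
  + move=> a x hx; rewrite !trace_norm_nucE//; first exact: nucZ.
    exact: XZ.
  + move=> x hx; rewrite trace_norm_nucE// => h; apply/funext => y.
    by apply: nuc_eq0 h y; case: hx.
- by split => // x [h1 h2]; exact: DX.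
- move=> x eps [sx tx] e0; have [T [sT fT hT]] := trace_density sx tx e0.
  by exists T.
- move=> u Xu cu.
  have su n : signed_adjoint 1 (u n) by apply/saE; case: (Xu n).
  have cu' eps : 0 < eps -> exists n0, forall m n, (n0 <= m)%N -> (n0 <= n)%N ->
      (nuc (u m - u n)%R < eps%:E)%E.
    move=> e0; have [n0 h0] := cu _ e0; exists n0 => m n hm hn.
    by rewrite -(trace_norm_nucE (XB _ _ (Xu m) (Xu n))); exact: h0.
  have hu eps : 0 < eps -> exists n0, forall m n, (n0 <= m)%N -> (n0 <= n)%N ->
      (hs_norm (u m - u n)%R < eps%:E)%E.
    move=> e0; have e20 : 0 < eps / 2 by rewrite divr_gt0.
    have [n0 h0] := cu' _ e20; exists n0 => m n hm hn.
    apply: (@le_lt_trans _ _ (eps / 2)%:E); last by rewrite lte_fin; lra.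
    have /sa_trace_classP[/saE sd hd _] := XB _ _ (Xu m) (Xu n).
    by apply: hs_norm_le_nuc => //; [exact: ltW|exact: ltW (h0 m n hm hn)].
  have [T [sT uT hT dT]] := hs_limit cH n1 su hu.
  have nT eps : 0 < eps -> exists n0, forall n, (n0 <= n)%N -> (nuc (u n - T)%R <= eps%:E)%E.
    move=> e0; have [n0 h0] := cu' _ e0; exists n0 => n hn.
    by apply: (nuc_limit_le (n0 := n0) uT) => m hm; exact: ltW (h0 n m hn hm).
  have XT : self_adjoint T /\ trace_class T.
    have [n0 h0] := hT _ ltr01; have [n2 h2] := nT _ ltr01; set N := maxn n0 n2.
    have TE : T = fun x => (-1 *: (u N - T)%R x + u N x).
      by apply/funext => x /=; rewrite scaleN1r opprB subrK.
    have /sa_trace_classP[_ hN nN] := Xu N.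
    apply/sa_trace_classP; split => //.
      rewrite TE; apply: hs2_lincomb => //; apply/hs_norm_lty.
      by apply: le_lt_trans (h0 N (leq_maxl _ _)) (ltry _).
    rewrite TE; apply: le_lt_trans (nucD _ _) _; rewrite nucZ; apply: lte_add_pinfty => //.
    apply: lte_mul_pinfty => //; rewrite ?lee_fin//.
    by apply: le_lt_trans (h2 N (leq_maxr _ _)) (ltry _).
  exists T => //; apply: ereal_cvg0 => [n|eps e0].
    by rewrite (trace_norm_nucE (XB _ _ (Xu n) XT)) nuc_ge0.
  have [n0 h0] := nT _ e0; exists n0 => n hn.
  by rewrite (trace_norm_nucE (XB _ _ (Xu n) XT)); exact: h0.
Qed.
End TraceCompletion.

(** * Orthogonal naturality *)

Section Isometry.
Variables (R : realType) (E F : innerProductType R) (fE : @findim R E).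
Variables (U : {linear E -> F}) (V : F -> E).
Hypotheses (UK : cancel U V) (VK : cancel V U).
Hypothesis Uiso : forall x y, inner (U x) (U y) = inner x y.

Let Unorm x : `|U x| = `|x|.
Proof.
by apply/eqP; rewrite -(@eqrXn2 _ 2)// -!inner_normE Uiso.
Qed.

Let Vlin : linear V.
Proof. by move=> a x y; rewrite -[x in LHS]VK -[y in LHS]VK -linearP UK. Qed.

Lemma isometry_findim : @findim R F.
Proof.
have [n [e he]] := fE; exists n, (U \o e) => x; have [c hc] := he (V x).
by exists c; rewrite -[LHS]VK hc linear_sum; apply: eq_bigr => i _; rewrite linearZ.
Qed.

Lemma conj_signed sg T : signed_adjoint sg T -> signed_adjoint sg (U \o T \o V).
Proof.
move=> [[lT _] aT]; have l : linear (U \o T \o V).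
  by move=> a x y /=; rewrite Vlin lT linearP.
split; first by split => //; exact: (findim_linear_continuous isometry_findim).
by move=> x y /=; rewrite -[y in LHS]VK Uiso aT -[x in RHS]VK Uiso.
Qed.
Lemma conj_skew K : skew_adjoint K -> skew_adjoint (U \o K \o V).
Proof. by move=> /skewE sK; apply/skewE; exact: conj_signed. Qed.
Lemma conj_sa S : self_adjoint S -> self_adjoint (U \o S \o V).
Proof. by move=> /saE sS; apply/saE; exact: conj_signed. Qed.

(** [U] maps a basis of [E] onto a basis of [F]. *)
Lemma hs_norm_conj K : skew_adjoint K -> hs_norm (U \o K \o V) = hs_norm K.
Proof.
move=> sK; have [n1 o1 t1] := onbP E; rewrite /hs_norm; congr poweR.
have oD : is_onb (U @` @onb R E).
  split.
  - by move=> _ [e Be <-]; rewrite Unorm n1.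
  - by move=> _ _ [e Be <-] [f Bf <-] ef; rewrite Uiso o1// => ef'; apply: ef; rewrite ef'.
  - move=> x hx; rewrite -[x]VK (t1 (V x)) ?linear0// => e Be.
    by rewrite -Uiso VK hx//; exists e.
rewrite -/(hs2 _ _) -/(hs2 _ K).
rewrite (hs2_onb (findim_complete isometry_findim) (skew_sos (conj_skew sK)) (onbP F) oD) /hs2.
rewrite (reindex_esum (@onb R E) (U @` @onb R E) U).
  by apply: eq_esum => e _ /=; rewrite UK Unorm.
split; first by move=> e Be; exists e.
- by move=> e f _ _; exact: (can_inj UK).
- by move=> _ [e Be <-]; exists e.
Qed.

Lemma op_norm_conj S : op_norm (U \o S \o V) = op_norm S.
Proof.
rewrite /op_norm; congr ereal_sup; apply/seteqP; split => _ [x /= nx <-].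
  by exists (V x); [rewrite /= -Unorm VK|rewrite /= Unorm].
by exists (U x); [rewrite /= Unorm|rewrite /= UK Unorm].
Qed.
End Isometry.

(** * Exhaustion by projections *)

Section ProjectionRange.
Variables (R : realType) (H : innerProductType R) (P : {linear H -> H}).
Hypothesis oP : orthogonal_projection P.
Let PP x : P (P x) = P x := oP.2 x.
Let Psym x y : inner (P x) y = inner x (P y) := oP.1.2 x y.

Lemma projection_contract x : `|P x| <= `|x|.
Proof.
have [z|nz] := eqVneq `|P x| 0; first by rewrite z.
have np : 0 < `|P x| by rewrite lt_neqAle eq_sym nz /=.
by rewrite -(ler_pM2r np) -expr2 -inner_normE Psym PP inner_le.
Qed.

Lemma rangesp_val (x : rangesp P) : P (subspace_val x) = subspace_val x.
Proof. by case: x => x /= /asboolP[y ->]; exact: PP. Qed.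

Lemma mem_rangesp x : P x \in subspace_pred (rangesp P).
Proof. by apply/asboolP; exists x. Qed.

(** Vectors spanning the range become elements of it once projected. *)
Lemma rangesp_findim : finite_rank P -> @findim R (rangesp P).
Proof.
move=> /finite_rank_proj[s os hs].
exists (size s), (fun i : 'I_(size s) => SubspaceElt (mem_rangesp s`_i)) => x.
exists (fun i : 'I_(size s) => inner s`_i (subspace_val x)); apply: val_inj => /=.
transitivity (P (proj_seq s (subspace_val x))).
  by rewrite -[in RHS](rangesp_val x) hs PP rangesp_val.
rewrite /proj_seq (big_nth 0) big_mkord linear_sum.
by elim/big_rec2: _ => // i u v _ ->; rewrite linearZ.
Qed.

Lemma compression_supported (T : H -> H) : linear T -> supported_on (rangesp P) (P \o T \o P).
Proof.
move=> lT; split; first by move=> x; exact: mem_rangesp.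
move=> x hx; suff Px : P x = 0 by rewrite /= Px (linp0 lT) linear0.
apply/eqP; rewrite -norm_sq0 -inner_normE -Psym PP; apply/eqP.
exact: (hx (SubspaceElt (mem_rangesp x))).
Qed.

Lemma projection_signed sg (T : H -> H) : signed_adjoint sg T -> signed_adjoint sg (P \o T \o P).
Proof.
move=> sT; have [M M0 hM] := signed_bound sT; have [[lT _] aT] := sT.
have l : linear (P \o T \o P) by move=> a x y /=; rewrite linearP lT linearP.
split; last by move=> x y /=; rewrite Psym aT Psym.
split => //; apply: (@linp_bound_continuous _ _ _ _ l M) => x /=.
apply: le_trans (projection_contract _) _; apply: le_trans (hM _) _.
by rewrite ler_wpM2l ?(ltW M0)// projection_contract.
Qed.
End ProjectionRange.

Section Exhaustion.
Variables (R : realType) (H : innerProductType R).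
Variable P : nat -> {linear H -> H}.
Hypothesis oP : forall n, orthogonal_projection (P n) /\ finite_rank (P n).
Hypothesis cP : forall x, (fun n => P n x) @ \oo --> x.

Lemma compression_cvg sg (T : H -> H) x : signed_adjoint sg T ->
  (fun n => P n (T (P n x))) @ \oo --> T x.
Proof.
move=> sT; have [M M0 hM] := signed_bound sT; have [[lT _] _] := sT.
apply/cvgrPdist_lt => eps e0.
have e2 : 0 < eps / 2 by rewrite divr_gt0.
have e3 : 0 < eps / 2 / M by rewrite divr_gt0.
have /cvgrPdist_lt/(_ _ e2)[N1 _ h1] := @cP (T x).
have /cvgrPdist_lt/(_ _ e3)[N2 _ h2] := @cP x.
exists (maxn N1 N2) => // n /=; rewrite geq_max => /andP[n1 n2].
have -> : T x - P n (T (P n x)) = (T x - P n (T x)) + P n (T (x - P n x)).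
  by rewrite (linpB lT) linearB addrA subrK.
apply: le_lt_trans (ler_normD _ _) _; rewrite [eps]splitr; apply: ltrD; first exact: h1.
apply: le_lt_trans (projection_contract (oP n).1 _) _; apply: le_lt_trans (hM _) _.
by rewrite mulrC -ltr_pdivlMr//; exact: h2.
Qed.

(** [S x] is the limit of [P S P x], where [P x] lies in the unit ball of the
    range. *)
Lemma op_norm_exhaustion S : self_adjoint S ->
  ereal_sup (range (fun n => op_norm (restr (E := rangesp (P n)) (P n \o S \o P n)))) = op_norm S.
Proof.
move=> sS; have lS := sa_linear sS; have /saE sS' := sS; have [M0 M0p hM0] := sa_bound sS.
have vE n x : `|restr (E := rangesp (P n)) (P n \o S \o P n) x| = `|P n (S (subspace_val x))|.
  rewrite -[LHS]/(`|subspace_val (restr (E := rangesp (P n)) (P n \o S \o P n) x)|).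
  by rewrite (val_restr (compression_supported (oP n).1 lS)) /= rangesp_val//; case: (oP n).
have up n : (op_norm (restr (E := rangesp (P n)) (P n \o S \o P n)) <= op_norm S)%E.
  apply: ge_ereal_sup => _ [x /= nx <-]; rewrite vE.
  apply: (@le_trans _ _ `|S (subspace_val x)|%:E).
    by rewrite lee_fin; apply: projection_contract; case: (oP n).
  by apply: ereal_sup_ubound; exists (subspace_val x).
apply/eqP; rewrite eq_le; apply/andP; split; first by apply: ge_ereal_sup => _ [n _ <-].
set M := ereal_sup _.
have hM n (x : rangesp (P n)) : `|x| <= 1 -> (`|P n (S (subspace_val x))|%:E <= M)%E.
  move=> nx; rewrite -vE; apply: (@le_trans _ _ (op_norm (restr (E := rangesp (P n)) (P n \o S \o P n)))).
    by apply: ereal_sup_ubound; exists x.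
  by apply: ereal_sup_ubound; exists n.
have M00 : (0 <= M)%E by apply: le_trans (hM 0%N 0 _); rewrite ?lee_fin ?normr0.
have mE : M = (fine M)%:E.
  rewrite fineK// ge0_fin_numE//; apply: (@le_lt_trans _ _ M0%:E); last exact: ltry.
  apply: ge_ereal_sup => _ [n _ <-]; apply: le_trans (up n) _.
  apply: ge_ereal_sup => _ [x /= nx <-]; rewrite lee_fin; apply: le_trans (hM0 x) _.
  by rewrite ler_piMr// ltW.
apply: ge_ereal_sup => _ [x /= nx <-]; rewrite mE lee_fin.
apply: (norm_limit_le (n0 := 0%N) (compression_cvg (x := x) sS')) => n _.
have [oPn _] := oP n; rewrite -lee_fin -mE.
apply: (hM n (SubspaceElt (mem_rangesp (P n) x))).
by apply: le_trans nx; exact: projection_contract.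
Qed.
Hypothesis cH : @cauchy_complete R H.

(** On the range of the projection, [P K P] is [P K], which is no longer than [K]. *)
Lemma hs_norm_compression_le K n : skew_adjoint K -> hilbert_schmidt K ->
  (hs_norm (restr (E := rangesp (P n)) (P n \o K \o P n)) <= hs_norm K)%E.
Proof.
move=> sK [_ /hs_norm_lty/hs_normE[k [k0 kE ->]]]; have lK := skew_linear sK.
have [oPn fPn] := oP n; have sup := compression_supported oPn lK.
apply/hs_norm_le; first exact: sqrtr_ge0.
rewrite sqr_sqrtr// -kE.
have [C oC [VC _]] := onb_of_subspace (rangesp_findim oPn fPn) sup (onbP _).
apply: le_trans (hs2_le_ortho cH (skew_sos sK) (onbP H) (orthonormalS VC (onb_orthonormal oC))).
rewrite /hs2 -(esum_subspace _ (fun e => `|K e| ^+ 2)); apply: le_esum => e _.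
rewrite lee_fin ler_pXn2r ?nnegrE//.
rewrite -[leLHS]/(`|subspace_val (restr (E := rangesp (P n)) (P n \o K \o P n) e)|).
by rewrite (val_restr sup) /= rangesp_val//; exact: projection_contract.
Qed.

(** Every finite part of the Hilbert-Schmidt sum of [K] is the limit of the
    corresponding parts for the compressions. *)
Lemma hs_norm_exhaustion K : skew_adjoint K -> hilbert_schmidt K ->
  ereal_sup (range (fun n => hs_norm (restr (E := rangesp (P n)) (P n \o K \o P n)))) = hs_norm K.
Proof.
move=> sK hK; have lK := skew_linear sK; have /skewE sK' := sK.
apply/eqP; rewrite eq_le; apply/andP; split.
  by apply: ge_ereal_sup => _ [n _ <-]; exact: hs_norm_compression_le.
set M := ereal_sup _.
have hM n : (hs_norm (restr (E := rangesp (P n)) (P n \o K \o P n)) <= M)%E.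
  by apply: ereal_sup_ubound; exists n.
have M0 : (0 <= M)%E by apply: le_trans (hM 0%N); exact: hs_norm_ge0.
have mE : M = (fine M)%:E.
  rewrite fineK// ge0_fin_numE//; case: (hK) => _; apply: le_lt_trans.
  by apply: ge_ereal_sup => _ [n _ <-]; exact: hs_norm_compression_le.
have m0 : 0 <= fine M by exact: fine_ge0.
rewrite mE; apply/hs_norm_le => //; apply: hs2_le_sq => s us sC.
have hc : \sum_(e <- s) `|P n (K (P n e))| ^+ 2 @[n --> \oo] --> \sum_(e <- s) `|K e| ^+ 2.
  elim: (s) => [|e t IH]; first by under eq_fun do rewrite big_nil; rewrite big_nil; exact: cvg_cst.
  under eq_fun do rewrite big_cons; rewrite big_cons; apply: cvgD => //.
  by apply: cvg_norm_sq; exact: compression_cvg sK'.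
apply: le_trans (ler_norm _) _; apply: (norm_limit_le (n0 := 0%N) hc) => n _.
rewrite ger0_norm; last by apply: sumr_ge0 => e _; exact: sqr_ge0.
have [oPn fPn] := oP n; have sup := compression_supported oPn lK.
have sT : sym_or_skew (P n \o K \o P n).
  by apply: (signed_sos (normrN1 _)); exact: projection_signed.
rewrite -lee_fin; apply: le_trans (hs2_seq (P n \o K \o P n) us sC) _.
rewrite -(hs2_restr cH (rangesp_findim oPn fPn) sup sT).
by apply/hs_norm_le => //; rewrite -mE; exact: hM.
Qed.

End Exhaustion.

(** * The response theorem *)

Section ResponseCompletion.
Variables (R : realType) (H : innerProductType R) (cH : @cauchy_complete R H).

Lemma response_completion :
  is_completion (@response_fin R H) (@response_norm R H) (@response_full R H) (@response_norm R H).
Proof.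
have := is_completion_prod (is_completion_prod (is_completion_self cH) (hs_completion cH))
  (trace_completion cH).
have -> : @response_norm R H = (fun x => maxe (maxe `|x.1.1|%:E (hs_norm x.1.2)) (trace_norm x.2)).
  by apply/funext => x; rewrite /response_norm maxA.
set A := [set x | _]; have -> : A = @response_fin R H.
  by apply/seteqP; split => x; [move=> [[_ [a b]] [c d]]|move=> [a b c d]]; split.
set B := [set x | _]; have -> : B = @response_full R H.
  by apply/seteqP; split => x; [move=> [[_ [a b]] [c d]]|move=> [a b c d]]; split.
by [].
Qed.
End ResponseCompletion.

Theorem theorem3p7 (R : realType) (beta : brownian R^o) :
  [/\
  (* calibration *)
   forall (E : innerProductType R) (B : brownian E) (K S : E -> E),
     findim E -> skew_adjoint K -> self_adjoint S ->
     cA B K = hs_norm K /\ cQ beta S = op_norm S,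
  (* dual state gauges *)
   forall (H : hilbertType R) (E : lsubspace H) (B : brownian E) (a q : H -> H),
     separable_space H -> findim E ->
     skew_adjoint a -> finite_rank a -> supported_on E a ->
     self_adjoint q -> finite_rank q -> supported_on E q ->
     dualA B (restr a) = hs_norm a /\
     dualQ beta (restr (E := E) q) = trace_norm q,
  (* response completion *)
   forall (H : hilbertType R) (E : response H -> lsubspace H)
          (B : forall x : response H, brownian (E x)),
     separable_space H ->
     (forall x : response H, response_fin x ->
        [/\ findim (E x), supported_on (E x) x.1.2 & supported_on (E x) x.2]) ->
     is_completion (@response_fin R H) (fun x => response_gauge beta (B x) x)
                   (@response_full R H) (@response_norm R H),
  (* orthogonal naturality *)
   forall (E F : innerProductType R) (BE : brownian E) (BF : brownian F)
          (U : {linear E -> F}) (V : F -> E) (K S : E -> E),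
     findim E -> cancel U V -> cancel V U ->
     (forall x y, inner (U x) (U y) = inner x y) ->
     skew_adjoint K -> self_adjoint S ->
     cA BF (U \o K \o V) = cA BE K /\ cQ beta (U \o S \o V) = cQ beta S &
  (* exhaustion by finite-rank projections *)
   forall (H : hilbertType R) (P : nat -> {linear H -> H})
          (B : forall n, brownian (rangesp (P n))) (K S : H -> H),
     separable_space H ->
     (forall n, orthogonal_projection (P n) /\ finite_rank (P n)) ->
     (forall n x, P n.+1 (P n x) = P n x) ->
     (forall x, (fun n => P n x) @ \oo --> x) ->
     skew_adjoint K -> hilbert_schmidt K -> self_adjoint S ->
     ereal_sup (range (fun n =>
       cA (B n) (restr (P n \o K \o P n)))) = hs_norm K /\
     ereal_sup (range (fun n =>
       cQ beta (restr (E := rangesp (P n)) (P n \o S \o P n)))) = op_norm S].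
Proof.
have dual (H : hilbertType R) (E : lsubspace H) (B : brownian E) (a q : H -> H) :
    findim E -> skew_adjoint a -> supported_on E a -> self_adjoint q -> supported_on E q ->
    dualA B (restr a) = hs_norm a /\ dualQ beta (restr (E := E) q) = trace_norm q.
  move=> fE sa pa sq pq; have cH := @hilbert_complete R H; split.
    by rewrite (dualA_hs_norm fE B (restr_skew fE pa sa)) (hs_norm_restr cH fE pa (skew_sos sa)).
  by rewrite (dualQ_trace_norm fE beta (restr_sa fE pq sq)) (trace_norm_restr cH fE pq sq).
split.
- by move=> E B K S fE sK sS; split; [exact: cA_hs_norm|exact: cQ_op_norm].
- by move=> H E B a q _ fE sa _ pa sq _ pq; exact: dual.
- move=> H E B _ hE; apply: is_completion_gauge (response_completion (@hilbert_complete R H)).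
  move=> x Dx; have [fE pa pq] := hE x Dx; have [sa _ sq _] := Dx.
  by have [h1 h2] := dual H (E x) (B x) _ _ fE sa pa sq pq; rewrite /response_gauge h1 h2.
- move=> E F BE BF U V K S fE UK VK Uiso sK sS.
  have fF := isometry_findim fE VK.
  rewrite (cA_hs_norm fF BF (conj_skew fE UK VK Uiso sK)) (cA_hs_norm fE BE sK).
  rewrite (cQ_op_norm fF beta (conj_sa fE UK VK Uiso sS)) (cQ_op_norm fE beta sS).
  by rewrite (hs_norm_conj fE UK VK Uiso sK) (op_norm_conj UK VK Uiso).
- move=> H P B K S _ oP _ cP sK hK sS; have cH := @hilbert_complete R H.
  rewrite -(hs_norm_exhaustion oP cP cH sK hK) -(op_norm_exhaustion oP cP sS).
  have fP n : findim (rangesp (P n)) by exact: (rangesp_findim (oP n).1 (oP n).2).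
  have supK n := compression_supported (oP n).1 (skew_linear sK).
  have supS n := compression_supported (oP n).1 (sa_linear sS).
  split; congr (ereal_sup (image _ _)); apply/funext => n.
    apply: (cA_hs_norm (fP n)); apply: (restr_skew (fP n) (supK n)).
    by apply/skewE; apply: (projection_signed (oP n).1); exact/skewE.
  apply: (cQ_op_norm (fP n)); apply: (restr_sa (fP n) (supS n)).
  by apply/saE; apply: (projection_signed (oP n).1); exact/saE.
Qed.
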